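(* Let $\gamma\subset\mathbb{C}$ be a Jordan curve with interior $G$, let $J\subseteq\gamma$ be a rectifiable open arc, and let $J'\subseteq J$ be a compact arc. Let $\Phi:D\to G$ be a conformal mapping from the open unit disk $D$ onto $G$, extended to a homeomorphism $\Phi:\overline{D}\to\overline{G}$, and let $a<b<a+2\pi$ be real numbers such that $J'=\{\Phi(e^{it}): a\le t\le b\}$. Then: 1. $\int_a^b|\Phi'(re^{it})|\,dt$ is bounded for $0<r<1$. 2. $\Phi'$ has non-tangential limits almost everywhere on $\{e^{it}:a<t<b\}$, denoted $\Phi'(e^{it})$, and $\Phi'(e^{it})\neq 0$ for almost every $t\in(a,b)$. 3. The function $t\mapsto\Phi'(e^{it})$ is integrable on $(a,b)$ and $\int_a^b|\Phi'(re^{it})-\Phi'(e^{it})|\,dt\to 0$ as $r\to1^-$. 4. $$\operatorname{length}(J')=\int_a^b|\Phi'(e^{it})|\,dt=\lim_{r\to1^-}\int_a^b|\Phi'(re^{it})|\,dt=\lim_{r\to1^-}\operatorname{length}\left(\Phi\{re^{iu}:a\le u\le b\}\right).$$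
   Context: $D=\{z\in\mathbb{C}:|z|<1\}$. A Jordan curve is a homeomorphic image of the unit circle in $\mathbb{C}$; its interior is the bounded component of its complement. An open arc of a Jordan curve $\gamma$ is a subset of the form $\gamma((s,t))$ for an open parameter interval $(s,t)$ on which the parametrization of $\gamma$ is injective; a compact arc is defined likewise with a compact interval. The length of an arc or curve is the supremum of the lengths of inscribed polygonal lines, and it is rectifiable if its length is finite; $\operatorname{length}(\Phi\{re^{iu}:a\le u\le b\})$ is the length of the curve $u\mapsto\Phi(re^{iu})$, $u\in[a,b]$. A conformal mapping onto $G$ means a holomorphic bijection onto $G$. By the Osgood–Carathéodory theorem every conformal mapping of $D$ onto the interior of a Jordan curve extends to a homeomorphism of $\overline{D}$ onto the closure of that interior; this extension is also denoted $\Phi$. A function on $D$ has a non-tangential limit at a point $\zeta$ of the unit circle if it has one and the same limit at $\zeta$ within every angle (with vertex $\zeta$, symmetric about the radius $[0,\zeta]$, of opening less than $\pi$). *)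

(* Defs.v *)
From HB Require Import structures.
From mathcomp Require Import all_boot all_order all_algebra.
From mathcomp Require Import complex.
From mathcomp Require Import all_classical all_reals all_analysis.

Set Implicit Arguments.
Unset Strict Implicit.
Unset Printing Implicit Defensive.

Import Order.TTheory GRing.Theory Num.Theory.
Import numFieldNormedType.Exports.

Local Open Scope classical_set_scope.
Local Open Scope ring_scope.
Local Open Scope complex_scope.

(* Over [R[i]] as its own field of scalars, [derivable f z 1] is complex
   differentiability at [z] and [derive1 f] is the complex derivative. *)
HB.instance Definition _ (R : realType) := NormedModule.copy R[i] R[i]^o.

Section Defs.
Variable R : realType.
Local Notation C := R[i].

(* The norm [`|z|] is [R[i]]-valued (a real complex number); lengths and
   integrals need an [R]-valued modulus. *)
Definition cabs (z : C) : R := ComplexField.Normc.normc z.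

Definition cis (t : R) : C := cos t +i* sin t.

Definition unit_disk : set C := [set z | cabs z < 1].
Definition closed_unit_disk : set C := [set z | cabs z <= 1].
Definition unit_circle : set C := [set z | cabs z = 1].

Definition homeomorphism_onto (A B : set C) (f : C -> C) : Prop :=
  [/\ set_bij A B f, {within A, continuous f} &
      exists g : C -> C, {within B, continuous g} /\ {in A, cancel f g}].

Definition jordan_curve (gamma : set C) (h : C -> C) : Prop :=
  homeomorphism_onto unit_circle gamma h.

(* [G] is a bounded connected component of the complement of [gamma]; by the
   Jordan curve theorem there is exactly one. *)
Definition interior_of_jordan_curve (gamma G : set C) : Prop :=
  bounded_set G /\
  exists2 z, (~` gamma) z & G = connected_component (~` gamma) z.

(* [A] is the arc of the Jordan curve parametrized by [t |-> h (cis t)] with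
   parameter interval [I]: an open (resp. compact) arc if [I] is open
   (resp. closed). *)
Definition arc_of (h : C -> C) (I : interval R) (A : set C) : Prop :=
  {in I &, injective (h \o cis)} /\ A = (h \o cis) @` [set` I].

Definition polygon_length (p : R -> C) (s : seq R) : R :=
  \sum_(i < (size s).-1) cabs (p (nth 0 s i.+1) - p (nth 0 s i)).

(* For [I] an open interval the vertices range over interior parameters, so
   this is also the length of an open arc. *)
Definition curve_length (p : R -> C) (I : interval R) : \bar R :=
  ereal_sup [set (polygon_length p s)%:E |
             s in [set s : seq R | sorted <%R s /\ {subset s <= I}]].

(* Meant for open [A]. *)
Definition conformal_onto (A B : set C) (f : C -> C) : Prop :=
  (forall z, A z -> derivable f z 1) /\ set_bij A B f.

(* The angle with vertex [zeta] and opening [2 * alpha], symmetric about the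
   radius from [0] to [zeta]. *)
Definition angle_at (zeta : C) (alpha : R) : set C :=
  [set z | exists rho theta : R,
     [/\ 0 < rho, `|theta| < alpha & z = zeta * (1 - rho%:C * cis theta)]].

Definition nontangential_limit (f : C -> C) (zeta l : C) : Prop :=
  forall alpha : R, 0 < alpha < pi / 2 ->
    f @ within (unit_disk `&` angle_at zeta alpha) (nbhs zeta) --> l.

Definition cintegrable (A : set R) (f : R -> C) : Prop :=
  (@lebesgue_measure R).-integrable A (fun t => (complex.Re (f t))%:E) /\
  (@lebesgue_measure R).-integrable A (fun t => (complex.Im (f t))%:E).

End Defs.

(* Main.v *)
Require Import Defs.
From HB Require Import structures.
From mathcomp Require Import all_boot all_order all_algebra.
From mathcomp Require Import complex.
From mathcomp Require Import all_classical all_reals all_analysis.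
From mathcomp Require Import measurable_realfun.
From mathcomp Require Import ring lra zify.
Set Implicit Arguments.
Unset Strict Implicit.
Unset Printing Implicit Defensive.
Import Order.TTheory GRing.Theory Num.Theory.
Import numFieldNormedType.Exports.
Local Open Scope classical_set_scope.
Local Open Scope ring_scope.
Local Open Scope complex_scope.

(* In the coordinate z = e^{iw} the map becomes a bounded function
   F(w) = Phi(e^{iw}) on the upper half-plane, continuous up to the real line,
   and on a neighbourhood of [a, b] its boundary values run through a
   rectifiable arc, hence have bounded variation.  By the argument of F. and
   M. Riesz their Stieltjes measure dF vanishes on every compact null set K:
   integrate F against the derivatives of analytic functions that are bounded
   by 1, tend to 0 on K and tend to 1 off K.  Thus F(t) has an integrable
   density q.  Up to a term O(Im w), F' is locally the Poisson integral of q,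
   so that F' tends to q non-tangentially almost everywhere and in L^1.  If q
   vanished on a set of positive measure, then F' would vanish on a vertical
   segment over each density point of it, against injectivity.  The statement
   follows from F'(w) = i z Phi'(z), since the length of a curve with an
   integrable density is the integral of the modulus of the density. *)

(** The logarithmic coordinate turns circles into horizontal lines, so that rectangles serve as the
    only contours; on their real side the map is merely continuous. The boundary function has no
    derivative to start from, hence integrals along that side are integrated by parts and the
    derivative falls on the kernel. The analytic functions of the Riesz argument are
    [1 / (1 + k * S)], where [S] sums [i r / (w - c + i r)] over the intervals of a finite cover of
    [K], with centre [c] and half-length [r]. Each term has nonnegative real part on the upper
    half-plane and real part at least [1 / 2] on its interval; away from [K] the sum is controlled
    by the total length, which a null set lets decrease faster than [k] grows. The same functions
    with a fixed [k] show that the density does not vanish: they enter a weight that is at least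
    [3 / 8] at an interior point and at most [1 / 8] on the contour, up to the zeros of the density
    and a set that carries little of it. Powers of the weight separate the two constants. Openness
    of [J] leaves room beyond both ends of [[a, b]], which pays for the loss of end points in every
    local statement. *)

Section ComplexBasics.
Variable R : realType.
Local Notation C := R[i].
Implicit Types (z w : C) (f g : C -> C).

(** * Modulus, real and imaginary parts, limits and complex differentiability *)

Lemma norm_cabs z : `|z| = (cabs z)%:C.
Proof. by []. Qed.

Lemma cabs_ge0 z : 0 <= cabs z.
Proof. by case: z => a b; rewrite /cabs /= sqrtr_ge0. Qed.

Lemma cabs0 : cabs (0 : C) = 0.
Proof. exact: ComplexField.Normc.normc0. Qed.

Lemma cabs_eq0 z : (cabs z == 0) = (z == 0).
Proof.
apply/eqP/eqP => [/ComplexField.Normc.eq0_normc //|->]; exact: cabs0.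
Qed.

Lemma cabs_gt0 z : (0 < cabs z) = (z != 0).
Proof. by rewrite lt_neqAle cabs_ge0 andbT eq_sym cabs_eq0. Qed.

Lemma cabsM z w : cabs (z * w) = cabs z * cabs w.
Proof. exact: ComplexField.Normc.normcM. Qed.

Lemma cabsV z : cabs z^-1 = (cabs z)^-1.
Proof. exact: ComplexField.Normc.normcV. Qed.

Lemma cabsN z : cabs (- z) = cabs z.
Proof. by case: z => a b; rewrite /cabs /= !sqrrN. Qed.

Lemma cabsD z w : cabs (z + w) <= cabs z + cabs w.
Proof. by have := ler_normD z w; rewrite !norm_cabs -rmorphD/= lecR. Qed.

Lemma cabsB z w : cabs (z - w) <= cabs z + cabs w.
Proof. by rewrite (le_trans (cabsD _ _))// cabsN. Qed.

Lemma cabs_distC z w : cabs (z - w) = cabs (w - z).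
Proof. by rewrite -cabsN opprB. Qed.

Lemma cabsX z n : cabs (z ^+ n) = cabs z ^+ n.
Proof.
elim: n => [|n IH]; first by rewrite !expr0; exact: ComplexField.Normc.normc1.
by rewrite !exprS cabsM IH.
Qed.

Lemma cabs_real (a : R) : cabs a%:C = `|a|.
Proof. by rewrite /cabs /= expr0n addr0 sqrtr_sqr. Qed.

Lemma cabs_ler_Re z : `|complex.Re z| <= cabs z.
Proof.
by case: z => a b; rewrite /cabs /= -sqrtr_sqr ler_wsqrtr// lerDl sqr_ge0.
Qed.

Lemma cabs_ler_Im z : `|complex.Im z| <= cabs z.
Proof.
by case: z => a b; rewrite /cabs /= -sqrtr_sqr ler_wsqrtr// lerDr sqr_ge0.
Qed.

Lemma cabs_i : cabs ('i : C) = 1.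
Proof. by rewrite /cabs /= expr0n add0r expr1n sqrtr1. Qed.

Lemma complexE z : z = (complex.Re z)%:C + 'i * (complex.Im z)%:C.
Proof. by case: z => a b; simpc. Qed.

Lemma cabs_le_ReIm z : cabs z <= `|complex.Re z| + `|complex.Im z|.
Proof.
rewrite {1}[z]complexE (le_trans (cabsD _ _))// cabsM cabs_i mul1r.
by rewrite !cabs_real.
Qed.

Lemma cabs_sqr z : cabs z ^+ 2 = complex.Re z ^+ 2 + complex.Im z ^+ 2.
Proof. by case: z => a b; rewrite /cabs /= sqr_sqrtr// addr_ge0// sqr_ge0. Qed.

Lemma ReM z w : complex.Re (z * w) =
  complex.Re z * complex.Re w - complex.Im z * complex.Im w.
Proof. by case: z; case: w. Qed.

Lemma ImM z w : complex.Im (z * w) =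
  complex.Re z * complex.Im w + complex.Im z * complex.Re w.
Proof. by case: z => a b; case: w => c d /=; rewrite (mulrC b c). Qed.

Lemma ReD z w : complex.Re (z + w) = complex.Re z + complex.Re w.
Proof. by case: z; case: w. Qed.

Lemma ImD z w : complex.Im (z + w) = complex.Im z + complex.Im w.
Proof. by case: z; case: w. Qed.

Lemma ReN z : complex.Re (- z) = - complex.Re z.
Proof. by case: z. Qed.

Lemma ImN z : complex.Im (- z) = - complex.Im z.
Proof. by case: z. Qed.

Lemma complex_ext z w :
  complex.Re z = complex.Re w -> complex.Im z = complex.Im w -> z = w.
Proof. by case: z => a b; case: w => c d /= -> ->. Qed.

Lemma cabs_cis (t : R) : cabs (cis t) = 1.
Proof. by rewrite /cabs /cis /= cos2Dsin2 sqrtr1. Qed.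

Lemma cisD (s t : R) : cis (s + t) = cis s * cis t.
Proof.
rewrite /cis cosD sinD; apply: complex_ext; rewrite ?ReM ?ImM //=.
by rewrite addrC.
Qed.

Lemma cis0 : cis (0 : R) = 1.
Proof. by rewrite /cis cos0 sin0. Qed.


(* A copy of [nbhs z]: the instance that [Defs] puts on [R[i]] makes
   unification unfold [nbhs z], which the library lemmas then do not
   recognize any more.  [ccvg] and [ccont] are the corresponding
   convergence and continuity. *)
Definition cnbhs z : set_system C :=
  [set P | exists2 e : R, 0 < e & forall w, cabs (w - z) < e -> P w].

Lemma nbhsC z (P : set C) : nbhs z P <-> cnbhs z P.
Proof.
split=> [/nbhs_normP[e /= e0 zP]|[e e0 zP]].
  have [e'0 Ime] : 0 < complex.Re e /\ complex.Im e = 0.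
    by move: e0; case: (e) => a b; rewrite ltcE /= => /andP[/eqP].
  exists (complex.Re e) => // w wz; apply: zP => /=.
  rewrite distrC norm_cabs ltcE /= Ime eqxx /=.
  by move: wz; rewrite /cabs.
apply/nbhs_normP; exists e%:C; first by rewrite /= ltcR.
by move=> w /=; rewrite distrC norm_cabs ltcR => /zP.
Qed.

Global Instance cnbhs_filter z : ProperFilter (cnbhs z).
Proof.
apply: Build_ProperFilter_ex.
  by move=> P [e e0 zP]; exists z; apply: zP; rewrite subrr cabs0.
split=> [|P Q [e e0 zP] [d d0 zQ]|P Q PQ [e e0 zP]].
- by exists 1.
- exists (Num.min e d); first by rewrite lt_min e0.
  by move=> w; rewrite lt_min => /andP[/zP ? /zQ ?].
- by exists e => // w /zP /PQ.
Qed.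

Definition ccvg {T : Type} (F : set_system T) (f : T -> C) (l : C) :=
  forall e : R, 0 < e -> \forall x \near F, cabs (f x - l) < e.

Definition ccont f z := ccvg (cnbhs z) f (f z).

Lemma cvgC {T : Type} (F : set_system T) {FF : Filter F} (f : T -> C) (l : C) :
  f @ F --> l <-> ccvg F f l.
Proof.
split=> [fl e e0|fl].
  have : nbhs l [set w | cabs (w - l) < e] by apply/nbhsC; exists e.
  by move/fl.
by move=> P /nbhsC[e e0 lP]; apply: filterS (fl _ e0) => x /lP.
Qed.

Lemma cabs_ler_dist z w : `|cabs z - cabs w| <= cabs (z - w).
Proof.
rewrite ler_norml; apply/andP; split.
  by rewrite lerBrDl lerBlDr -{1}(subrK z w) (le_trans (cabsD _ _))// cabs_distC addrC.
by rewrite lerBlDl -{1}(subrK w z) addrC (le_trans (cabsD _ _)).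
Qed.

Section ccvg.
Context {T : Type} (F : set_system T) {FF : Filter F}.
Implicit Types h k : T -> C.

Lemma ccvgP h (l : C) : ccvg F h l <->
  (complex.Re (h x) @[x --> F] --> complex.Re l) /\
  (complex.Im (h x) @[x --> F] --> complex.Im l).
Proof.
split=> [fl|[/cvgrPdist_lt fR /cvgrPdist_lt fI]].
  split; apply/cvgrPdist_lt => e /fl; apply: filterS => x; apply: le_lt_trans.
    by rewrite -ReN -ReD (le_trans (cabs_ler_Re _))// cabs_distC.
  by rewrite -ImN -ImD (le_trans (cabs_ler_Im _))// cabs_distC.
move=> e e0; have e20 : 0 < e / 2 by rewrite divr_gt0.
near=> x; rewrite (le_lt_trans (cabs_le_ReIm _))// [e]splitr ltrD//.
  by rewrite ReD ReN distrC; near: x; exact: fR.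
by rewrite ImD ImN distrC; near: x; exact: fI.
Unshelve. all: by end_near. Qed.

Lemma ccvg_cst (c : C) : ccvg F (fun _ => c) c.
Proof. by move=> e e0; apply: nearW => x; rewrite subrr cabs0. Qed.

Lemma ccvg_near h k l : (\forall x \near F, h x = k x) -> ccvg F h l -> ccvg F k l.
Proof.
move=> hk hl e e0; near=> x.
have <- : h x = k x by near: x.
by near: x; exact: hl.
Unshelve. all: by end_near. Qed.

Lemma ccvgD h k l m : ccvg F h l -> ccvg F k m ->
  ccvg F (fun x => h x + k x) (l + m).
Proof.
move=> /ccvgP[hR hI] /ccvgP[kR kI]; apply/ccvgP; rewrite ReD ImD.
by split; under eq_fun do rewrite ?ReD ?ImD; exact: cvgD.
Qed.

Lemma ccvgN h l : ccvg F h l -> ccvg F (fun x => - h x) (- l).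
Proof.
move=> /ccvgP[hR hI]; apply/ccvgP; rewrite ReN ImN.
by split; under eq_fun do rewrite ?ReN ?ImN; exact: cvgN.
Qed.

Lemma ccvgB h k l m : ccvg F h l -> ccvg F k m ->
  ccvg F (fun x => h x - k x) (l - m).
Proof. by move=> hl km; apply: ccvgD => //; exact: ccvgN. Qed.

Lemma ccvgM h k l m : ccvg F h l -> ccvg F k m ->
  ccvg F (fun x => h x * k x) (l * m).
Proof.
move=> /ccvgP[hR hI] /ccvgP[kR kI]; apply/ccvgP; rewrite ReM ImM.
split; under eq_fun do rewrite ?ReM ?ImM.
  by apply: cvgB; exact: cvgM.
by apply: cvgD; exact: cvgM.
Qed.

Lemma ccvg_cabs h l : ccvg F h l -> cabs (h x) @[x --> F] --> cabs l.
Proof.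
move=> hl; apply/cvgrPdist_lt => e /hl; apply: filterS => x.
by apply: le_lt_trans; rewrite distrC cabs_ler_dist.
Qed.

Lemma ReV z : complex.Re z^-1 = complex.Re z / cabs z ^+ 2.
Proof. by rewrite cabs_sqr; case: z. Qed.

Lemma ImV z : complex.Im z^-1 = - complex.Im z / cabs z ^+ 2.
Proof. by rewrite cabs_sqr mulNr; case: z. Qed.

Lemma ccvgV h l : l != 0 -> ccvg F h l -> ccvg F (fun x => (h x)^-1) l^-1.
Proof.
move=> l0 hl; have cl := ccvg_cabs hl; have cl0 : cabs l ^+ 2 != 0.
  by rewrite sqrf_eq0 cabs_eq0.
have cV : (cabs (h x) ^+ 2)^-1 @[x --> F] --> (cabs l ^+ 2)^-1.
  by apply: cvgV => //; rewrite expr2; under eq_fun do rewrite expr2; exact: cvgM.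
move: hl => /ccvgP[hR hI]; apply/ccvgP; rewrite ReV ImV.
split; under eq_fun do rewrite ?ReV ?ImV.
  exact: cvgM.
by apply: cvgM => //; exact: cvgN.
Qed.

Lemma ccvgX h l n : ccvg F h l -> ccvg F (fun x => h x ^+ n) (l ^+ n).
Proof.
move=> hl; elim: n => [|n IH].
  by under eq_fun do rewrite expr0; rewrite expr0; exact: ccvg_cst.
by under eq_fun do rewrite exprS; rewrite exprS; exact: ccvgM.
Qed.

Lemma ccvg_comp h f l : ccvg F h l -> ccont f l -> ccvg F (f \o h) (f l).
Proof.
move=> hl fl e e0; have [d d0 fd] := fl _ e0.
by apply: filterS (hl _ d0) => x /fd.
Qed.

End ccvg.

Lemma ccont_id z : ccont id z.
Proof. by move=> e e0; exists e. Qed.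

(* [q] is the slope of [f] at [z] *)
Definition cdiff f z l := exists q : C -> C,
  [/\ ccont q z, q z = l & \forall w \near cnbhs z, f w = f z + q w * (w - z)].

Lemma cnbhs_at (P : set C) z : (\forall w \near cnbhs z, P w) -> P z.
Proof. by case=> e e0; apply; rewrite subrr cabs0. Qed.

Lemma cdiff_cont f z l : cdiff f z l -> ccont f z.
Proof.
move=> [q [cq qz fq]].
have : ccvg (cnbhs z) (fun w => f z + q w * (w - z)) (f z + q z * (z - z)).
  apply: ccvgD; first exact: ccvg_cst.
  by apply: ccvgM => //; apply: ccvgB; [exact: ccont_id|exact: ccvg_cst].
rewrite subrr mulr0 addr0; apply: ccvg_near.
by apply: filterS fq => w /esym.
Qed.

Lemma cdiff_cst (c : C) z : cdiff (fun _ => c) z 0.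
Proof.
exists (fun _ => 0); split => //; first exact: ccvg_cst.
by apply: nearW => w /=; rewrite mul0r addr0.
Qed.

Lemma cdiff_id z : cdiff id z 1.
Proof.
exists (fun _ => 1); split => //; first exact: ccvg_cst.
by apply: nearW => w /=; rewrite mul1r addrC subrK.
Qed.

Lemma cdiffD f g z l m : cdiff f z l -> cdiff g z m ->
  cdiff (fun w => f w + g w) z (l + m).
Proof.
move=> [p [cp pz fp]] [q [cq qz gq]]; exists (fun w => p w + q w); split.
- exact: ccvgD.
- by rewrite pz qz.
- near=> w.
  have -> : f w = f z + p w * (w - z) by near: w.
  have -> : g w = g z + q w * (w - z) by near: w.
  by rewrite mulrDl addrACA.
Unshelve. all: by end_near. Qed.

Lemma cdiffM f g z l m : cdiff f z l -> cdiff g z m ->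
  cdiff (fun w => f w * g w) z (l * g z + f z * m).
Proof.
move=> df dg; have cg := cdiff_cont dg.
move: df dg => [p [cp pz fp]] [q [cq qz gq]].
exists (fun w => p w * g w + f z * q w); split.
- by apply: ccvgD; apply: ccvgM => //; exact: ccvg_cst.
- by rewrite pz qz.
- near=> w.
  have fwE : f w = f z + p w * (w - z) by near: w.
  have gwE : g w = g z + q w * (w - z) by near: w.
  by rewrite {1}fwE mulrDl {1}gwE; ring.
Unshelve. all: by end_near. Qed.

Lemma cdiffN f z l : cdiff f z l -> cdiff (fun w => - f w) z (- l).
Proof.
move=> /(cdiffM (cdiff_cst (-1) z)); rewrite mul0r add0r mulN1r.
by congr cdiff; apply/funext => w /=; rewrite mulN1r.
Qed.

Lemma cdiffB f g z l m : cdiff f z l -> cdiff g z m ->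
  cdiff (fun w => f w - g w) z (l - m).
Proof. by move=> df dg; apply: cdiffD => //; exact: cdiffN. Qed.

Lemma cdiffV f z l : f z != 0 -> cdiff f z l ->
  cdiff (fun w => (f w)^-1) z (- l / f z ^+ 2).
Proof.
move=> fz0 df; have cf := cdiff_cont df.
move: df => [p [cp pz fp]].
exists (fun w => - (p w) * ((f w)^-1 * (f z)^-1)); split.
- apply: ccvgM; first exact: ccvgN.
  by apply: ccvgM; [exact: ccvgV|exact: ccvg_cst].
- by rewrite pz expr2 invfM.
- near=> w.
  have fwE : f w = f z + p w * (w - z) by near: w.
  have fw0 : f w != 0.
    apply/eqP => fw0; have : cabs (f w - f z) < cabs (f z).
      by near: w; apply: cf; rewrite cabs_gt0.
    by rewrite fw0 sub0r cabsN ltxx.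
  have pE : p w * (w - z) = f w - f z by rewrite fwE addrAC subrr add0r.
  by rewrite mulrAC mulNr pE; field; rewrite fw0 fz0.
Unshelve. all: by end_near. Qed.

(** In Carathéodory's form the slopes multiply; there is no quotient by [g w - g z], which may
    vanish for [w] near [z]. *)
Lemma cdiff_comp f g z l m : cdiff g z m -> cdiff f (g z) l ->
  cdiff (f \o g) z (l * m).
Proof.
move=> dg; have cg := cdiff_cont dg.
move: dg => [q [cq qz gq]] [p [cp pz fp]].
exists (fun w => p (g w) * q w); split.
- by apply: ccvgM => //; exact: (ccvg_comp cg cp).
- by rewrite pz qz.
- near=> w.
  have gwE : g w = g z + q w * (w - z) by near: w.
  have -> : (f \o g) w = f (g z) + p (g w) * (g w - g z).
    near: w; have [e e0 fe] := fp; apply: filterS (cg _ e0) => w; exact: fe.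
  by rewrite {2}gwE /=; ring.
Unshelve. all: by end_near. Qed.

Lemma cdiff_near f g z l : (\forall w \near cnbhs z, f w = g w) ->
  cdiff f z l -> cdiff g z l.
Proof.
move=> fg [p [cp pz fp]]; exists p; split => //; near=> w.
have -> : g w = f w by apply/esym; near: w.
by rewrite -(cnbhs_at fg); near: w.
Unshelve. all: by end_near. Qed.

Lemma cdiffX f z l n : cdiff f z l ->
  cdiff (fun w => f w ^+ n) z (n%:R * f z ^+ n.-1 * l).
Proof.
move=> df; elim: n => [|n IH].
  rewrite !mul0r; apply: cdiff_near (cdiff_cst 1 z).
  by apply: nearW => w; rewrite expr0.
have := cdiffM df IH; set k := (X in cdiff _ _ X); set k' := (X in _ -> cdiff _ _ X).
suff -> : k = k' by congr cdiff; apply/funext => w; rewrite exprS.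
rewrite /k /k' /= -natr1; case: n {IH k k'} => [|n].
  by rewrite expr0 /=; ring.
by rewrite /= exprS; ring.
Qed.

Lemma derivable_cdiff f z : derivable f z 1 -> cdiff f z (derive1 f z).
Proof.
move=> /cvg_ex[l fl].
have -> : derive1 f z = l.
  rewrite derive1E /derive; apply: cvg_lim fl; exact: norm_hausdorff.
(* At [z] the difference quotient is completed by its limit, which makes the slope continuous
   there. *)
exists (fun w => if w == z then l else (f w - f z) / (w - z)); split.
- rewrite /= /ccont eqxx => e e0.
  move/cvgC : fl => /(_ _ e0); rewrite near_withinE => /nbhsC[d d0 H].
  exists d => // w wz; case: eqVneq => [_|wz0].
    by rewrite subrr cabs0.
  have := H (w - z); rewrite subr0 => /(_ wz); rewrite subr_eq0 => /(_ wz0).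
  by rewrite /= [_ *: 1]mulr1 subrK /GRing.scale/= mulrC.
- by rewrite eqxx.
- apply: nearW => w; case: eqVneq => [->|wz0].
    by rewrite subrr mulr0 addr0.
  by rewrite divfK ?subr_eq0// addrC subrK.
Qed.

End ComplexBasics.

#[global] Arguments cabs : simpl never.

(** * Complex-valued Lebesgue integrals and differentiation along a real parameter *)

Section ComplexIntegral.
Variable R : realType.
Local Notation C := R[i].
Local Notation mu := (@lebesgue_measure R).
Implicit Types (A : set R) (f g : R -> C) (a b c : R).

Definition cint A f : C :=
  (\int[mu]_(t in A) complex.Re (f t)) +i* (\int[mu]_(t in A) complex.Im (f t)).

#[global] Arguments cint : simpl never.

Lemma cintegrable_measurable A f : cintegrable A f ->
  measurable_fun A (fun t => complex.Re (f t)) /\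
  measurable_fun A (fun t => complex.Im (f t)).
Proof. by move=> [/measurable_int/measurable_EFinP ? /measurable_int/measurable_EFinP]. Qed.

Lemma cabsE (z : C) : cabs z = Num.sqrt (complex.Re z ^+ 2 + complex.Im z ^+ 2).
Proof. by case: z. Qed.

Lemma measurable_cabs A f : measurable A ->
  measurable_fun A (fun t => complex.Re (f t)) ->
  measurable_fun A (fun t => complex.Im (f t)) ->
  measurable_fun A (fun t => cabs (f t)).
Proof.
move=> mA mR mI; under eq_fun do rewrite cabsE.
apply: (measurableT_comp (continuous_measurable_fun (@sqrt_continuous R))).
by apply: measurable_funD; exact: measurable_funX.
Qed.

Lemma cintegrable_le A f (g : R -> R) : measurable A ->
  measurable_fun A (fun t => complex.Re (f t)) ->
  measurable_fun A (fun t => complex.Im (f t)) ->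
  mu.-integrable A (EFin \o g) ->
  (forall t, A t -> cabs (f t) <= g t) -> cintegrable A f.
Proof.
move=> mA mR mI ig fg; split.
  apply: le_integrable ig => //; first exact/measurable_EFinP.
  move=> t At; rewrite /= lee_fin (le_trans (cabs_ler_Re _))//.
  by rewrite (le_trans (fg _ At))// ler_norm.
apply: le_integrable ig => //; first exact/measurable_EFinP.
move=> t At; rewrite /= lee_fin (le_trans (cabs_ler_Im _))//.
by rewrite (le_trans (fg _ At))// ler_norm.
Qed.

Lemma integrable_cabs A f : measurable A -> cintegrable A f ->
  mu.-integrable A (EFin \o (fun t => cabs (f t))).
Proof.
move=> mA cf; have [mR mI] := cintegrable_measurable cf.
have [iR iI] := cf.
apply: (@le_integrable _ _ _ mu _ mA _
  (fun t => (`|complex.Re (f t)|%:E + `|complex.Im (f t)|%:E)%E)).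
- by apply/measurable_EFinP; exact: measurable_cabs.
- move=> t At; rewrite /= lee_fin ger0_norm ?cabs_ge0//.
  by rewrite (le_trans (cabs_le_ReIm _))// ler_norm.
- apply: integrableD => //; first exact: integrable_abse iR.
  exact: integrable_abse iI.
Qed.

Lemma cintegrableS A (B : set R) f : measurable A -> measurable B ->
  B `<=` A -> cintegrable A f -> cintegrable B f.
Proof. by move=> mA mB BA [iR iI]; split; [exact: integrableS iR|exact: integrableS iI]. Qed.

Lemma eq_cintegrable A f g : measurable A -> {in A, f =1 g} -> cintegrable A f ->
  cintegrable A g.
Proof.
move=> mA fg [iR iI]; split.
  by apply: eq_integrable iR => // t tA; rewrite fg.
by apply: eq_integrable iI => // t tA; rewrite fg.
Qed.

Lemma eq_cint A f g : {in A, f =1 g} -> cint A f = cint A g.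
Proof.
by move=> fg; congr (_ +i* _); apply: eq_Rintegral => t tA; rewrite fg.
Qed.

Lemma cintegrableD A f g : measurable A -> cintegrable A f -> cintegrable A g ->
  cintegrable A (fun t => f t + g t).
Proof.
move=> mA [fR fI] [gR gI]; split; under eq_fun do rewrite ?ReD ?ImD EFinD.
  exact: integrableD.
exact: integrableD.
Qed.

Lemma cintD A f g : measurable A -> cintegrable A f -> cintegrable A g ->
  cint A (fun t => f t + g t) = cint A f + cint A g.
Proof.
move=> mA [fR fI] [gR gI]; apply: complex_ext; rewrite ?ReD ?ImD /=.
  by under eq_Rintegral do rewrite ReD; rewrite RintegralD.
by under eq_Rintegral do rewrite ImD; rewrite RintegralD.
Qed.

Lemma integrable_lincomb A (u v : R -> R) (k l : R) : measurable A ->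
  mu.-integrable A (EFin \o u) -> mu.-integrable A (EFin \o v) ->
  mu.-integrable A (EFin \o (fun t => k * u t + l * v t)).
Proof.
move=> mA iu iv; rewrite (_ : EFin \o _ =
  (fun t => k%:E * (EFin \o u) t + l%:E * (EFin \o v) t)%E)//.
by apply: integrableD => //; exact: integrableZl.
Qed.

Lemma Rintegral_lincomb A (u v : R -> R) (k l : R) : measurable A ->
  mu.-integrable A (EFin \o u) -> mu.-integrable A (EFin \o v) ->
  \int[mu]_(t in A) (k * u t + l * v t) =
  k * \int[mu]_(t in A) u t + l * \int[mu]_(t in A) v t.
Proof.
move=> mA iu iv; rewrite RintegralD ?RintegralZl//.
  by rewrite (_ : EFin \o _ = (fun t => k%:E * (EFin \o u) t)%E)//; exact: integrableZl.
by rewrite (_ : EFin \o _ = (fun t => l%:E * (EFin \o v) t)%E)//; exact: integrableZl.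
Qed.

Lemma cintegrableZ A f (z : C) : measurable A -> cintegrable A f ->
  cintegrable A (fun t => z * f t).
Proof.
move=> mA [fR fI]; split.
  rewrite (_ : (fun t => _) = EFin \o (fun t => complex.Re z * complex.Re (f t)
    + (- complex.Im z) * complex.Im (f t))).
    exact: integrable_lincomb.
  by apply/funext => t /=; rewrite ReM mulNr.
rewrite (_ : (fun t => _) = EFin \o (fun t => complex.Re z * complex.Im (f t)
    + complex.Im z * complex.Re (f t))).
  exact: integrable_lincomb.
by apply/funext => t /=; rewrite ImM.
Qed.

Lemma cintZ A f (z : C) : measurable A -> cintegrable A f ->
  cint A (fun t => z * f t) = z * cint A f.
Proof.
move=> mA [fR fI]; apply: complex_ext; rewrite ?ReM ?ImM /=.
  under eq_Rintegral do rewrite ReM -mulNr.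
  by rewrite Rintegral_lincomb// mulNr.
under eq_Rintegral do rewrite ImM.
by rewrite Rintegral_lincomb.
Qed.

Lemma cintegrableN A f : measurable A -> cintegrable A f ->
  cintegrable A (fun t => - f t).
Proof.
move=> mA /(cintegrableZ (-1) mA); apply: eq_cintegrable => // t _.
by rewrite mulN1r.
Qed.

Lemma cintN A f : measurable A -> cintegrable A f ->
  cint A (fun t => - f t) = - cint A f.
Proof.
move=> mA cf; rewrite -mulN1r -cintZ//; apply: eq_cint => t _.
by rewrite mulN1r.
Qed.

Lemma cintegrableB A f g : measurable A -> cintegrable A f -> cintegrable A g ->
  cintegrable A (fun t => f t - g t).
Proof. by move=> mA cf cg; apply: cintegrableD => //; exact: cintegrableN. Qed.

Lemma cintB A f g : measurable A -> cintegrable A f -> cintegrable A g ->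
  cint A (fun t => f t - g t) = cint A f - cint A g.
Proof. by move=> mA cf cg; rewrite cintD ?cintN//; exact: cintegrableN. Qed.

Lemma cint_set1 a f : cint [set a] f = 0.
Proof. by rewrite /cint !Rintegral_set1. Qed.

Lemma Rintegral_itv_split (u : R -> R) a c b : a <= c -> c <= b ->
  mu.-integrable `[a, b] (EFin \o u) ->
  \int[mu]_(t in `[a, b]) u t =
  \int[mu]_(t in `[a, c]) u t + \int[mu]_(t in `[c, b]) u t.
Proof.
move=> ac cb iu; have /= := Rintegral_itvB (x := c) iu.
rewrite !bnd_simp => /(_ ac cb); rewrite Rintegral_itv_obnd_cbnd.
  by move=> <-; rewrite addrC subrK.
by apply: integrableS iu => //; apply: subset_itv; rewrite ?bnd_simp.
Qed.

Lemma cint_split f a c b : a <= c -> c <= b -> cintegrable `[a, b] f ->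
  cint `[a, b] f = cint `[a, c] f + cint `[c, b] f.
Proof.
move=> ac cb [fR fI]; apply: complex_ext; rewrite ?ReD ?ImD /=.
  exact: Rintegral_itv_split.
exact: Rintegral_itv_split.
Qed.

(* Rotate so that the integral becomes a nonnegative real. *)
Lemma cabs_cint A f : measurable A -> cintegrable A f ->
  cabs (cint A f) <= \int[mu]_(t in A) cabs (f t).
Proof.
move=> mA cf; have [->|n0] := eqVneq (cint A f) 0.
  by rewrite cabs0; apply: Rintegral_ge0 => t _; exact: cabs_ge0.
set z := cint A f; pose w := (cabs z)%:C / z.
have w1 : cabs w = 1.
  rewrite /w cabsM cabsV cabs_real ger0_norm ?cabs_ge0// divff//.
  by rewrite cabs_eq0.
have -> : cabs z = complex.Re (cint A (fun t => w * f t)).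
  by rewrite cintZ// /w -mulrA mulVf// mulr1.
rewrite /=; apply: le_Rintegral => //.
- by have [] := cintegrableZ w mA cf.
- exact: integrable_cabs.
- move=> t _; rewrite (le_trans (ler_norm _))// (le_trans (cabs_ler_Re _))//.
  by rewrite cabsM w1 mul1r.
Qed.

Lemma Rintegral_cst_itv a b (k : R) : a <= b ->
  \int[mu]_(t in `[a, b]) k = k * (b - a).
Proof.
move=> ab; rewrite Rintegral_cst//= lebesgue_measure_itv/= lte_fin.
have [ab'|ba] := ltP a b; first by rewrite -EFinD.
by rewrite (@le_anti _ _ a b) ?ab// subrr.
Qed.

Lemma integrable_cst_itv a b (k : R) : mu.-integrable `[a, b] (fun=> k%:E).
Proof.
apply: continuous_compact_integrable; first exact: segment_compact.
by move=> x; apply: cvg_cst.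
Qed.

Lemma cintegrable_cst a b (z : C) : cintegrable `[a, b] (fun=> z).
Proof. by split; exact: integrable_cst_itv. Qed.

Lemma cint_cst a b (z : C) : a <= b -> cint `[a, b] (fun=> z) = (b - a)%:C * z.
Proof.
move=> ab; apply: complex_ext; rewrite ?ReM ?ImM /= Rintegral_cst_itv//.
  by rewrite mul0r subr0 mulrC.
by rewrite mul0r addr0 mulrC.
Qed.

Lemma cint_le A f (g : R -> R) : measurable A -> cintegrable A f ->
  mu.-integrable A (EFin \o g) -> (forall t, A t -> cabs (f t) <= g t) ->
  cabs (cint A f) <= \int[mu]_(t in A) g t.
Proof.
move=> mA cf ig fg; apply: (le_trans (cabs_cint mA cf)).
by apply: le_Rintegral => //; exact: integrable_cabs.
Qed.

Lemma cint_bound f a b (M : R) : a <= b -> cintegrable `[a, b] f ->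
  (forall t, a <= t <= b -> cabs (f t) <= M) ->
  cabs (cint `[a, b] f) <= M * (b - a).
Proof.
move=> ab cf fM; rewrite -Rintegral_cst_itv//; apply: cint_le => //.
exact: integrable_cst_itv.
Qed.

Definition pcont f (t : R) := ccvg (nbhs t) f (f t).

Lemma cintegrable_cont f a b : (forall t, a <= t <= b -> pcont f t) ->
  cintegrable `[a, b] f.
Proof.
move=> fab; split; apply: continuous_compact_integrable; try exact: segment_compact.
  apply: continuous_in_subspaceT => t; rewrite inE /= in_itv /=.
  by move=> /fab /ccvgP[].
apply: continuous_in_subspaceT => t; rewrite inE /= in_itv /=.
by move=> /fab /ccvgP[].
Qed.

Definition rdiff f (t : R) (l : C) :=
  is_derive t 1 (fun s => complex.Re (f s)) (complex.Re l) /\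
  is_derive t 1 (fun s => complex.Im (f s)) (complex.Im l).

Lemma rdiff_cont f t l : rdiff f t l -> pcont f t.
Proof.
have dc (g : R -> R) : derivable g t 1 -> {for t, continuous g}.
  by move=> dg; apply: differentiable_continuous; apply/derivable1_diffP.
by move=> [[/dc cR _] [/dc cI _]]; apply/ccvgP; split.
Qed.

Lemma Rintegral_FTC (F f : R -> R) a b : a <= b ->
  (forall t, a <= t <= b -> {for t, continuous f}) ->
  (forall t, a <= t <= b -> is_derive t 1 F (f t)) ->
  \int[mu]_(t in `[a, b]) f t = F b - F a.
Proof.
rewrite le_eqVlt => /predU1P[->|ab] cf dF.
  by rewrite set_itv1 Rintegral_set1 subrr.
rewrite /Rintegral (@continuous_FTC2 _ f F) ?EFinB//.
- apply: continuous_in_subspaceT => t; rewrite inE /= in_itv /=; exact: cf.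
- have cF t : a <= t <= b -> {for t, continuous F}.
    by move=> /dF[dt _]; exact/differentiable_continuous/derivable1_diffP.
  split.
  + move=> t; rewrite in_itv /= => /andP[at_ tb].
    by have [] := dF t; rewrite ?(ltW at_) ?(ltW tb).
  + by apply: cvg_at_right_filter; apply: cF; rewrite lexx ltW.
  + by apply: cvg_at_left_filter; apply: cF; rewrite lexx ltW.
- move=> t; rewrite in_itv /= => /andP[at_ tb].
  have [|_ <-] := dF t; first by rewrite (ltW at_) (ltW tb).
  by rewrite derive1E.
Qed.

Lemma cint_FTC f g a b : a <= b ->
  (forall t, a <= t <= b -> pcont g t) ->
  (forall t, a <= t <= b -> rdiff f t (g t)) ->
  cint `[a, b] g = f b - f a.
Proof.
move=> ab cg df; apply: complex_ext; rewrite ?ReD ?ReN ?ImD ?ImN /=.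
  apply: (@Rintegral_FTC (fun t => complex.Re (f t))) => // t /[dup] tab.
    by move=> /cg /ccvgP[].
  by move=> /df[].
apply: (@Rintegral_FTC (fun t => complex.Im (f t))) => // t /[dup] tab.
  by move=> /cg /ccvgP[].
by move=> /df[].
Qed.

(** Off [t] the difference quotient of [u] coincides with [q], so that both have the same limit. *)
Lemma is_derive_slope (u q : R -> R) (t l : R) : q s @[s --> t] --> l ->
  (\forall s \near t, u s = u t + q s * (s - t)) -> is_derive t 1 u l.
Proof.
move=> ql uq.
have H : h^-1 *: (u (h *: 1 + t) - u t) @[h --> 0^'] --> l.
  have ht : (fun h : R => h + t) h @[h --> 0^'] --> t.
    rewrite -[X in _ --> X]add0r; apply: cvg_within_filter.
    by apply: cvgD; [exact: cvg_id|exact: cvg_cst].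
  have ql' : q (h + t) @[h --> 0^'] --> l by apply: (cvg_comp _ q ht ql).
  apply: cvg_trans ql'; apply: near_eq_cvg.
  have H : \forall h \near 0^', u (h + t) = u t + q (h + t) * (h + t - t).
    exact: (ht _ uq).
  near=> h.
  have hE : u (h + t) = u t + q (h + t) * (h + t - t) by near: h.
  have h0 : h != 0 by near: h; exact: nbhs_dnbhs_neq.
  rewrite [_ *: 1]mulr1 hE addrAC subrr add0r addrK /GRing.scale /=.
  by rewrite mulrCA mulVf// mulr1.
split; first by apply/cvg_ex; exists l.
by rewrite /derive; apply: cvg_lim => //; exact: Rhausdorff.
Unshelve. all: by end_near. Qed.

(** The chain rule on an affine line of direction [v]: horizontal sides of a rectangle use [v = 1],
    vertical sides [v = 'i]. *)
Lemma rdiff_line (f : C -> C) (z v : C) (t : R) (l : C) :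
  cdiff f (z + t%:C * v) l -> rdiff (fun s => f (z + s%:C * v)) t (l * v).
Proof.
move=> [q [cq qz fq]].
have cp : ccvg (nbhs t) (fun s : R => z + s%:C * v) (z + t%:C * v).
  apply: ccvgD; first exact: ccvg_cst.
  apply: ccvgM; last exact: ccvg_cst.
  by apply/ccvgP; split; [exact: cvg_id|exact: cvg_cst].
have cqp : ccvg (nbhs t) (fun s => q (z + s%:C * v) * v) (l * v).
  rewrite -qz; apply: ccvgM; first exact: (ccvg_comp cp cq).
  exact: ccvg_cst.
have fE : \forall s \near t, f (z + s%:C * v) =
    f (z + t%:C * v) + q (z + s%:C * v) * v * (s - t)%:C.
  have [e e0 fe] := fq; apply: filterS (cp _ e0) => s /fe ->.
  by rewrite opprD addrACA subrr add0r -mulrBl -rmorphB/= mulrAC [in LHS]mulrA.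
move: cqp => /ccvgP[qR qI]; split.
  apply: is_derive_slope qR _; apply: filterS fE => s ->.
  by rewrite ReD [X in _ + X]ReM /= mulr0 subr0.
apply: is_derive_slope qI _; apply: filterS fE => s ->.
by rewrite ImD [X in _ + X]ImM /= mulr0 add0r.
Qed.

End ComplexIntegral.

(** * Cauchy's theorem on rectangles *)

Section Rectangles.
Variable R : realType.
Local Notation C := R[i].
Local Notation mu := (@lebesgue_measure R).
Implicit Types (f g : C -> C) (x y a b c e : R) (z w : C).

Lemma hlineE (t y : R) : t +i* y = (0 +i* y) + t%:C * 1.
Proof. by apply: complex_ext => /=; ring. Qed.

Lemma vlineE (x s : R) : x +i* s = x%:C + s%:C * 'i.
Proof. by apply: complex_ext => /=; ring. Qed.

Lemma pcont_hline f t y : ccont f (t +i* y) -> pcont (fun s => f (s +i* y)) t.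
Proof.
move=> cf; apply: (ccvg_comp _ cf); apply/ccvgP; split; first exact: cvg_id.
exact: cvg_cst.
Qed.

Lemma pcont_vline f x s : ccont f (x +i* s) -> pcont (fun t => f (x +i* t)) s.
Proof.
move=> cf; apply: (ccvg_comp _ cf); apply/ccvgP; split; first exact: cvg_cst.
exact: cvg_id.
Qed.

Lemma rdiff_hline f t y l : cdiff f (t +i* y) l ->
  rdiff (fun s => f (s +i* y)) t l.
Proof.
move=> df; rewrite -[l]mulr1.
rewrite (_ : (fun s => _) = fun s : R => f ((0 +i* y) + s%:C * 1)).
  by apply: rdiff_line; rewrite -hlineE.
by apply/funext => s; rewrite hlineE.
Qed.

Lemma rdiff_vline f x s l : cdiff f (x +i* s) l ->
  rdiff (fun t => f (x +i* t)) s (l * 'i).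
Proof.
move=> df; rewrite (_ : (fun t => _) = fun t : R => f (x%:C + t%:C * 'i)).
  by apply: rdiff_line; rewrite -vlineE.
by apply/funext => t; rewrite vlineE.
Qed.

Definition inrect x0 x1 y0 y1 z :=
  (x0 <= complex.Re z <= x1) && (y0 <= complex.Im z <= y1).

Definition bdry x0 x1 y0 y1 z := inrect x0 x1 y0 y1 z &&
  [|| complex.Re z == x0, complex.Re z == x1, complex.Im z == y0 |
      complex.Im z == y1].

(** The counterclockwise contour integral: [dz] is [dt] on the horizontal sides and ['i ds] on the
    vertical ones. *)
Definition rint x0 x1 y0 y1 f : C :=
  cint `[x0, x1] (fun t => f (t +i* y0)) - cint `[x0, x1] (fun t => f (t +i* y1))
  + 'i * (cint `[y0, y1] (fun s => f (x1 +i* s)) -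
          cint `[y0, y1] (fun s => f (x0 +i* s))).

#[global] Arguments rint : simpl never.

(** Continuity is meant in the whole plane, not only from inside the rectangle. For this reason the
    map is later extended across the real line. *)
Definition bcont x0 x1 y0 y1 f := forall z, bdry x0 x1 y0 y1 z -> ccont f z.

Section bdry.
Context x0 x1 y0 y1 (x01 : x0 <= x1) (y01 : y0 <= y1).

Lemma bdry_bot t : x0 <= t <= x1 -> bdry x0 x1 y0 y1 (t +i* y0).
Proof. by move=> h; rewrite /bdry /inrect /= h lexx y01 eqxx !orbT. Qed.

Lemma bdry_top t : x0 <= t <= x1 -> bdry x0 x1 y0 y1 (t +i* y1).
Proof. by move=> h; rewrite /bdry /inrect /= h lexx y01 eqxx !orbT. Qed.

Lemma bdry_left s : y0 <= s <= y1 -> bdry x0 x1 y0 y1 (x0 +i* s).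
Proof. by move=> h; rewrite /bdry /inrect /= h lexx x01 eqxx. Qed.

Lemma bdry_right s : y0 <= s <= y1 -> bdry x0 x1 y0 y1 (x1 +i* s).
Proof. by move=> h; rewrite /bdry /inrect /= h lexx x01 eqxx !orbT. Qed.

Lemma bcont_sides f : bcont x0 x1 y0 y1 f ->
  [/\ cintegrable `[x0, x1] (fun t => f (t +i* y0)),
      cintegrable `[x0, x1] (fun t => f (t +i* y1)),
      cintegrable `[y0, y1] (fun s => f (x0 +i* s)) &
      cintegrable `[y0, y1] (fun s => f (x1 +i* s))].
Proof.
move=> cf; split; apply: cintegrable_cont => t h.
- by apply: pcont_hline; apply: cf; exact: bdry_bot.
- by apply: pcont_hline; apply: cf; exact: bdry_top.
- by apply: pcont_vline; apply: cf; exact: bdry_left.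
- by apply: pcont_vline; apply: cf; exact: bdry_right.
Qed.

Lemma rintD f g : bcont x0 x1 y0 y1 f -> bcont x0 x1 y0 y1 g ->
  rint x0 x1 y0 y1 (fun z => f z + g z) = rint x0 x1 y0 y1 f + rint x0 x1 y0 y1 g.
Proof.
move=> /bcont_sides[f1 f2 f3 f4] /bcont_sides[g1 g2 g3 g4].
by rewrite /rint !cintD//; ring.
Qed.

Lemma rintZ f k : bcont x0 x1 y0 y1 f ->
  rint x0 x1 y0 y1 (fun z => k * f z) = k * rint x0 x1 y0 y1 f.
Proof.
by move=> /bcont_sides[f1 f2 f3 f4]; rewrite /rint !cintZ//; ring.
Qed.

Lemma bcontB f g : bcont x0 x1 y0 y1 f -> bcont x0 x1 y0 y1 g ->
  bcont x0 x1 y0 y1 (fun z => f z - g z).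
Proof. by move=> cf cg z bz; apply: ccvgB; [exact: cf|exact: cg]. Qed.

Lemma rintB f g : bcont x0 x1 y0 y1 f -> bcont x0 x1 y0 y1 g ->
  rint x0 x1 y0 y1 (fun z => f z - g z) = rint x0 x1 y0 y1 f - rint x0 x1 y0 y1 g.
Proof.
move=> /bcont_sides[f1 f2 f3 f4] /bcont_sides[g1 g2 g3 g4].
by rewrite /rint !cintB//; ring.
Qed.

Lemma rint_bound f M : bcont x0 x1 y0 y1 f ->
  (forall z, bdry x0 x1 y0 y1 z -> cabs (f z) <= M) ->
  cabs (rint x0 x1 y0 y1 f) <= 2 * M * (x1 - x0 + (y1 - y0)).
Proof.
move=> /bcont_sides[f1 f2 f3 f4] fM; rewrite /rint (le_trans (cabsD _ _))//.
rewrite cabsM cabs_i mul1r.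
have := cint_bound x01 f1 (fun t h => fM _ (bdry_bot h)).
have := cint_bound x01 f2 (fun t h => fM _ (bdry_top h)).
have := cint_bound y01 f3 (fun t h => fM _ (bdry_left h)).
have := cint_bound y01 f4 (fun t h => fM _ (bdry_right h)).
have := cabsB (cint `[x0, x1] (fun t => f (t +i* y0))) (cint `[x0, x1] (fun t => f (t +i* y1))).
have := cabsB (cint `[y0, y1] (fun s => f (x1 +i* s))) (cint `[y0, y1] (fun s => f (x0 +i* s))).
lra.
Qed.

Lemma rint_prim f g : bcont x0 x1 y0 y1 f ->
  (forall z, bdry x0 x1 y0 y1 z -> cdiff g z (f z)) -> rint x0 x1 y0 y1 f = 0.
Proof.
move=> cf dg; rewrite /rint.
rewrite (cint_FTC (f := fun t => g (t +i* y0)) x01); last 2 first.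
  by move=> t h; apply: pcont_hline; apply: cf; exact: bdry_bot.
  by move=> t h; apply: rdiff_hline; apply: dg; exact: bdry_bot.
rewrite (cint_FTC (f := fun t => g (t +i* y1)) x01); last 2 first.
  by move=> t h; apply: pcont_hline; apply: cf; exact: bdry_top.
  by move=> t h; apply: rdiff_hline; apply: dg; exact: bdry_top.
have [_ _ f3 f4] := bcont_sides cf.
rewrite mulrBr -!cintZ//.
rewrite (cint_FTC (f := fun s => g (x1 +i* s)) y01); last 2 first.
  move=> t h; apply: ccvgM; first exact: ccvg_cst.
  by apply: pcont_vline; apply: cf; exact: bdry_right.
  by move=> t h; rewrite mulrC; apply: rdiff_vline; apply: dg; exact: bdry_right.
rewrite (cint_FTC (f := fun s => g (x0 +i* s)) y01); last 2 first.
  move=> t h; apply: ccvgM; first exact: ccvg_cst.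
  by apply: pcont_vline; apply: cf; exact: bdry_left.
  by move=> t h; rewrite mulrC; apply: rdiff_vline; apply: dg; exact: bdry_left.
by ring.
Qed.

End bdry.

Lemma rint_cutx f x0 x1 x2 y0 y1 : x0 <= x1 -> x1 <= x2 -> y0 <= y1 ->
  bcont x0 x1 y0 y1 f -> bcont x1 x2 y0 y1 f ->
  rint x0 x2 y0 y1 f = rint x0 x1 y0 y1 f + rint x1 x2 y0 y1 f.
Proof.
move=> x01 x12 y01 c1 c2; rewrite /rint.
have x02 := le_trans x01 x12.
rewrite (cint_split (f := fun t => f (t +i* y0)) x01 x12); last first.
  apply: cintegrable_cont => t /andP[t0 t2]; apply: pcont_hline.
  have [tx|xt] := leP t x1; first by apply: c1; apply: bdry_bot => //; rewrite t0.
  by apply: c2; apply: bdry_bot => //; rewrite t2 ltW.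
rewrite (cint_split (f := fun t => f (t +i* y1)) x01 x12); last first.
  apply: cintegrable_cont => t /andP[t0 t2]; apply: pcont_hline.
  have [tx|xt] := leP t x1; first by apply: c1; apply: bdry_top => //; rewrite t0.
  by apply: c2; apply: bdry_top => //; rewrite t2 ltW.
by ring.
Qed.

Lemma rint_cuty f x0 x1 y0 y1 y2 : x0 <= x1 -> y0 <= y1 -> y1 <= y2 ->
  bcont x0 x1 y0 y1 f -> bcont x0 x1 y1 y2 f ->
  rint x0 x1 y0 y2 f = rint x0 x1 y0 y1 f + rint x0 x1 y1 y2 f.
Proof.
move=> x01 y01 y12 c1 c2; rewrite /rint.
have y02 := le_trans y01 y12.
rewrite (cint_split (f := fun t => f (x0 +i* t)) y01 y12); last first.
  apply: cintegrable_cont => t /andP[t0 t2]; apply: pcont_vline.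
  have [tx|xt] := leP t y1; first by apply: c1; apply: bdry_left => //; rewrite t0.
  by apply: c2; apply: bdry_left => //; rewrite t2 ltW.
rewrite (cint_split (f := fun t => f (x1 +i* t)) y01 y12); last first.
  apply: cintegrable_cont => t /andP[t0 t2]; apply: pcont_vline.
  have [tx|xt] := leP t y1; first by apply: c1; apply: bdry_right => //; rewrite t0.
  by apply: c2; apply: bdry_right => //; rewrite t2 ltW.
by ring.
Qed.

(** Each left end point lies below each right end point, so the supremum of the left ones belongs to
    all the intervals. *)
Lemma nested_point (u : nat -> R) (L : R) :
  (forall n, u n <= u n.+1) ->
  (forall n, u n.+1 + L / 2 ^+ n.+1 <= u n + L / 2 ^+ n) -> 0 <= L ->
  exists p, forall n, u n <= p <= u n + L / 2 ^+ n.
Proof.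
move=> u1 u2 L0.
have um n k : u n <= u (n + k)%N.
  by elim: k => [|k IH]; rewrite ?addn0// addnS (le_trans IH).
have uM n k : u (n + k)%N + L / 2 ^+ (n + k) <= u n + L / 2 ^+ n.
  by elim: k => [|k IH]; rewrite ?addn0// addnS (le_trans (u2 _)).
have Lk k : 0 <= L / 2 ^+ k by rewrite divr_ge0// exprn_ge0.
have umM n m : u n <= u m + L / 2 ^+ m.
  have [nm|mn] := leqP n m.
    by rewrite (le_trans (um n (m - n)%N))// subnKC// lerDl.
  rewrite (le_trans _ (uM m (n - m)%N))// subnKC ?(ltnW mn)// lerDl//.
have ub : has_ubound (range u) by exists (u 0%N + L / 2 ^+ 0) => _ [n _ <-].
exists (sup (range u)) => n; rewrite ub_le_sup//=; last by exists n.
by apply: ge_sup; [exists (u 0%N), 0%N|move=> _ [m _ <-]].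
Qed.

Definition cdiffable f z := exists l, cdiff f z l.

Lemma inrect_bdry x0 x1 y0 y1 z : bdry x0 x1 y0 y1 z -> inrect x0 x1 y0 y1 z.
Proof. by case/andP. Qed.

Lemma cabs_pos4 (z1 z2 z3 z4 : C) (k : R) :
  4 * k <= cabs (z1 + z2 + (z3 + z4)) ->
  [\/ k <= cabs z1, k <= cabs z2, k <= cabs z3 | k <= cabs z4].
Proof.
move=> h; have [h1|h1] := leP k (cabs z1); first exact: Or41.
have [h2|h2] := leP k (cabs z2); first exact: Or42.
have [h3|h3] := leP k (cabs z3); first exact: Or43.
have [h4|h4] := leP k (cabs z4); first exact: Or44.
have := cabsD (z1 + z2) (z3 + z4); have := cabsD z1 z2; have := cabsD z3 z4.
lra.
Qed.

(** The affine part of [f] at [p] has a primitive and integrates to zero. What remains is small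
    compared with the distance to [p], and half the perimeter bounds that distance. *)
Lemma goursat_local f p : cdiffable f p -> forall e, 0 < e ->
  exists2 d, 0 < d & forall x0 x1 y0 y1,
    x0 <= complex.Re p <= x1 -> y0 <= complex.Im p <= y1 ->
    x1 - x0 + (y1 - y0) < d -> bcont x0 x1 y0 y1 f ->
    cabs (rint x0 x1 y0 y1 f) <= e * (x1 - x0 + (y1 - y0)) ^+ 2.
Proof.
move=> [l [q [cq ql fq]]] e e0.
have e20 : 0 < e / 2 by rewrite divr_gt0.
have [d d0 Hd] : \forall z \near cnbhs p,
    f z = f p + q z * (z - p) /\ cabs (q z - q p) < e / 2.
  by near=> z; split; near: z => //; exact: cq.
exists d => // x0 x1 y0 y1 /andP[px0 px1] /andP[py0 py1].
set S := x1 - x0 + (y1 - y0) => Sd cf.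
have x01 := le_trans px0 px1; have y01 := le_trans py0 py1.
pose r z := f p + l * (z - p).
have dr z : cdiff r z l.
  rewrite -[l in cdiff _ _ l]add0r; apply: cdiffD; first exact: cdiff_cst.
  have := cdiffM (cdiff_cst l z) (cdiffB (cdiff_id z) (cdiff_cst p z)).
  by rewrite mul0r add0r subr0 mulr1.
have cr : bcont x0 x1 y0 y1 r by move=> z _; exact: cdiff_cont (dr z).
have r0 : rint x0 x1 y0 y1 r = 0.
  apply: (@rint_prim _ _ _ _ x01 y01 _ (fun z => f p * z + l / 2 * (z - p) ^+ 2)) => //.
  move=> z _.
  have d1 := cdiffM (cdiff_cst (f p) z) (cdiff_id z).
  have d2 := cdiffM (cdiff_cst (l / 2) z)
    (cdiffX 2 (cdiffB (cdiff_id z) (cdiff_cst p z))).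
  have := cdiffD d1 d2; congr cdiff.
  rewrite /r /= mul0r add0r mulr1 mul0r add0r subr0 mulr1 expr1.
  by congr (_ + _); field.
rewrite -[rint _ _ _ _ f]subr0 -r0 -rintB//.
(* The remainder is at most [e / 2 * S] on the boundary, whose length is [2 * S]. *)
have -> : e * S ^+ 2 = 2 * (e / 2 * S) * S by field.
apply: rint_bound => //; first exact: bcontB.
move=> z /inrect_bdry /andP[/andP[z1 z2] /andP[z3 z4]].
have zS : cabs (z - p) <= S.
  rewrite (le_trans (cabs_le_ReIm _))// ReD ImD ReN ImN lerD//.
    by rewrite ler_norml; apply/andP; split;
      rewrite ?lerB// lerNl opprB lerB.
  by rewrite ler_norml; apply/andP; split;
    rewrite ?lerB// lerNl opprB lerB.
have [|fz qz] := Hd z; first exact: le_lt_trans Sd.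
rewrite /r fz opprD addrACA subrr add0r -mulrBl cabsM -ql.
by apply: ler_pM; rewrite ?cabs_ge0// ltW.
Unshelve. all: by end_near. Qed.

(** Bisection: some quarter keeps a quarter of the modulus, hence at least [I / 4 ^+ n] after [n]
    steps. At the common point of the rectangles the local bound is [e' * (S / 2 ^+ n) ^+ 2], and
    the powers of 4 cancel. *)
Lemma goursat f x0 x1 y0 y1 : x0 <= x1 -> y0 <= y1 ->
  (forall z, inrect x0 x1 y0 y1 z -> cdiffable f z) -> rint x0 x1 y0 y1 f = 0.
Proof.
move=> x01 y01 df; apply/eqP; rewrite -cabs_eq0; apply/negPn/negP => /eqP/eqP I0.
set I := cabs (rint x0 x1 y0 y1 f) in I0.
have {}I0 : 0 < I by rewrite lt_neqAle eq_sym I0 cabs_ge0.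
pose L := x1 - x0; pose H := y1 - y0.
have L0 : 0 <= L by rewrite subr_ge0.
have H0 : 0 <= H by rewrite subr_ge0.
have K0 (K : R) n : 0 <= K -> 0 <= K / 2 ^+ n by move=> ?; rewrite divr_ge0// exprn_ge0.
pose P n (p : R * R) := [/\ x0 <= p.1, p.1 + L / 2 ^+ n <= x1, y0 <= p.2,
  p.2 + H / 2 ^+ n <= y1 &
  I / 4 ^+ n <= cabs (rint p.1 (p.1 + L / 2 ^+ n) p.2 (p.2 + H / 2 ^+ n) f)].
have halfE (K : R) n : K / 2 ^+ n = K / 2 ^+ n.+1 + K / 2 ^+ n.+1.
  by rewrite exprS invfM mulrA -mulrDl; congr (_ / _); field.
have step n p : P n p -> exists q, [/\ P n.+1 q, p.1 <= q.1,
    q.1 + L / 2 ^+ n.+1 <= p.1 + L / 2 ^+ n, p.2 <= q.2 &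
    q.2 + H / 2 ^+ n.+1 <= p.2 + H / 2 ^+ n].
  move=> []; case: p => x y /= px0 px1 py0 py1 PI.
  have l0 := K0 _ n.+1 L0; have h0 := K0 _ n.+1 H0.
  move: px1 py1 PI; rewrite !(halfE _ n) !addrA.
  set l := L / 2 ^+ n.+1 in l0 *; set k := H / 2 ^+ n.+1 in h0 * => px1 py1 PI.
  have xl : x <= x + l by rewrite lerDl.
  have xll : x + l <= x + l + l by rewrite lerDl.
  have yk : y <= y + k by rewrite lerDl.
  have ykk : y + k <= y + k + k by rewrite lerDl.
  have x0l := le_trans px0 xl; have xl1 := le_trans xll px1.
  have yk2 := le_trans yk ykk; have y0k := le_trans py0 yk; have yk1 := le_trans ykk py1.
  have bc a b c d : x0 <= a -> b <= x1 -> y0 <= c -> d <= y1 -> bcont a b c d f.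
    move=> a0 b1 c0 d1 z /inrect_bdry /andP[/andP[h1 h2] /andP[h3 h4]].
    suff /df[m /cdiff_cont] : inrect x0 x1 y0 y1 z by [].
    by rewrite /inrect (le_trans a0)//= (le_trans h2)//= (le_trans c0)//= (le_trans h4).
  move: PI; rewrite (@rint_cutx _ _ (x + l)) //; try by apply: bc.
  rewrite (@rint_cuty _ x _ _ (y + k)) //; try by apply: bc.
  rewrite (@rint_cuty _ (x + l) _ _ (y + k)) //; try by apply: bc.
  have -> : I / 4 ^+ n = 4 * (I / 4 ^+ n.+1).
    rewrite exprS; field; exact: expf_neq0.
  case/cabs_pos4 => PI.
  - by exists (x, y); split; rewrite /P/= -/l -/k; [split|..].
  - by exists (x, y + k); split; rewrite /P/= -/l -/k; [split|..].
  - by exists (x + l, y); split; rewrite /P/= -/l -/k; [split|..].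
  - by exists (x + l, y + k); split; rewrite /P/= -/l -/k; [split|..].
have P0 : P 0%N (x0, y0).
  by rewrite /P /= !expr0 !divr1 /L /H !(addrC _ (_ - _)) !subrK.
(* Dependent choice: the invariant [P n] travels in the subtype, and [nxt] selects a quarter that
   preserves it. *)
pose nxt n (p : {p | P n p}) : {q | P n.+1 q} :=
  let s := cid (step n _ (svalP p)) in
  exist _ (sval s) (let: And5 h _ _ _ _ := svalP s in h).
pose fix sq n : {p | P n p} :=
  match n with 0%N => exist _ _ P0 | m.+1 => nxt _ (sq m) end.
have sqS n : [/\ (sval (sq n)).1 <= (sval (sq n.+1)).1,
    (sval (sq n.+1)).1 + L / 2 ^+ n.+1 <= (sval (sq n)).1 + L / 2 ^+ n,
    (sval (sq n)).2 <= (sval (sq n.+1)).2 &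
    (sval (sq n.+1)).2 + H / 2 ^+ n.+1 <= (sval (sq n)).2 + H / 2 ^+ n].
  by rewrite /=; case: (cid _) => q [].
have [px pxP] := @nested_point (fun n => (sval (sq n)).1) L
  (fun n => let: And4 h _ _ _ := sqS n in h)
  (fun n => let: And4 _ h _ _ := sqS n in h) L0.
have [py pyP] := @nested_point (fun n => (sval (sq n)).2) H
  (fun n => let: And4 _ _ h _ := sqS n in h)
  (fun n => let: And4 _ _ _ h := sqS n in h) H0.
pose p := px +i* py.
have /df dp : inrect x0 x1 y0 y1 p.
  have := pxP 0%N; have := pyP 0%N.
  by rewrite /inrect /= !expr0 !divr1 /L /H !(addrC _ (_ - _)) !subrK => -> ->.
have : I <= 0; last by rewrite leNgt I0.
apply/ler_addgt0Pr => e e0; rewrite add0r.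
pose S := L + H; have S0 : 0 <= S by rewrite addr_ge0.
(* [S] vanishes for a degenerate rectangle, hence the [+ 1] in the denominator. *)
pose e' := e / (S ^+ 2 + 1).
have S20 : 0 < S ^+ 2 + 1 by rewrite ltr_wpDl// sqr_ge0.
have e'0 : 0 < e' by rewrite divr_gt0.
have [d d0 Hd] := goursat_local dp e'0.
have [n Sn] : exists n, S / 2 ^+ n < d.
  pose n := Num.truncn (S / d); exists n.+1.
  rewrite ltr_pdivrMr ?exprn_gt0// mulrC -ltr_pdivrMr//.
  have : S / d < n.+1%:R by rewrite truncnS_gt ?divr_ge0// ltW.
  move=> /lt_le_trans; apply.
  by rewrite -natrX ler_nat ltnW// ltn_expl.
have [] := svalP (sq n); move: (pxP n) (pyP n).
case: (sval (sq n)) => x y /= pxn pyn q1 q2 q3 q4 q5.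
have SE : x + L / 2 ^+ n - x + (y + H / 2 ^+ n - y) = S / 2 ^+ n.
  by rewrite [RHS]mulrDl [x + _]addrC [y + _]addrC !addrK.
have Hn := Hd _ _ _ _ pxn pyn; rewrite SE in Hn.
have {Hn} : I / 4 ^+ n <= e' * (S / 2 ^+ n) ^+ 2.
  apply: (le_trans q5); apply: Hn => // z /inrect_bdry /andP[/andP[z1 z2] /andP[z3 z4]].
  suff /df[m /cdiff_cont] : inrect x0 x1 y0 y1 z by [].
  by rewrite /inrect (le_trans q1)//= (le_trans z2)//= (le_trans q3)//= (le_trans z4).
rewrite ler_pdivrMr ?exprn_gt0// => /le_trans; apply.
have -> : e' * (S / 2 ^+ n) ^+ 2 * 4 ^+ n = e' * S ^+ 2.
  have -> : (4 : R) ^+ n = 2 ^+ n * 2 ^+ n by rewrite -exprMn; congr (_ ^+ n); ring.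
  by field; rewrite expf_neq0.
by rewrite /e' mulrAC ler_pdivrMr// ler_wpM2l ?(ltW e0)// lerDl.
Qed.

(** The bottom side will carry the boundary values of the map, about which only continuity is
    known. *)
Definition hol_rect x0 x1 y0 y1 f :=
  (forall z, inrect x0 x1 y0 y1 z -> ccont f z) /\
  (forall z, inrect x0 x1 y0 y1 z -> y0 < complex.Im z -> cdiffable f z).

(** Compactness of the bottom side makes continuity at its points uniform in [t]. *)
Lemma near_bottom f x0 x1 y0 : (forall t, x0 <= t <= x1 -> ccont f (t +i* y0)) ->
  forall e, 0 < e -> exists2 d, 0 < d & forall t s, x0 <= t <= x1 ->
    `|s - y0| < d -> cabs (f (t +i* s) - f (t +i* y0)) < e.
Proof.
move=> cf e e0.
suff : \forall s \near nbhs y0, `[x0, x1]%classic `<=`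
    (fun t => cabs (f (t +i* s) - f (t +i* y0)) < e).
  move=> /nbhs_ballP[d /= d0 Hd]; exists d => // t s tx sd.
  by apply: (Hd s) => //=; rewrite /ball /= distrC.
have /compact_near_coveringP := @segment_compact _ x0 x1.
apply.
move=> t; rewrite /= in_itv /= => tx.
have [d d0 Hd] := cf _ tx _ (divr_gt0 e0 (ltr0n _ 2)).
have d20 : 0 < d / 2 by rewrite divr_gt0.
exists (ball t (d / 2), ball y0 (d / 2)) => /=.
  by split; exact: nbhsx_ballx.
move=> [t' s'] /= [tt' ss'].
have dist u v : `|u - t| < d / 2 -> `|v - y0| < d / 2 ->
    cabs (u +i* v - t +i* y0) < d.
  move=> ut vy; rewrite (le_lt_trans (cabs_le_ReIm _))//= [d]splitr.
  by rewrite ltrD.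
rewrite -(subrKA (f (t +i* y0))) (le_lt_trans (cabsD _ _))// [e]splitr.
rewrite ltrD// ?[cabs (f (t +i* y0) - _)]cabs_distC; apply: Hd; apply: dist.
- by rewrite distrC.
- by rewrite distrC.
- by rewrite distrC.
- by rewrite subrr normr0.
Qed.

(** A thin strip along the bottom is cut off, and above it the integral vanishes by [goursat]. In
    the strip the two long sides nearly cancel by uniform continuity, and the short sides are
    negligible. *)
Lemma goursat_bottom f x0 x1 y0 y1 : x0 <= x1 -> y0 <= y1 ->
  hol_rect x0 x1 y0 y1 f -> rint x0 x1 y0 y1 f = 0.
Proof.
move=> x01; rewrite le_eqVlt => /predU1P[-> _|y01 [cf df]].
  by rewrite /rint !set_itv1 !cint_set1 !subrr mulr0 addr0.
apply/eqP; rewrite -cabs_eq0 eq_le cabs_ge0 andbT.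
apply/ler_addgt0Pr => e e0; rewrite add0r.
have cfb t : x0 <= t <= x1 -> ccont f (t +i* y0).
  by move=> tx; apply: cf; rewrite /inrect /= tx lexx ltW.
pose M := Num.max (cabs (f (x0 +i* y0))) (cabs (f (x1 +i* y0))) + 1.
have M0 : 0 < M by rewrite ltr_wpDl// le_max cabs_ge0.
pose L := x1 - x0 + 1; have L0 : 0 < L by rewrite ltr_wpDl// subr_ge0.
have [d1 d10 H1] := near_bottom cfb (divr_gt0 e0 (mulr_gt0 (ltr0n _ 2) L0)).
have [d2 d20 H2] := near_bottom cfb ltr01.
(* The halves keep [d] strictly below [d1] and [d2]. The bound [y1 - y0] keeps the strip inside the
   rectangle, and [e / (4 * M)] lets each short side contribute at most [e / 4]; the long sides
   share the other [e / 2]. *)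
pose d := Num.min (Num.min (d1 / 2) (d2 / 2)) (Num.min (y1 - y0) (e / (4 * M))).
have d0 : 0 < d by rewrite !lt_min !divr_gt0//= ?subr_gt0 ?y01 ?mulr_gt0.
have dd1 : d < d1 by rewrite /d !gt_min ltr_pdivrMr// mulr_natr mulr2n ltrDl d10.
have dd2 : d < d2.
  by rewrite /d !gt_min [d2 / 2 < d2]ltr_pdivrMr// mulr_natr mulr2n ltrDl d20 !orbT.
have dy : y0 + d <= y1 by rewrite -lerBrDl /d !ge_min lexx !orbT.
have de : M * d <= e / 4.
  by rewrite mulrC -ler_pdivlMr// -mulrA -invfM /d !ge_min lexx !orbT.
have cR a b : y0 <= a -> b <= y1 -> bcont x0 x1 a b f.
  move=> ya yb z /inrect_bdry /andP[zx /andP[z1 z2]]; apply: cf.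
  by rewrite /inrect zx (le_trans ya)//= (le_trans z2).
have yd : y0 <= y0 + d by rewrite lerDl ltW.
rewrite (@rint_cuty _ _ _ _ (y0 + d)) //; [|exact: cR..].
rewrite [X in _ + X]goursat ?addr0//; last first.
  move=> z /andP[zx /andP[z1 z2]]; apply: df.
    by rewrite /inrect zx z2 (le_trans yd).
  by rewrite (lt_le_trans _ z1)// ltrDl.
have [i1 i2 i3 i4] := bcont_sides x01 yd (cR _ _ (lexx _) dy).
rewrite /rint (le_trans (cabsD _ _))// cabsM cabs_i mul1r.
have -> : e = e / (2 * L) * L + (e / 4 + e / 4) by field; rewrite gt_eqF.
have sd s : y0 <= s <= y0 + d -> `|s - y0| <= d.
  by move=> /andP[s1 s2]; rewrite ger0_norm ?subr_ge0// lerBlDl.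
apply: lerD.
  rewrite -cintB//; apply: (@le_trans _ _ (e / (2 * L) * (x1 - x0))).
    apply: cint_bound => //; first exact: cintegrableB.
    move=> t tx; rewrite cabs_distC ltW//; apply: H1 => //.
    by rewrite (le_lt_trans (sd _ _))// yd lexx.
  by rewrite ler_wpM2l ?divr_ge0 ?mulr_ge0 ?(ltW e0) ?(ltW L0)// lerDl.
have Mx x s : x0 <= x <= x1 -> cabs (f (x +i* y0)) <= M - 1 ->
    y0 <= s <= y0 + d -> cabs (f (x +i* s)) <= M.
  move=> xx xM sy; have : cabs (f (x +i* s) - f (x +i* y0)) < 1.
    by apply: H2 => //; rewrite (le_lt_trans (sd _ _)).
  have := cabsD (f (x +i* s) - f (x +i* y0)) (f (x +i* y0)); rewrite subrK.
  by lra.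
rewrite (le_trans (cabsB _ _))// lerD//; apply: le_trans de.
  rewrite -[X in _ <= _ * X](addrK y0) [d + _]addrC.
  by apply: cint_bound => // s; apply: Mx; rewrite ?lexx ?x01// /M addrK le_max lexx orbT.
rewrite -[X in _ <= _ * X](addrK y0) [d + _]addrC.
by apply: cint_bound => // s; apply: Mx; rewrite ?lexx ?x01// /M addrK le_max lexx.
Qed.

(** The four rectangles around the small square avoid [p], so their integrals vanish. One of them
    rests on the bottom side, whence [goursat_bottom]. *)
Lemma rint_shrink f p x0 x1 y0 y1 e : 0 < e ->
  x0 < complex.Re p - e -> complex.Re p + e < x1 ->
  y0 < complex.Im p - e -> complex.Im p + e < y1 ->
  (forall z, inrect x0 x1 y0 y1 z -> z != p -> ccont f z) ->
  (forall z, inrect x0 x1 y0 y1 z -> y0 < complex.Im z -> z != p ->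
     cdiffable f z) ->
  rint x0 x1 y0 y1 f = rint (complex.Re p - e) (complex.Re p + e)
    (complex.Im p - e) (complex.Im p + e) f.
Proof.
case: p => a b /= e0 xa xb ya yb cf df.
have G u v c d : x0 <= u -> v <= x1 -> y0 <= c -> d <= y1 -> u <= v -> c <= d ->
    ~~ inrect u v c d (a +i* b) -> rint u v c d f = 0.
  move=> ux vx cy dy uv cd np; apply: goursat_bottom => //.
  have sub z : inrect u v c d z -> inrect x0 x1 y0 y1 z /\ z != a +i* b.
    move=> /[dup] zi /andP[/andP[z1 z2] /andP[z3 z4]]; split.
      by rewrite /inrect (le_trans ux)//= (le_trans z2)//= (le_trans cy)//= (le_trans z4).
    by apply: contraNneq np => <-.
  split=> z /sub[zi zp]; first exact: cf.
  move=> cz; apply: df => //; exact: le_lt_trans cz.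
have bc u v c d : x0 <= u -> v <= x1 -> y0 <= c -> d <= y1 ->
    u != a -> v != a -> c != b -> d != b -> bcont u v c d f.
  move=> ux vx cy dy ua va cb db z /andP[/andP[/andP[z1 z2] /andP[z3 z4]] zb].
  apply: cf.
    by rewrite /inrect (le_trans ux)//= (le_trans z2)//= (le_trans cy)//= (le_trans z4).
  apply: contraTneq zb => -> /=.
  by rewrite !(eq_sym a) !(eq_sym b) !negb_or ua va cb db.
have ae : a - e < a by rewrite ltrBlDr ltrDl.
have ae' : a < a + e by rewrite ltrDl.
have be : b - e < b by rewrite ltrBlDr ltrDl.
have be' : b < b + e by rewrite ltrDl.
have aee := lt_trans ae ae'; have bee := lt_trans be be'.
have xa' := lt_trans xa ae; have xb' := lt_trans ae' xb.
have ya' := lt_trans ya be; have yb' := lt_trans be' yb.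
have xaa := lt_trans xa aee; have yaa := lt_trans ya bee.
have xbb := lt_trans aee xb; have ybb := lt_trans bee yb.
have lxa := ltW xa; have lxb := ltW xb; have lya := ltW ya; have lyb := ltW yb.
have lxaa := ltW xaa; have lxbb := ltW xbb; have lyaa := ltW yaa; have lybb := ltW ybb.
have lae := ltW aee; have lbe := ltW bee; have lyy := ltW (lt_trans ya' yb').
have [nx0 nx1] : x0 != a /\ x1 != a by rewrite (lt_eqF xa') (gt_eqF xb').
have [ny0 ny1] : y0 != b /\ y1 != b by rewrite (lt_eqF ya') (gt_eqF yb').
have [na na'] : a - e != a /\ a + e != a by rewrite (lt_eqF ae) (gt_eqF ae').
have [nb nb'] : b - e != b /\ b + e != b by rewrite (lt_eqF be) (gt_eqF be').
rewrite (@rint_cutx f x0 (a - e) x1) //; try by apply: bc.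
rewrite G ?add0r //; last first.
  by rewrite /inrect /= [a <= a - e]leNgt ae andbF.
rewrite (@rint_cutx f _ (a + e) x1) //; try by apply: bc.
rewrite [X in _ + X]G ?addr0 //; last first.
  by rewrite /inrect /= [a + e <= a]leNgt ae'.
rewrite (@rint_cuty f _ _ y0 (b - e) y1) //; try by apply: bc.
rewrite G ?add0r //; last first.
  by rewrite /inrect /= [b <= b - e]leNgt be !andbF.
rewrite (@rint_cuty f _ _ _ (b + e) y1) //; try by apply: bc.
rewrite [X in _ + X]G ?addr0 //.
by rewrite /inrect /= [b + e <= b]leNgt be' !andbF.
Qed.

End Rectangles.

(** * Cauchy's integral formulas for a function and its derivative *)

Section Cauchy.
Variable R : realType.
Local Notation C := R[i].
Local Notation mu := (@lebesgue_measure R).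
Implicit Types (f g : C -> C) (x y a b c e : R) (z w : C).

Lemma continuous_real_rat (t c y : R) : y != 0 ->
  {for t, continuous (fun s : R => y / ((s - c) ^+ 2 + y ^+ 2))}.
Proof.
move=> y0; apply: cvgM; first exact: cvg_cst.
apply: cvgV; first by rewrite paddr_eq0 ?sqr_ge0// negb_and !sqrf_eq0 y0 orbT.
apply: cvgD; last exact: cvg_cst.
by apply: cvgM; apply: cvgB; (exact: cvg_id || exact: cvg_cst).
Qed.

Lemma Rintegral_poisson_atan (a b c y : R) : a <= b -> y != 0 ->
  \int[mu]_(t in `[a, b]) (y / ((t - c) ^+ 2 + y ^+ 2)) =
  atan ((b - c) / y) - atan ((a - c) / y).
Proof.
move=> ab y0; apply: (@Rintegral_FTC _ (fun t => atan ((t - c) / y))) => // t _.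
  exact: continuous_real_rat.
have d1 : is_derive t 1 (fun s : R => (s - c) / y) y^-1.
  by apply: is_derive_eq; rewrite /GRing.scale /=; ring.
have n0 : (t - c) ^+ 2 + y ^+ 2 != 0.
  by rewrite paddr_eq0 ?sqr_ge0// negb_and !sqrf_eq0 y0 orbT.
rewrite (_ : y / _ = (1 + ((t - c) / y) ^+ 2)^-1 * y^-1).
  exact: (is_derive1_comp (is_derive1_atan _) d1).
have n1 : 1 + ((t - c) / y) ^+ 2 != 0 by rewrite gt_eqF// ltr_wpDr// sqr_ge0.
have -> : (1 + ((t - c) / y) ^+ 2) = ((t - c) ^+ 2 + y ^+ 2) / y ^+ 2 by field.
by move: (_ + _) n0 => w n0; field; rewrite n0 y0.
Qed.

Lemma Rintegral_log (a b c y : R) : a <= b -> y != 0 ->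
  \int[mu]_(t in `[a, b]) ((t - c) / ((t - c) ^+ 2 + y ^+ 2)) =
  2^-1 * ln ((b - c) ^+ 2 + y ^+ 2) - 2^-1 * ln ((a - c) ^+ 2 + y ^+ 2).
Proof.
move=> ab y0; apply: (@Rintegral_FTC _ (fun t => 2^-1 * ln ((t - c) ^+ 2 + y ^+ 2))) => // t _.
  apply: cvgM; first by apply: cvgB; [exact: cvg_id|exact: cvg_cst].
  apply: cvgV; first by rewrite paddr_eq0 ?sqr_ge0// negb_and !sqrf_eq0 y0 orbT.
  apply: cvgD; last exact: cvg_cst.
  by apply: cvgM; apply: cvgB; (exact: cvg_id || exact: cvg_cst).
have n0 : (t - c) ^+ 2 + y ^+ 2 != 0.
  by rewrite paddr_eq0 ?sqr_ge0// negb_and !sqrf_eq0 y0 orbT.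
have p0 : 0 < (t - c) ^+ 2 + y ^+ 2 by rewrite lt_neqAle eq_sym n0 addr_ge0// sqr_ge0.
have d1 : is_derive t 1 (fun t : R => (t - c) ^+ 2 + y ^+ 2) (2 * (t - c)).
  by apply: is_derive_eq; rewrite /GRing.scale /=; ring.
have d2 := is_derive1_comp (g := fun t : R => (t - c) ^+ 2 + y ^+ 2) (is_derive1_ln p0) d1.
rewrite (_ : _ / _ = 2^-1 *: (((t - c) ^+ 2 + y ^+ 2)^-1 * (2 * (t - c)))).
  exact: (is_deriveZ _ d2).
by rewrite /GRing.scale /=; field.
Qed.

(* The logarithmic parts of the sides cancel, each side gives [i * pi / 2]. *)
Lemma rint_square_inv p e : 0 < e ->
  rint (complex.Re p - e) (complex.Re p + e) (complex.Im p - e)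
    (complex.Im p + e) (fun z => (z - p)^-1) = (2 * pi)%:C * 'i.
Proof.
move=> e0; have en0 : e != 0 by rewrite gt_eqF.
have ne0 : - e != 0 by rewrite oppr_eq0.
case: p => u v /=.
have ue : u - e <= u + e by rewrite lerD2l ge0_cp// ltW.
have ve : v - e <= v + e by rewrite lerD2l ge0_cp// ltW.
have i1 (y a c : R) : y != 0 -> \int[mu]_(t in `[a - e, a + e]) (y / ((t - a) ^+ 2 + y ^+ 2)) =
    atan (e / y) - atan (- e / y).
  move=> y0; rewrite Rintegral_poisson_atan//; last by rewrite lerD2l ge0_cp// ltW.
  by rewrite [a - e]addrC [a + e]addrC !addrK.
have i2 (y a c : R) : y != 0 -> \int[mu]_(t in `[a - e, a + e]) ((t - a) / ((t - a) ^+ 2 + y ^+ 2)) = 0.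
  move=> y0; rewrite Rintegral_log//; last by rewrite lerD2l ge0_cp// ltW.
  by rewrite [a - e]addrC [a + e]addrC !addrK sqrrN subrr.
have at1 : atan (e / e) - atan (- e / e) = pi / 2.
  by rewrite mulNr divff// atanN atan1; field.
have at2 : atan (e / - e) - atan (- e / - e) = - (pi / 2).
  by rewrite invrN mulrN mulrNN divff// atanN atan1; field.
have invE (a b : R) : (a +i* b)^-1 = (a / (a ^+ 2 + b ^+ 2)) +i* (- b / (a ^+ 2 + b ^+ 2)).
  by rewrite mulNr.
rewrite /rint.
have bot : cint `[u - e, u + e] (fun t => (t +i* (v - e) - (u +i* v))^-1) = 0 +i* (pi / 2).
  have E : (fun t : R => (t +i* (v - e) - (u +i* v))^-1) = fun t : R =>
      ((t - u) / ((t - u) ^+ 2 + e ^+ 2)) +i* (e / ((t - u) ^+ 2 + e ^+ 2)).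
    apply/funext => t; rewrite [X in X^-1](_ : _ = (t - u) +i* (- e)); last by simpc; congr (_ +i* _); ring.
    by rewrite invE sqrrN opprK.
  rewrite E /cint; apply: complex_ext => /=.
    exact: i2.
  by rewrite i1.
have top : cint `[u - e, u + e] (fun t => (t +i* (v + e) - (u +i* v))^-1) = 0 +i* (- (pi / 2)).
  have E : (fun t : R => (t +i* (v + e) - (u +i* v))^-1) = fun t : R =>
      ((t - u) / ((t - u) ^+ 2 + (- e) ^+ 2)) +i* (- e / ((t - u) ^+ 2 + (- e) ^+ 2)).
    apply/funext => t; rewrite [X in X^-1](_ : _ = (t - u) +i* e); last by simpc; congr (_ +i* _); ring.
    by rewrite invE sqrrN.
  rewrite E /cint; apply: complex_ext => /=.
    exact: i2.
  by rewrite i1.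
have rgt : cint `[v - e, v + e] (fun s => ((u + e) +i* s - (u +i* v))^-1) = (pi / 2)%:C.
  have E : (fun s : R => ((u + e) +i* s - (u +i* v))^-1) = fun s : R =>
      (e / ((s - v) ^+ 2 + e ^+ 2)) +i* (- 1 * ((s - v) / ((s - v) ^+ 2 + e ^+ 2))).
    apply/funext => s; rewrite [X in X^-1](_ : _ = e +i* (s - v)); last by simpc; congr (_ +i* _); ring.
    by rewrite invE addrC mulN1r mulNr.
  rewrite E /cint; apply: complex_ext => /=.
    by rewrite i1.
  rewrite RintegralZl ?i2 ?mulr0//.
  apply: continuous_compact_integrable; first exact: segment_compact.
  apply: continuous_in_subspaceT => t _.
  have -> : (fun t0 : R => (t0 - v) / ((t0 - v) ^+ 2 + e ^+ 2)) =
     (fun t0 : R => e^-1 * ((t0 - v) * (e / ((t0 - v) ^+ 2 + e ^+ 2)))).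
    by apply/funext => r; rewrite [RHS]mulrCA; congr (_ * _); rewrite mulrA mulVf// mul1r.
  apply: cvgM; first exact: cvg_cst.
  apply: cvgM; first by apply: cvgB; [exact: cvg_id|exact: cvg_cst].
  exact: continuous_real_rat.
have lft : cint `[v - e, v + e] (fun s => ((u - e) +i* s - (u +i* v))^-1) = (- (pi / 2))%:C.
  have E : (fun s : R => ((u - e) +i* s - (u +i* v))^-1) = fun s : R =>
      (- e / ((s - v) ^+ 2 + (- e) ^+ 2)) +i* (- 1 * ((s - v) / ((s - v) ^+ 2 + (- e) ^+ 2))).
    apply/funext => s; rewrite [X in X^-1](_ : _ = (- e) +i* (s - v)); last by simpc; congr (_ +i* _); ring.
    by rewrite invE (addrC ((- e) ^+ 2)); congr (_ +i* _); rewrite mulN1r mulNr.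
  rewrite E /cint; apply: complex_ext => /=.
    by rewrite i1.
  rewrite RintegralZl ?i2 ?mulr0//.
  apply: continuous_compact_integrable; first exact: segment_compact.
  apply: continuous_in_subspaceT => t _.
  have -> : (fun t0 : R => (t0 - v) / ((t0 - v) ^+ 2 + (- e) ^+ 2)) =
     (fun t0 : R => e^-1 * ((t0 - v) * (e / ((t0 - v) ^+ 2 + e ^+ 2)))).
    by apply/funext => r; rewrite sqrrN [RHS]mulrCA; congr (_ * _); rewrite mulrA mulVf// mul1r.
  apply: cvgM; first exact: cvg_cst.
  apply: cvgM; first by apply: cvgB; [exact: cvg_id|exact: cvg_cst].
  exact: continuous_real_rat.
by rewrite bot top rgt lft; apply: complex_ext => /=; field.
Qed.

Lemma square_bdry_neq p z e : 0 < e ->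
  bdry (complex.Re p - e) (complex.Re p + e) (complex.Im p - e)
    (complex.Im p + e) z -> z != p.
Proof.
move=> e0 /andP[_ zb]; apply: contraTneq zb => ->.
by apply/negP => /or4P[]/eqP; lra.
Qed.

(** [h] is an explicit principal part of [g] at [p]. On a small square around [p] their difference
    is [o(1 / |z - p|)] while the perimeter is proportional to the side, so the integrals agree in
    the limit. *)
Lemma rint_residue g h p x0 x1 y0 y1 (V : C) :
  x0 < complex.Re p < x1 -> y0 < complex.Im p < y1 ->
  (forall z, inrect x0 x1 y0 y1 z -> z != p -> ccont g z) ->
  (forall z, inrect x0 x1 y0 y1 z -> y0 < complex.Im z -> z != p -> cdiffable g z) ->
  (forall z, z != p -> ccont h z) ->
  (forall e, 0 < e -> rint (complex.Re p - e) (complex.Re p + e)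
     (complex.Im p - e) (complex.Im p + e) h = V) ->
  (forall eta, 0 < eta -> \forall z \near cnbhs p, z != p ->
     cabs (g z - h z) * cabs (z - p) <= eta) ->
  rint x0 x1 y0 y1 g = V.
Proof.
move=> /andP[xa xb] /andP[ya yb] cg dg ch hV gh.
apply/eqP; rewrite -subr_eq0 -cabs_eq0 eq_le cabs_ge0 andbT.
apply/ler_addgt0Pr => eta eta0; rewrite add0r.
have [d d0 Hd] := gh _ (divr_gt0 eta0 (ltr0n _ 8)).
pose m := Num.min (Num.min (complex.Re p - x0) (x1 - complex.Re p))
  (Num.min (complex.Im p - y0) (y1 - complex.Im p)).
have m0 : 0 < m by rewrite !lt_min !subr_gt0 xa xb ya yb.
(* Halving [m] keeps the square strictly inside the rectangle. Points of the square have distance at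
   most [2 * e] from [p], which is below [3 * e <= d]. *)
pose e := Num.min (m / 2) (d / 3).
have e0 : 0 < e by rewrite lt_min !divr_gt0.
have em : e < m.
  by rewrite /e gt_min ltr_pdivrMr// mulr_natr mulr2n ltrDl m0.
have [e1 e2 e3 e4] : [/\ e < complex.Re p - x0, e < x1 - complex.Re p,
    e < complex.Im p - y0 & e < y1 - complex.Im p].
  by move: em; rewrite !lt_min => /andP[/andP[-> ->] /andP[-> ->]].
have ed : 3 * e <= d.
  by rewrite mulrC -ler_pdivlMr// /e ge_min lexx orbT.
rewrite (@rint_shrink _ g p _ _ _ _ e)//; [|move: e1 e2 e3 e4; clear; lra..].
rewrite -(hV _ e0).
set X0 := complex.Re p - e; set X1 := complex.Re p + e.
set Y0 := complex.Im p - e; set Y1 := complex.Im p + e.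
have X01 : X0 <= X1 by rewrite /X0 /X1; lra.
have Y01 : Y0 <= Y1 by rewrite /Y0 /Y1; lra.
have bE z : bdry X0 X1 Y0 Y1 z ->
    [/\ inrect x0 x1 y0 y1 z, z != p, e <= cabs (z - p) & cabs (z - p) < d].
  move=> /andP[/andP[/andP[z1 z2] /andP[z3 z4]] zb].
  have ez : e <= cabs (z - p).
    have h1 := cabs_ler_Re (z - p); have h2 := cabs_ler_Im (z - p).
    move: h1 h2; rewrite ReD ReN ImD ImN; case/or4P: zb => /eqP ->.
    - by rewrite /X0 addrAC subrr add0r normrN (gtr0_norm e0).
    - by rewrite /X1 addrAC subrr add0r (gtr0_norm e0).
    - by rewrite /Y0 addrAC subrr add0r normrN (gtr0_norm e0).
    - by rewrite /Y1 addrAC subrr add0r (gtr0_norm e0).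
  split => //.
  - rewrite /inrect; rewrite /X0 in z1; rewrite /X1 in z2.
    rewrite /Y0 in z3; rewrite /Y1 in z4.
    move: z1 z2 z3 z4 e1 e2 e3 e4; clear => z1 z2 z3 z4 e1 e2 e3 e4.
    by apply/andP; split; apply/andP; split; lra.
  - by rewrite -subr_eq0 -cabs_gt0 (lt_le_trans e0).
  - have h1 : `|complex.Re z - complex.Re p| <= e.
      by rewrite ler_norml lerBlDl lerBrDl z1 z2.
    have h2 : `|complex.Im z - complex.Im p| <= e.
      by rewrite ler_norml lerBlDl lerBrDl z3 z4.
    have := cabs_le_ReIm (z - p); rewrite ReD ReN ImD ImN; lra.
have bg : bcont X0 X1 Y0 Y1 g by move=> z /bE[zi zp _ _]; exact: cg.
have bh : bcont X0 X1 Y0 Y1 h by move=> z /bE[zi zp _ _]; exact: ch.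
(* On the boundary [e <= |z - p|], which turns the hypothesis into the bound [eta / 8 / e]; the
   perimeter is [8 * e]. *)
rewrite -rintB// (le_trans (rint_bound X01 Y01 _ (M := eta / 8 / e) _))//.
- exact: bcontB.
- move=> z /bE[zi zp ez zd]; rewrite ler_pdivlMr//.
  by rewrite (le_trans _ (Hd _ zd zp))// ler_wpM2l// cabs_ge0.
- rewrite /X0 /X1 /Y0 /Y1.
  have -> : 2 * (eta / 8 / e) * (complex.Re p + e - (complex.Re p - e) +
      (complex.Im p + e - (complex.Im p - e))) = eta.
    by field; rewrite gt_eqF.
  by [].
Qed.

Lemma ccont_subr w z : ccont (fun t => t - w) z.
Proof. by apply: ccvgB; [exact: ccont_id|exact: ccvg_cst]. Qed.

Lemma cdiff_subr w z : cdiff (fun t => t - w) z 1.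
Proof. by have := cdiffB (cdiff_id z) (cdiff_cst w z); rewrite subr0. Qed.

Lemma ccont_invr w z : z != w -> ccont (fun t => (t - w)^-1) z.
Proof. by move=> zw; apply: ccvgV; [rewrite subr_eq0|exact: ccont_subr]. Qed.

Lemma cdiff_invr w z : z != w -> cdiff (fun t => (t - w)^-1) z (- (z - w) ^- 2).
Proof.
move=> zw; have := cdiffV (f := fun t => t - w) (z := z) (l := 1).
rewrite subr_eq0 => /(_ zw (cdiff_subr w z)).
by rewrite mulNr mul1r.
Qed.

(** The principal part is [f w / (z - w)]; the difference from it is the slope of [f], which is
    bounded near [w]. *)
Theorem cauchy_formula f w x0 x1 y0 y1 : hol_rect x0 x1 y0 y1 f ->
  x0 < complex.Re w < x1 -> y0 < complex.Im w < y1 ->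
  rint x0 x1 y0 y1 (fun z => f z * (z - w)^-1) = (2 * pi)%:C * 'i * f w.
Proof.
move=> [cf df] xw yw.
have [l [q [cq ql fq]]] : cdiffable f w.
  move: xw yw => /andP[xa xb] /andP[ya yb].
  by apply: df => //; rewrite /inrect !ltW.
apply: (@rint_residue _ (fun z => f w * (z - w)^-1) w) => //.
- by move=> z zi zw; apply: ccvgM; [exact: cf|exact: ccont_invr].
- move=> z zi zy zw; have [m dm] := df z zi zy.
  by have := cdiffM dm (cdiff_invr zw); exists (m * (z - w)^-1 + f z * - (z - w) ^- 2).
- by move=> z zw; apply: ccvgM; [exact: ccvg_cst|exact: ccont_invr].
- move=> e e0; rewrite rintZ ?rint_square_inv//; first by rewrite mulrC.
  + by rewrite lerD2l ge0_cp// ltW.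
  + by rewrite lerD2l ge0_cp// ltW.
  + move=> z /(square_bdry_neq e0) zw; exact: ccont_invr.
- move=> eta eta0.
  have [d d0 Hd] : \forall z \near cnbhs w, f z = f w + q z * (z - w) /\
      cabs (q z - q w) < 1.
    by near=> z; split; near: z => //; exact: cq.
  pose k := cabs (q w) + 1; have k0 : 0 < k by rewrite ltr_wpDl// cabs_ge0.
  exists (Num.min d (eta / k)); first by rewrite lt_min d0 divr_gt0.
  move=> z; rewrite lt_min => /andP[zd zk] zw.
  have [fz qz] := Hd z zd.
  rewrite fz -mulrBl addrAC subrr add0r mulfK ?subr_eq0//.
  rewrite (@le_trans _ _ (k * (eta / k)))//; last first.
    by rewrite mulrC divfK// gt_eqF.
  apply: ler_pM; rewrite ?cabs_ge0//; last exact: ltW.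
  by have := cabsD (q z - q w) (q w); rewrite subrK /k; lra.
Unshelve. all: by end_near. Qed.

(** The principal part is [f w / (z - w) ^ 2 + l / (z - w)]. Its first term has a primitive on the
    boundary of the square, so only [l] survives. *)
Theorem cauchy_derivative f w l x0 x1 y0 y1 : hol_rect x0 x1 y0 y1 f ->
  x0 < complex.Re w < x1 -> y0 < complex.Im w < y1 -> cdiff f w l ->
  rint x0 x1 y0 y1 (fun z => f z * (z - w) ^- 2) = (2 * pi)%:C * 'i * l.
Proof.
move=> [cf df] xw yw [q [cq ql fq]].
have c2 z : z != w -> ccont (fun z => (z - w) ^- 2) z.
  move=> zw; rewrite (_ : (fun z => _) = fun z => (z - w)^-1 ^+ 2).
    by apply: ccvgX; exact: ccont_invr.
  by apply/funext => t; rewrite exprVn.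
have bc e (h : C -> C) : 0 < e -> (forall z, z != w -> ccont h z) ->
  bcont (complex.Re w - e) (complex.Re w + e) (complex.Im w - e) (complex.Im w + e) h.
  by move=> e0 ch z /(square_bdry_neq e0) /ch.
apply: (@rint_residue _ (fun z => f w * (z - w) ^- 2 + l * (z - w)^-1) w) => //.
- by move=> z zi zw; apply: ccvgM; [exact: cf|exact: c2].
- move=> z zi zy zw; have [m dm] := df z zi zy.
  have := cdiffM dm (cdiffX 2 (cdiff_invr zw)) => d2; eexists.
  apply: cdiff_near d2; apply: nearW => t; by rewrite exprVn.
- move=> z zw; apply: ccvgD; apply: ccvgM; try exact: ccvg_cst.
    exact: c2.
  exact: ccont_invr.
- move=> e e0; have l1 : complex.Re w - e <= complex.Re w + e by rewrite lerD2l ge0_cp// ltW.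
  have l2 : complex.Im w - e <= complex.Im w + e by rewrite lerD2l ge0_cp// ltW.
  rewrite rintD// ?rintZ// ?rint_square_inv//; try (apply: bc => // z zw).
  + rewrite (@rint_prim _ _ _ _ _ _ _ _ (fun z => - (z - w)^-1))// ?mulr0 ?add0r 1?mulrC//.
      exact: bc.
    move=> z zb; rewrite -[_ ^- _]opprK; apply: cdiffN; apply: cdiff_invr.
    exact: (square_bdry_neq e0 zb).
  + exact: ccont_invr.
  + by apply: ccvgM; [exact: ccvg_cst|exact: c2].
  + by apply: ccvgM; [exact: ccvg_cst|exact: ccont_invr].
- move=> eta eta0.
  have [d d0 Hd] : \forall z \near cnbhs w, f z = f w + q z * (z - w) /\
      cabs (q z - q w) < eta.
    by near=> z; split; near: z => //; exact: cq.
  exists d => // z zd zw; have [fz qz] := Hd z zd.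
  have zw0 : z - w != 0 by rewrite subr_eq0.
  have -> : f z * (z - w) ^- 2 - (f w * (z - w) ^- 2 + l * (z - w)^-1) =
      (q z - q w) * (z - w)^-1.
    by rewrite fz -ql; field.
  by rewrite -cabsM divfK// ltW.
Unshelve. all: by end_near. Qed.

End Cauchy.

(** * Poisson integrals on the upper half-plane *)

Section Poisson.
Variable R : realType.
Local Notation mu := (@lebesgue_measure R).
Implicit Types (x y t a b e : R) (g u : R -> R) (A B : set R).

Lemma ae_imply (P Q : R -> Prop) : (forall x, P x -> Q x) ->
  {ae mu, forall x, P x} -> {ae mu, forall x, Q x}.
Proof. by move=> PQ; apply: filterS => //; exact: (ae_filter_ringOfSetsType mu). Qed.

(** The Poisson kernel of the half-plane without the factor [1 / pi], which [poisson] restores. *)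
Definition pker x y t : R := y / ((t - x) ^+ 2 + y ^+ 2).

Lemma pker_den_gt0 x y t : 0 < y -> 0 < (t - x) ^+ 2 + y ^+ 2.
Proof. by move=> y0; rewrite ltr_wpDl ?sqr_ge0// exprn_gt0. Qed.

Lemma pker_ge0 x y t : 0 < y -> 0 <= pker x y t.
Proof. by move=> y0; rewrite divr_ge0 ?ltW// pker_den_gt0. Qed.

Lemma pker_le x y t : 0 < y -> pker x y t <= y^-1.
Proof.
move=> y0; rewrite ler_pdivrMr ?pker_den_gt0// mulrDr.
by rewrite [y ^+ 2]expr2 mulKf ?gt_eqF// lerDr mulr_ge0 ?invr_ge0 ?sqr_ge0 ?ltW.
Qed.

Lemma pker_far x y t (r : R) : 0 < y -> 0 < r -> r <= `|t - x| ->
  pker x y t <= y / r ^+ 2.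
Proof.
move=> y0 r0 rt; rewrite ler_pM2l// lef_pV2 ?posrE ?pker_den_gt0 ?exprn_gt0//.
rewrite ler_wpDr ?sqr_ge0// -[(t - x) ^+ 2]real_normK ?num_real//.
by rewrite lerXn2r ?nnegrE// ltW.
Qed.

Lemma continuous_pker x y : 0 < y -> continuous (pker x y).
Proof. by move=> y0 t; apply: continuous_real_rat; rewrite gt_eqF. Qed.

Lemma measurable_pker x y A : 0 < y -> measurable_fun A (pker x y).
Proof.
by move=> y0; apply: measurable_funTS; apply: continuous_measurable_fun; exact: continuous_pker.
Qed.

Lemma integrable_pkerM x y g A : measurable A -> 0 < y ->
  mu.-integrable A (EFin \o g) ->
  mu.-integrable A (EFin \o (fun t => pker x y t * g t)).
Proof.
move=> mA y0 ig.
apply: (@le_integrable _ _ _ mu _ mA _ (fun t => y^-1%:E * (EFin \o g) t)%E).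
- apply/measurable_EFinP; apply: measurable_funM; first exact: measurable_pker.
  by apply/measurable_EFinP; exact: measurable_int ig.
- move=> t _; rewrite /= lee_fin normrM [leRHS]normrM ler_wpM2r//.
  rewrite (ger0_norm (pker_ge0 _ _ y0)) ger0_norm ?invr_ge0 ?(ltW y0)//.
  exact: pker_le.
- exact: integrableZl.
Qed.

Lemma Rintegral_subset A B u : measurable A -> measurable B -> A `<=` B ->
  mu.-integrable B (EFin \o u) -> (forall t, 0 <= u t) ->
  \int[mu]_(t in A) u t <= \int[mu]_(t in B) u t.
Proof.
move=> mA mB AB iu u0; rewrite /Rintegral fine_le//.
- by apply: integrable_fin_num => //; apply: integrableS iu.
- exact: integrable_fin_num.
- apply: ge0_subset_integral => //; first exact: measurable_int iu.
  by move=> t _; rewrite lee_fin.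
Qed.

Lemma integrable_normr A u : mu.-integrable A (EFin \o u) ->
  mu.-integrable A (EFin \o (fun t => `|u t|)).
Proof. exact: integrable_abse. Qed.

Lemma integrable_scale A u (k : R) : measurable A -> mu.-integrable A (EFin \o u) ->
  mu.-integrable A (EFin \o (fun t => k * u t)).
Proof.
move=> mA iu; rewrite (_ : EFin \o _ = (fun t => k%:E * (EFin \o u) t)%E)//.
exact: integrableZl.
Qed.

(** Dyadic rings around [x0]: between the radii [2 ^+ n * y] and [2 ^+ n.+1 * y] the kernel is at
    most [y / (2 ^+ n * y) ^+ 2] and the mass of [u] at most [eta * (2 ^+ n.+1 * y)]. A ring thus
    contributes at most [2 * eta / 2 ^+ n], a geometric series. *)
Lemma poisson_vanish u x0 : mu.-integrable setT (EFin \o u) ->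
  (forall t, 0 <= u t) ->
  (forall e, 0 < e -> exists2 d : R, 0 < d & forall r, 0 < r < d ->
     \int[mu]_(t in ball x0 r) u t <= e * r) ->
  forall e, 0 < e -> exists2 d : R, 0 < d & forall y, 0 < y < d ->
    \int[mu]_t (pker x0 y t * u t) <= e.
Proof.
move=> iu u0 ud e e0.
(* The near part will be at most [5 * eta], which has to be [e / 2]. *)
have [eta eta0 etaE] : exists2 eta : R, 0 < eta & eta = e / 10.
  by exists (e / 10); rewrite ?divr_gt0.
have [d d0 Hd] := ud _ eta0.
pose U := \int[mu]_t u t; have U0 : 0 <= U by exact: Rintegral_ge0.
have q0 : 0 < d ^+ 2 * e / (8 * (U + 1)).
  by rewrite divr_gt0 ?mulr_gt0 ?exprn_gt0 ?ltr_wpDl.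
exists (Num.min d (d ^+ 2 * e / (8 * (U + 1)))); first by rewrite lt_min d0.
move=> y /andP[y0]; rewrite lt_min => /andP[yd yU].
have iuA B : measurable B -> mu.-integrable B (EFin \o u).
  by move=> mB; apply: integrableS iu.
have ik B : measurable B -> mu.-integrable B (EFin \o (fun t => pker x0 y t * u t)).
  by move=> mB; apply: integrable_pkerM => //; exact: iuA.
have Ik B (k : R) : measurable B -> (forall t, B t -> pker x0 y t <= k) ->
    \int[mu]_(t in B) (pker x0 y t * u t) <= k * \int[mu]_(t in B) u t.
  move=> mB Bk; rewrite -RintegralZl//; last exact: iuA.
  apply: le_Rintegral => //; [exact: ik| |].
    by apply: integrable_scale => //; exact: iuA.
  by move=> t Bt; rewrite ler_wpM2r// Bk.
have mb r : measurable (ball x0 r) by exact: measurable_ball.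
(* The innermost ball contributes 1 and the rings [4 - 4 / 2 ^+ n]. *)
have step n : 2 ^+ n * y < d -> \int[mu]_(t in ball x0 (2 ^+ n * y)) (pker x0 y t * u t)
    <= eta * (5 - 4 / 2 ^+ n).
  elim: n => [|n IH] nd.
    rewrite expr0 mul1r divr1 (_ : 5 - 4 = 1) ?mulr1; last by lra.
    rewrite (le_trans (Ik _ y^-1 _ _))//; first by move=> t _; exact: pker_le.
    by rewrite mulrC ler_pdivrMr// Hd// y0 yd.
  have p0 : 0 < (2 : R) ^+ n by rewrite exprn_gt0.
  have lt2 : 2 ^+ n * y < 2 ^+ n.+1 * y.
    by rewrite ltr_pM2r// exprS ltr_pMl// ltr1n.
  have {}IH := IH (lt_trans lt2 nd).
  have bE : ball x0 (2 ^+ n.+1 * y) = ball x0 (2 ^+ n * y) `|`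
      (ball x0 (2 ^+ n.+1 * y) `\` ball x0 (2 ^+ n * y)).
    rewrite setDUK//; apply: le_ball; exact: ltW.
  have mD : measurable (ball x0 (2 ^+ n.+1 * y) `\` ball x0 (2 ^+ n * y)).
    exact: measurableD.
  rewrite bE Rintegral_setU//; last 3 first.
  - exact: mb.
  - by apply: ik; exact: measurableU.
  - by apply/disj_setPS => t [? []].
  have -> : eta * (5 - 4 / 2 ^+ n.+1) = eta * (5 - 4 / 2 ^+ n) + eta * (2 / 2 ^+ n).
    by rewrite exprS; field; rewrite gt_eqF.
  apply: lerD => //; rewrite (le_trans (Ik _ (y / (2 ^+ n * y) ^+ 2) _ _))//.
  - move=> t [_ /negP]; rewrite -leNgt distrC => tn; apply: pker_far => //.
    by rewrite mulr_gt0.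
  have -> : eta * (2 / 2 ^+ n) = y / (2 ^+ n * y) ^+ 2 * (eta * (2 ^+ n.+1 * y)).
    have F (w : R) : 0 < w -> eta * (2 / w) = y / (w * y) ^+ 2 * (eta * (2 * w * y)).
      by move=> w0; field; rewrite !gt_eqF.
    by rewrite (exprS 2 n); exact: F.
  rewrite ler_wpM2l//; first by rewrite divr_ge0 ?sqr_ge0// ltW.
  apply: le_trans (Hd _ _); last by rewrite nd andbT mulr_gt0// exprn_gt0.
  by apply: Rintegral_subset => //; exact: iuA.
(* The least such exponent is some [n.+1], so that [2 ^+ n * y] lies between [d / 2] and [d]. Beyond
   this radius the kernel is at most [y / (d / 2) ^+ 2], and the second bound on [y] makes its
   product with the total mass at most [e / 2]. *)
have ex : exists n, d <= 2 ^+ n * y.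
  pose n := Num.truncn (d / y); exists n.+1.
  rewrite -ler_pdivrMr//; apply: (@le_trans _ _ n.+1%:R).
    by rewrite ltW// truncnS_gt// divr_ge0// ltW.
  by rewrite -natrX ler_nat ltnW// ltn_expl.
have := ex_minnP ex => -[[|n]]; first by rewrite expr0 mul1r leNgt yd.
move=> dn nmin.
have nd : 2 ^+ n * y < d.
  by rewrite ltNge; apply/negP => /nmin; rewrite ltnn.
have n0 : 0 < 2 ^+ n * y by rewrite mulr_gt0// exprn_gt0.
have mC : measurable (~` ball x0 (2 ^+ n * y)) by exact: measurableC.
have -> : [set: R] = ball x0 (2 ^+ n * y) `|` ~` ball x0 (2 ^+ n * y) by rewrite setUCr.
rewrite Rintegral_setU//; last 3 first.
- exact: mb.
- by apply: ik; exact: measurableU.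
- by apply/disj_setPS => t [].
have -> : e = e / 2 + e / 2 by lra.
apply: lerD.
  rewrite (le_trans (step n nd))// etaE.
  have p0 : 0 <= 4 / (2 : R) ^+ n by rewrite divr_ge0// exprn_ge0.
  by nra.
rewrite (le_trans (Ik _ (y / (d / 2) ^+ 2) _ _))//.
  move=> t /= /negP; rewrite -leNgt distrC => tn; apply: pker_far => //.
    by rewrite divr_gt0.
  by rewrite (le_trans _ tn)// ler_pdivrMr// mulrC mulrA -exprS//.
apply: (@le_trans _ _ (y / (d / 2) ^+ 2 * (U + 1))).
  rewrite ler_wpM2l ?divr_ge0 ?sqr_ge0 ?(ltW y0)//.
  by rewrite (le_trans (Rintegral_subset _ _ _ iu u0)) ?lerDl.
have -> : y / (d / 2) ^+ 2 * (U + 1) = y * (8 * (U + 1)) / d ^+ 2 / 2.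
  by field; rewrite gt_eqF.
rewrite ler_pM2r// ler_pdivrMr ?exprn_gt0// mulrC -ler_pdivlMl ?mulr_gt0 ?ltr_wpDl//.
by rewrite ltW// mulrC (mulrC e).
Qed.

(** The average in [lebesgue_pt] runs over an interval of length [2 * r], whence the tolerance
    [e / 2]. *)
Lemma lebesgue_ptP g x0 : mu.-integrable setT (EFin \o g) -> lebesgue_pt g x0 ->
  forall e, 0 < e -> exists2 d : R, 0 < d & forall r, 0 < r < d ->
     \int[mu]_(t in ball x0 r) `|g t - g x0| <= e * r.
Proof.
move=> ig gx e e0.
have e20 : 0 < e / 2 by rewrite divr_gt0.
have /fine_cvgP[[d1 /= d10 H1] /cvgrPdist_lt/(_ _ e20)[d2 /= d20 H2]] := gx.
exists (Num.min d1 d2); first by rewrite lt_min d10.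
move=> r /andP[r0]; rewrite lt_min => /andP[rd1 rd2].
have bd d : r < d -> ball 0 d r by rewrite /ball /= sub0r normrN gtr0_norm.
have := H1 _ (bd _ rd1) r0; have := H2 _ (bd _ rd2) r0.
rewrite /= sub0r normrN => H3 H4.
have {H3 H4} : (davg g x0 r < (e / 2)%:E)%E.
  by rewrite -(fineK H4) lte_fin (le_lt_trans (ler_norm _)).
rewrite /davg /iavg (lebesgue_measure_ball _ (ltW r0)).
have r20 : 0 < r *+ 2 by rewrite mulrn_wgt0.
rewrite inver gt_eqF// muleC lte_pdivrMr//.
set I := (\int[_]_(y in _) _)%E => IH.
have -> : \int[mu]_(t in ball x0 r) `|g t - g x0| = fine I.
  by rewrite /Rintegral /I; congr fine; apply: eq_integral.
have I0 : (0 <= I)%E by exact: integral_ge0.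
rewrite -lee_fin fineK; last by rewrite ge0_fin_numE// (lt_le_trans IH)// leey.
by rewrite (le_trans (ltW IH))// -EFinM lee_fin -mulr_natr; lra.
Qed.

(** Reduces non-tangential approach to vertical approach: [(t - x0) ^+ 2] is at most
    [2 * (t - x) ^+ 2 + 2 * (x - x0) ^+ 2], and the last square is at most [(k * y) ^+ 2] in the
    cone. *)
Lemma pker_shift x x0 y t (k : R) : 0 < y -> 0 <= k -> `|x - x0| <= k * y ->
  pker x y t <= (2 + 2 * k ^+ 2) * pker x0 y t.
Proof.
move=> y0 k0 xk; have p0 := pker_den_gt0 x t y0; have p1 := pker_den_gt0 x0 t y0.
rewrite /pker mulrCA ler_pM2l// ler_pdivlMr// mulrC ler_pdivrMr//.
have h1 : (x - x0) ^+ 2 <= (k * y) ^+ 2.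
  by rewrite -real_normK ?num_real// lerXn2r ?nnegrE// mulr_ge0// ltW.
have h2 : 0 <= (t - x - (x - x0)) ^+ 2 by exact: sqr_ge0.
have h3 : 0 <= k ^+ 2 * (t - x) ^+ 2 by rewrite mulr_ge0 ?sqr_ge0.
have h4 := sqr_ge0 y.
have -> : (t - x0) ^+ 2 = 2 * (t - x) ^+ 2 + 2 * (x - x0) ^+ 2 - (t - x - (x - x0)) ^+ 2.
  by ring.
move: h1; rewrite exprMn; lra.
Qed.

Definition poisson g x y : R := pi^-1 * \int[mu]_t (pker x y t * g t).

Lemma atan_near_pi2 e : 0 < e -> exists N : R, forall s, N <= s ->
  `|atan s - pi / 2| <= e.
Proof.
move=> e0; have /cvgrPdist_le/(_ _ e0)[N [_ HN]] := @cvgy_atan R.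
exists (N + 1) => s Ns; rewrite distrC HN// (lt_le_trans _ Ns)// ltrDl//.
Qed.

Lemma poisson_nontangential g x0 (k : R) : mu.-integrable setT (EFin \o g) ->
  lebesgue_pt g x0 -> 0 <= k ->
  forall e, 0 < e -> exists2 d : R, 0 < d & forall x y, 0 < y < d ->
    `|x - x0| <= k * y -> `|poisson g x y - g x0| <= e.
Proof.
move=> ig gx k0 e e0.
(* A nonzero constant is not integrable on the line, so [g x0] is subtracted on a bounded interval
   only. Near [x0] this makes no difference, and the Poisson integral of the indicator is an
   explicit difference of arctangents. *)
pose B := `[x0 - 1, x0 + 1]%classic; have mB : measurable B by exact: measurable_itv.
pose h t := g t - g x0 * \1_B t.
have iB : mu.-integrable setT (EFin \o (\1_B : R -> R)).
  exact/integrable_indic_itv.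
have ih : mu.-integrable setT (EFin \o h).
  rewrite (_ : EFin \o h = (fun t => (EFin \o g) t - (g x0)%:E * (EFin \o (\1_B : R -> R)) t)%E)//.
  by apply: integrableB => //; exact: integrableZl.
have inh := integrable_normr ih.
have hd e' : 0 < e' -> exists2 d : R, 0 < d & forall r, 0 < r < d ->
     \int[mu]_(t in ball x0 r) `|h t| <= e' * r.
  move=> /(lebesgue_ptP ig gx)[d d0 Hd]; exists (Num.min d 1); first by rewrite lt_min d0/=.
  move=> r /andP[r0]; rewrite lt_min => /andP[rd r1].
  rewrite (_ : \int[mu]_(t in _) _ = \int[mu]_(t in ball x0 r) `|g t - g x0|).
    by rewrite Hd// r0.
  apply: eq_Rintegral => t; rewrite inE /ball /= => tr.
  rewrite /h indicE mem_set ?mulr1// /B /= in_itv /=.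
  by move: tr; rewrite ltr_norml; lra.
pose k2 := 2 + 2 * k ^+ 2; have k20 : 0 < k2 by rewrite ltr_wpDr// mulr_ge0 ?sqr_ge0.
have e10 : 0 < e / 2 / k2 by rewrite !divr_gt0.
have [d d0 Hd] := poisson_vanish inh (fun t => normr_ge0 _) hd e10.
(* Two arctangents each miss [pi / 2] by this much, so that after multiplication by [g x0] the error
   is at most [e / 2]. *)
have e20 : 0 < e / 4 / (`|g x0| + 1) by rewrite !divr_gt0// ltr_wpDl.
have [N HN] := atan_near_pi2 e20.
have N0 : 0 < `|N| + k + 1 by rewrite ltr_wpDl// addr_ge0.
(* The bound on [y] gives [N * y + k * y <= 1], so that both end points of [B] are at least [N * y]
   away from [x]. *)
exists (Num.min d (`|N| + k + 1)^-1); first by rewrite lt_min d0 invr_gt0.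
move=> x y /andP[y0]; rewrite lt_min => /andP[yd yN] xk.
have pi1 : 1 <= (pi : R) by rewrite (le_trans _ (pi_ge2 R))// ler1n.
have pi0 : 0 < (pi : R) by exact: pi_gt0.
have ik (f : R -> R) := @integrable_pkerM x y f setT measurableT y0.
have -> : poisson g x y = pi^-1 * \int[mu]_t (pker x y t * h t) +
    g x0 * (pi^-1 * \int[mu]_(t in B) pker x y t).
  rewrite mulrCA -mulrDr; congr (_ * _).
  have -> : \int[mu]_(t in B) pker x y t = \int[mu]_t (pker x y t * \1_B t).
    rewrite Rintegral_mkcond; apply: eq_Rintegral => t _.
    by rewrite /patch indicE; case: (_ \in _); rewrite ?mulr1 ?mulr0.
  rewrite -RintegralZl//; last exact: ik.
  rewrite -RintegralD//; last 2 first.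
    exact: ik.
    by apply: integrable_scale => //; exact: ik.
  by apply: eq_Rintegral => t _; rewrite /h; ring.
rewrite /B Rintegral_poisson_atan ?gt_eqF//; last by lra.
have yN' : y * (`|N| + k + 1) < 1 by rewrite -ltr_pdivlMr// div1r.
have NN : N * y <= `|N| * y by rewrite ler_pM2r// ler_norm.
move: (xk); rewrite ler_norml => /andP[xk1 xk2].
have t1 : N <= (x0 + 1 - x) / y by rewrite ler_pdivlMr//; move: y0 NN yN' xk1 xk2; clear; lra.
have t2 : N <= - ((x0 - 1 - x) / y) by rewrite -mulNr ler_pdivlMr//; move: y0 NN yN' xk1 xk2; clear; lra.
have := HN _ t1; have := HN _ t2; rewrite atanN.
set A1 := atan ((x0 + 1 - x) / y); set A2 := atan _.
move=> H2 H1.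
have H3 : `|pi^-1 * \int[mu]_t (pker x y t * h t)| <= e / 2.
  rewrite normrM gtr0_norm ?invr_gt0// mulrC ler_pdivrMr//.
  apply: (@le_trans _ _ (e / 2)); last by rewrite ler_peMr// ltW// divr_gt0.
  rewrite (le_trans (le_normr_Rintegral _ (ik _ ih)))//.
  apply: (@le_trans _ _ (k2 * \int[mu]_t (pker x0 y t * `|h t|))).
    rewrite -RintegralZl//; last exact: integrable_pkerM.
    apply: le_Rintegral => //.
    - exact: (integrable_normr (ik _ ih)).
    - by apply: integrable_scale => //; exact: integrable_pkerM.
    - move=> t _; rewrite normrM (ger0_norm (pker_ge0 _ _ y0)) mulrA.
      by rewrite ler_wpM2r//; exact: pker_shift.
  by rewrite mulrC -ler_pdivlMr// Hd// y0.
have H4 : `|g x0 * (pi^-1 * (A1 - A2)) - g x0| <= e / 2.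
  have -> : g x0 * (pi^-1 * (A1 - A2)) - g x0 =
      g x0 * (pi^-1 * ((A1 - pi / 2) + (- A2 - pi / 2))).
    rewrite (_ : A1 - pi / 2 + (- A2 - pi / 2) = A1 - A2 - pi); last by field.
    by rewrite (mulrBr pi^-1 _ pi) mulVf ?gt_eqF// [RHS]mulrBr mulr1.
  rewrite !normrM (gtr0_norm (x := pi^-1)) ?invr_gt0//.
  apply: (@le_trans _ _ ((`|g x0| + 1) * (1 * (e / 4 / (`|g x0| + 1) + e / 4 / (`|g x0| + 1))))).
    apply: ler_pM => //; first by rewrite mulr_ge0// invr_ge0 ltW.
      by rewrite lerDl.
    apply: ler_pM => //; first by rewrite invr_ge0 ltW.
      by rewrite invf_le1.
    by rewrite (le_trans (ler_normD _ _))// lerD.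
  rewrite mul1r -mulrDl mulrC divfK ?gt_eqF ?ltr_wpDl//.
  by move: e0; clear; lra.
rewrite -addrA (le_trans (ler_normD _ _))//.
by rewrite [leRHS]splitr; exact: lerD.
Qed.


Lemma poisson_ge0 g x y : 0 < y -> (forall t, 0 <= g t) -> 0 <= poisson g x y.
Proof.
move=> y0 g0; rewrite mulr_ge0 ?invr_ge0 ?pi_ge0//.
by apply: Rintegral_ge0 => t _; rewrite mulr_ge0// pker_ge0.
Qed.

(** Tonelli: the kernel is symmetric in [x] and [t], and its integral over [x] is a difference of
    arctangents, hence at most [pi]. *)
Lemma poisson_total g a b y : a <= b -> 0 < y -> mu.-integrable setT (EFin \o g) ->
  (forall t, 0 <= g t) ->
  mu.-integrable `[a, b] (EFin \o (poisson g)^~ y) /\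
  \int[mu]_(x in `[a, b]) poisson g x y <= \int[mu]_t g t.
Proof.
move=> ab y0 ig g0.
have mg : measurable_fun setT g by apply/measurable_EFinP; exact: measurable_int ig.
pose D := `[a, b]%classic; have mD : measurable D by exact: measurable_itv.
have pi0 : 0 < pi^-1 :> R by rewrite invr_gt0 pi_gt0.
pose f (z : R * R) := (\1_D z.1 * (pi^-1 * (pker z.1 y z.2 * g z.2)))%:E.
have mf : measurable_fun setT f.
  apply/measurable_EFinP; apply: measurable_funM.
    apply: (measurableT_comp (f := \1_D : R -> R)) => //; exact: measurable_fst.
  apply: measurable_funM => //; apply: measurable_funM; last first.
    by apply: (measurableT_comp mg); exact: measurable_snd.
  rewrite (_ : (fun z => _) = pker 0 y \o (fun z : R * R => z.2 - z.1)); last first.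
    by apply/funext => z /=; rewrite /pker subr0.
  apply: measurableT_comp; first exact: measurable_pker.
  by apply: measurable_funB; [exact: measurable_snd|exact: measurable_fst].
have f0 z : (0 <= f z)%E.
  by rewrite lee_fin mulr_ge0 ?indicE// mulr_ge0 ?(ltW pi0)// mulr_ge0// pker_ge0.
have FE x : (\int[mu]_t f (x, t) = (\1_D x * poisson g x y)%:E)%E.
  rewrite /f /=.
  under eq_integral do rewrite mulrA EFinM.
  rewrite integralZl//; last first.
    exact: (integrable_pkerM x measurableT y0 ig).
  rewrite EFinM -muleA [in RHS]EFinM; congr (_ * _)%E.
  rewrite /poisson EFinM; congr (_ * _)%E; rewrite /Rintegral fineK//; apply: integrable_fin_num => //.
  exact: integrable_pkerM.
have GE t : (\int[mu]_x f (x, t) <= (g t)%:E)%E.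
  rewrite /f /=.
  have -> : (\int[mu]_x (\1_D x * (pi^-1 * (pker x y t * g t)))%:E =
      \int[mu]_(x in D) ((pi^-1 * g t) * (pker t y x))%:E)%E.
    rewrite [RHS]integral_mkcond; apply: eq_integral => x _.
    rewrite /patch indicE; case: (_ \in _); rewrite ?mul0r ?mul1r//.
    by congr (_%:E); rewrite /pker -sqrrN opprB; ring.
  have ip : mu.-integrable D (EFin \o pker t y).
    apply: continuous_compact_integrable; first exact: segment_compact.
    by apply: continuous_in_subspaceT => s _; exact: continuous_pker.
  under eq_integral do rewrite EFinM.
  rewrite integralZl// -[(\int[mu]_(x in D) _)%E]fineK; last exact: integrable_fin_num.
  have -> : fine (\int[mu]_(x in D) (pker t y x)%:E)%E =
      atan ((b - t) / y) - atan ((a - t) / y).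
    by rewrite -(Rintegral_poisson_atan t ab) ?gt_eqF.
  rewrite -EFinM lee_fin mulrAC mulrC ler_piMr// ler_pdivrMl ?pi_gt0// mulr1.
  have := atan_ltpi2 ((b - t) / y); have := atan_gtNpi2 ((a - t) / y); lra.
have tot : (\int[mu]_(x in D) (poisson g x y)%:E <= \int[mu]_t (g t)%:E)%E.
  have -> : (\int[mu]_(x in D) (poisson g x y)%:E = \int[mu]_x \int[mu]_t f (x, t))%E.
    rewrite integral_mkcond; apply: eq_integral => x _; rewrite FE.
    by rewrite /patch indicE; case: (_ \in _); rewrite ?mul0r ?mul1r.
  have -> : (\int[mu]_x \int[mu]_t f (x, t) = \int[mu]_t \int[mu]_x f (x, t))%E.
    exact: (@fubini_tonelli _ _ (measurableTypeR R) (measurableTypeR R) R mu mu f).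
  apply: ge0_le_integral => //.
  - by move=> t _; exact: integral_ge0.
  - exact: measurable_fun_fubini_tonelli_G.
  - exact: measurable_int ig.
have ip : mu.-integrable D (EFin \o (poisson g)^~ y).
  apply/integrableP; split.
    apply: (eq_measurable_fun (fun x => \int[mu]_t f (x, t))%E).
      by move=> x xD; rewrite FE indicE xD mul1r.
    apply: measurable_funTS; exact: measurable_fun_fubini_tonelli_F.
  under eq_integral => x _ do rewrite /= ger0_norm ?poisson_ge0//.
  rewrite (le_lt_trans tot)// -ge0_fin_numE; first exact: integrable_fin_num.
  by apply: integral_ge0 => t _; rewrite lee_fin.
split => //; rewrite /Rintegral fine_le//; exact: integrable_fin_num.
Qed.

(* Scheffe's argument: the integral of [P g - g] is nonpositive, so that
   only the positive part of [g - P g], which is dominated by [g], matters. *)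
Lemma poisson_L1_ge0 g a b : a <= b -> mu.-integrable setT (EFin \o g) ->
  (forall t, 0 <= g t) -> (forall t, ~ `[a, b]%classic t -> g t = 0) ->
  \int[mu]_(x in `[a, b]) `|poisson g x y - g x| @[y --> 0^'+] --> (0 : R).
Proof.
(* Along a sequence of heights the dominated convergence theorem applies. *)
move=> ab ig g0 gab; apply/cvg_at_rightP => v [v0 vl].
pose D := `[a, b]%classic; have mD : measurable D by exact: measurable_itv.
have igD : mu.-integrable D (EFin \o g) by apply: integrableS ig.
have ip n := (poisson_total ab (v0 n) ig g0).1.
pose h n x := Num.max (g x - poisson g x (v n)) 0.
have ipg n : mu.-integrable D (EFin \o (fun x => poisson g x (v n) - g x)).
  by rewrite (_ : EFin \o _ = (EFin \o (poisson g)^~ (v n)) \- (EFin \o g))%E//; exact: integrableB.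
have mh n : measurable_fun D (fun x => (h n x)%:E).
  apply/measurable_EFinP; apply: measurable_maxr; last exact: measurable_cst.
  have /measurable_int/measurable_EFinP m := ipg n.
  rewrite (_ : (fun x => _) = (fun x => - (poisson g x (v n) - g x))).
    exact: measurableT_comp.
  by apply/funext => x; rewrite opprB.
have hg n x : 0 <= h n x <= g x.
  by rewrite le_max lexx orbT ge_max g0 gerBl poisson_ge0.
have h0 : \int[mu]_(x in D) (h n x) @[n --> \oo] --> (0 : R).
  have ff : {ae mu, forall x, D x -> (h n x)%:E @[n --> \oo] --> 0%E}.
    have lg : locally_integrable setT g by apply: open_integrable_locally => //; exact: openT.
    apply: ae_imply (lebesgue_differentiation lg) => x gx Dx.
    apply/fine_cvgP; split; first exact: nearW.
    apply/cvgrPdist_le => e e0.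
    have [d d0 Hd] := poisson_nontangential ig gx (lexx 0) e0.
    have /cvgrPdist_lt/(_ _ d0) := vl; apply: filterS => n vn.
    have := Hd x (v n); rewrite v0 subrr normr0 mul0r => /(_ _ (lexx 0)).
    move: vn; rewrite sub0r normrN gtr0_norm// => -> /(_ isT) => H.
    rewrite sub0r normrN /= ger0_norm; last by have /andP[] := hg n x.
    by rewrite ge_max (ltW e0) andbT (le_trans (ler_norm _))// distrC.
  have fg : {ae mu, forall x n, D x -> (`|(h n x)%:E| <= (EFin \o g) x)%E}.
    apply: aeW => x n Dx; have /andP[h1 h2] := hg n x.
    by rewrite /= lee_fin ger0_norm.
  have [_ _] := @dominated_convergence _ _ _ mu D mD
    (fun n x => (h n x)%:E) (cst 0%E) (EFin \o g) mh (measurable_cst _) ff igD fg.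
  by rewrite integral0 => /fine_cvgP[_].
apply: (@squeeze_cvgr _ _ _ _ (cst 0) (fun n => 2 * \int[mu]_(x in D) h n x)).
- apply: nearW => n; rewrite Rintegral_ge0//=.
  have ih : mu.-integrable D (EFin \o h n).
    apply: le_integrable igD => //.
      exact: mh.
    by move=> x Dx; have /andP[h1 h2] := hg n x; rewrite /= lee_fin !ger0_norm.
  (* The identity [|v| = v + 2 * max (- v) 0] for [v = P g - g]. *)
  have -> : \int[mu]_(x in D) `|poisson g x (v n) - g x| =
      \int[mu]_(x in D) (poisson g x (v n) - g x) + 2 * \int[mu]_(x in D) h n x.
    rewrite -RintegralZl// -RintegralD//; last exact: integrable_scale.
    apply: eq_Rintegral => x _; rewrite /h.
    case: (leP (g x) (poisson g x (v n))) => gp.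
      by rewrite max_r ?subr_le0// mulr0 addr0 ger0_norm// subr_ge0.
    rewrite max_l ?subr_ge0 ?(ltW gp)// ltr0_norm ?subr_lt0//; ring.
  rewrite gerDr RintegralB// subr_le0.
  rewrite (le_trans (poisson_total ab (v0 n) ig g0).2)//.
  rewrite [leRHS]Rintegral_mkcond; rewrite le_eqVlt; apply/orP; left; apply/eqP; apply: eq_Rintegral => x _.
  rewrite /patch; case: ifPn => // /negP; rewrite inE; exact: gab.
- exact: cvg_cst.
- rewrite -[X in _ --> X](mulr0 2); apply: cvgM => //; exact: cvg_cst.
Qed.

End Poisson.

(** * Length of curves with an integrable density *)

Section Length.
Variable R : realType.
Local Notation C := R[i].
Local Notation mu := (@lebesgue_measure R).
Implicit Types (p q : R -> C) (a b s t : R).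

Lemma polygon_length_le p (V : R -> R) a b (l : seq R) : a <= b ->
  (forall s t, a <= s -> s <= t -> t <= b -> cabs (p t - p s) <= V t - V s) ->
  sorted <%R l -> {subset l <= `[a, b]} -> polygon_length p l <= V b - V a.
Proof.
move=> ab pV; case: l => [|x r] sl lab.
  rewrite /polygon_length /= big_ord0 (le_trans (cabs_ge0 (p b - p a)))//.
  exact: pV.
have inab i : (i < (size r).+1)%N -> a <= nth 0 (x :: r) i <= b.
  by move=> ir; have /lab : nth 0 (x :: r) i \in x :: r by exact: mem_nth.
have le1 i : (i < size r)%N -> nth 0 (x :: r) i <= nth 0 (x :: r) i.+1.
  by move=> ir; apply/ltW; move/(sortedP 0) : sl; exact.
rewrite /polygon_length /=.
apply: (@le_trans _ _ (\sum_(i < size r) (V (nth 0 (x :: r) i.+1) - V (nth 0 (x :: r) i)))).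
  apply: ler_sum => i _.
  have /andP[h1 h2] := inab i (leqW (ltn_ord i)).
  have /andP[h3 h4] : a <= nth 0 (x :: r) i.+1 <= b by apply: inab; rewrite ltnS.
  by apply: pV => //; exact: le1.
rewrite -(big_mkord xpredT (fun i => V (nth 0 (x :: r) i.+1) - V (nth 0 (x :: r) i))).
rewrite telescope_sumr//=.
have /andP[h1 h2] : a <= x <= b by exact: (inab 0%N).
have /andP[h3 h4] : a <= nth 0 (x :: r) (size r) <= b by exact: inab.
have V1 : V a <= V x.
  by rewrite -subr_ge0 (le_trans (cabs_ge0 (p x - p a)))//; exact: pV.
have V2 : V (nth 0 (x :: r) (size r)) <= V b.
  by rewrite -subr_ge0 (le_trans (cabs_ge0 (p b - p (nth 0 (x :: r) (size r)))))//; exact: pV.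
lra.
Qed.

Lemma uniform_continuity_itv (f : R -> C) a b :
  (forall t, a <= t <= b -> pcont f t) -> forall e, 0 < e ->
  exists2 d : R, 0 < d & forall s t, a <= s <= b -> a <= t <= b -> `|s - t| < d ->
    cabs (f s - f t) < e.
Proof.
move=> cf e e0.
suff : \forall d \near (0 : R)^'+, `[a, b]%classic `<=`
    (fun s => forall t, `|s - t| < d -> cabs (f s - f t) < e).
  move=> [d /= d0 Hd]; exists (d / 2); first by rewrite divr_gt0.
  move=> s t sab tab st; apply: (Hd (d / 2)) st => /=; last by rewrite in_itv.
    by rewrite sub0r normrN gtr0_norm ?divr_gt0// ltr_pdivrMr// mulr_natr mulr2n ltrDl.
  by rewrite divr_gt0.
have /compact_near_coveringP := @segment_compact _ a b.
apply.
move=> t; rewrite /= in_itv /= => tab.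
have e20 : 0 < e / 2 by rewrite divr_gt0.
have [d /= d0 Hd] := cf _ tab _ e20.
have d20 : 0 < d / 2 by rewrite divr_gt0.
exists (ball t (d / 2), [set k | k < d / 2]) => /=.
  split; first exact: nbhsx_ballx.
  exact: nbhs_right_lt.
move=> [s k] /= [ts kd] u su.
rewrite -(subrKA (f t)) (le_lt_trans (cabsD _ _))// [e]splitr ltrD//.
  by apply: Hd; rewrite /ball /= (lt_trans ts)// ltr_pdivrMr// mulr_natr mulr2n ltrDl.
rewrite cabs_distC; apply: Hd; rewrite /ball /= -(subrKA s).
rewrite (le_lt_trans (ler_normD _ _))// [d]splitr ltrD//.
exact: lt_trans kd.
Qed.

(** Absolute continuity of [p] with derivative [q], in integrated form. *)
Definition has_density p q a b := cintegrable `[a, b] q /\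
  forall s t, a <= s -> s <= t -> t <= b -> p t - p s = cint `[s, t] q.

Lemma Rintegral_itv_ge0_le (f : R -> R) a s t b : a <= s -> s <= t -> t <= b ->
  mu.-integrable `[a, b] (EFin \o f) ->
  \int[mu]_(u in `[s, t]) f u =
  \int[mu]_(u in `[a, t]) f u - \int[mu]_(u in `[a, s]) f u.
Proof.
move=> as_ st tb iF; rewrite [X in _ = X - _](Rintegral_itv_split as_ st).
  by rewrite addrAC subrr add0r.
by apply: integrableS iF => //; apply: subset_itvl; rewrite bnd_simp.
Qed.

Lemma has_density_le p q a b (l : seq R) : a <= b -> has_density p q a b ->
  sorted <%R l -> {subset l <= `[a, b]} ->
  polygon_length p l <= \int[mu]_(u in `[a, b]) cabs (q u).
Proof.
move=> ab [iq pq] sl lab; pose V t := \int[mu]_(u in `[a, t]) cabs (q u).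
have ic := integrable_cabs (measurable_itv `[a, b]) iq.
rewrite (_ : \int[mu]_(u in _) _ = V b - V a); last first.
  by rewrite /V set_itv1 Rintegral_set1 subr0.
apply: polygon_length_le => // s t as_ st tb.
rewrite pq// /V -(Rintegral_itv_ge0_le as_ st tb ic); apply: cabs_cint => //.
apply: cintegrableS iq => //; apply: subset_itv; rewrite bnd_simp//.
Qed.

Lemma integrable_add (A : set R) (u v : R -> R) : measurable A ->
  mu.-integrable A (EFin \o u) -> mu.-integrable A (EFin \o v) ->
  mu.-integrable A (EFin \o (fun t => u t + v t)).
Proof.
move=> mA iu iv; rewrite (_ : EFin \o _ = (EFin \o u) \+ (EFin \o v))%E//.
exact: integrableD.
Qed.

Lemma integrable_sub (A : set R) (u v : R -> R) : measurable A ->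
  mu.-integrable A (EFin \o u) -> mu.-integrable A (EFin \o v) ->
  mu.-integrable A (EFin \o (fun t => u t - v t)).
Proof.
move=> mA iu iv; rewrite (_ : EFin \o _ = (EFin \o u) \- (EFin \o v))%E//.
exact: integrableB.
Qed.

Lemma cintegrable_approx q a b : cintegrable `[a, b] q -> forall e, 0 < e ->
  exists r : R -> C, [/\ forall t, pcont r t &
    \int[mu]_(u in `[a, b]) cabs (q u - r u) <= e].
Proof.
move=> [iR iI] e e0; have e20 : 0 < e / 2 by rewrite divr_gt0.
have ap (f : R -> R) : mu.-integrable `[a, b] (EFin \o f) ->
    exists g : R -> R, continuous g /\ \int[mu]_(u in `[a, b]) `|f u - g u| <= e / 2.
  move=> iF; have ab_oo : (mu `[a, b]%classic < +oo)%E.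
    by rewrite lebesgue_measure_itv /=; case: ifP => // _; rewrite -EFinD ltry.
  have [g [cg ig]] := approximation_continuous_integrable (measurable_itv `[a, b]) ab_oo iF.
  move=> /fine_cvgP[[n1 _ H1] /cvgrPdist_lt/(_ _ e20)[n2 _ H2]].
  exists (g (maxn n1 n2)); split; first exact: cg.
  have := H2 (maxn n1 n2) (leq_maxr _ _); rewrite sub0r normrN /= => /ltW.
  exact: le_trans (ler_norm _).
have [r1 [c1 H1]] := ap _ iR; have [r2 [c2 H2]] := ap _ iI.
exists (fun t => r1 t +i* r2 t); split.
  by move=> t; apply/ccvgP; split; [exact: c1|exact: c2].
have i1 : mu.-integrable `[a, b] (EFin \o r1).
  apply: continuous_compact_integrable; first exact: segment_compact.
  by apply: continuous_in_subspaceT => t _; exact: c1.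
have i2 : mu.-integrable `[a, b] (EFin \o r2).
  apply: continuous_compact_integrable; first exact: segment_compact.
  by apply: continuous_in_subspaceT => t _; exact: c2.
have j1 : mu.-integrable `[a, b] (EFin \o (fun u => `|complex.Re (q u) - r1 u|)).
  by apply: integrable_normr; exact: integrable_sub.
have j2 : mu.-integrable `[a, b] (EFin \o (fun u => `|complex.Im (q u) - r2 u|)).
  by apply: integrable_normr; exact: integrable_sub.
rewrite [e]splitr (le_trans _ (lerD H1 H2))// -RintegralD//.
apply: le_Rintegral => //.
- by apply: integrable_cabs => //; apply: cintegrableB.
- exact: integrable_add.
- by move=> t _; rewrite (le_trans (cabs_le_ReIm _))// ReD ReN ImD ImN.
Qed.

(** On a short interval a continuous approximation [r] of [q] is almost constant. There the integral
    of [|q|] exceeds the chord [|p t - p s|] by at most twice the [L^1] error of [r] and twice its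
    oscillation times the length; these bounds are summed over an equidistant partition. *)
Lemma has_density_ge p q a b (M : R) : a < b -> has_density p q a b ->
  (forall l : seq R, sorted <%R l -> {subset l <= `[a, b]} -> polygon_length p l <= M) ->
  \int[mu]_(u in `[a, b]) cabs (q u) <= M.
Proof.
move=> ab [iq pq] pM; have mI s t := measurable_itv `[s, t].
have ba0 : 0 < b - a by rewrite subr_gt0.
apply/ler_addgt0Pr => e e0.
(* The total error is [2 * eta + 2 * eta * (b - a)], which is [e]. *)
pose eta := e / (2 * (1 + (b - a))).
have eta0 : 0 < eta by rewrite divr_gt0// mulr_gt0// ltr_wpDr// ltW.
have [r [cr Hr]] := cintegrable_approx iq eta0.
have [d d0 Hd] := uniform_continuity_itv (fun t (_ : a <= t <= b) => cr t) eta0.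
have ir : cintegrable `[a, b] r by apply: cintegrable_cont => t _; exact: cr.
have iqr := cintegrableB (mI a b) iq ir.
have ic := integrable_cabs (mI _ _) iq.
have ie := integrable_cabs (mI _ _) iqr.
pose Vq t := \int[mu]_(u in `[a, t]) cabs (q u).
pose Ve t := \int[mu]_(u in `[a, t]) cabs (q u - r u).
have loc s t : a <= s -> s <= t -> t <= b -> t - s < d ->
    Vq t - Vq s <= cabs (p t - p s) + 2 * (Ve t - Ve s) + 2 * eta * (t - s).
  move=> as_ st tb ts.
  have sub : `[s, t] `<=` `[a, b] by apply: subset_itv; rewrite bnd_simp.
  have iqS := cintegrableS (mI _ _) (mI _ _) sub iq.
  have irS := cintegrableS (mI _ _) (mI _ _) sub ir.
  have iqrS := cintegrableS (mI _ _) (mI _ _) sub iqr.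
  have irs : cintegrable `[s, t] (fun u => r u - r s).
    by apply: cintegrableB => //; exact: cintegrable_cst.
  have rsb u : s <= u <= t -> cabs (r u - r s) <= eta.
    move=> /andP[su ut]; apply/ltW/Hd.
    - by rewrite (le_trans as_)//= (le_trans ut).
    - by rewrite as_ (le_trans st).
    - by rewrite ger0_norm ?subr_ge0// (le_lt_trans _ ts)// lerB.
  rewrite /Vq /Ve -!(Rintegral_itv_ge0_le as_ st tb)//.
  have h1 : cabs (r s) * (t - s) <= cabs (p t - p s) +
      \int[mu]_(u in `[s, t]) cabs (q u - r u) + eta * (t - s).
    have -> : cabs (r s) * (t - s) = cabs (cint `[s, t] (fun=> r s)).
      by rewrite cint_cst// cabsM cabs_real ger0_norm ?subr_ge0// mulrC.
    have -> : cint `[s, t] (fun=> r s) = cint `[s, t] q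
       - cint `[s, t] (fun u => q u - r u) - cint `[s, t] (fun u => r u - r s).
      rewrite !cintB//; last exact: cintegrable_cst.
      by ring.
    rewrite -pq// (le_trans (cabsB _ _))// lerD//; last exact: cint_bound.
    by rewrite (le_trans (cabsB _ _))// lerD2l; exact: cabs_cint.
  have h2 : \int[mu]_(u in `[s, t]) cabs (q u) <=
      \int[mu]_(u in `[s, t]) cabs (q u - r u) + (eta + cabs (r s)) * (t - s).
    rewrite -Rintegral_cst_itv// -RintegralD//; last 2 first.
      exact: integrable_cabs.
      exact: integrable_cst_itv.
    apply: le_Rintegral => //; first exact: integrable_cabs.
      apply: integrable_add => //; first exact: integrable_cabs.
      exact: integrable_cst_itv.
    move=> u /=; rewrite in_itv /= => /rsb ru.
    rewrite -{1}(subrK (r u) (q u)) (le_trans (cabsD _ _))// lerD2l.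
    by rewrite -{1}(subrK (r s) (r u)) (le_trans (cabsD _ _))// lerD2r.
  lra.
have [n n0 nd] : exists2 n : nat, 0 < n%:R :> R & (b - a) / n%:R < d.
  exists (Num.truncn ((b - a) / d)).+1 => //.
  rewrite ltr_pdivrMr// mulrC -ltr_pdivrMr//.
  by rewrite truncnS_gt// divr_ge0// ltW.
pose u (i : nat) := a + i%:R * ((b - a) / n%:R).
have u0 : u 0%N = a by rewrite /u mul0r addr0.
have un : u n = b by rewrite /u mulrC divfK ?gt_eqF// addrC subrK.
have uS i : u i.+1 - u i = (b - a) / n%:R.
  by rewrite /u opprD addrACA subrr add0r -mulrBl -natrB// subSnn mul1r.
have uS1 i : u i < u i.+1 by rewrite -subr_gt0 uS divr_gt0.
have um i j : (i <= j)%N -> u i <= u j.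
  by move=> ij; rewrite /u lerD2l ler_pM2r ?divr_gt0// ler_nat.
have uab i : (i <= n)%N -> a <= u i <= b.
  by move=> ni; apply/andP; split; [rewrite -u0 um|rewrite -un um].
have pl : \sum_(i < n) cabs (p (u i.+1) - p (u i)) <= M.
  apply: le_trans (pM (mkseq u n.+1) _ _).
  - rewrite /polygon_length size_mkseq; apply: ler_sum => i _.
    have -> : nth 0 (mkseq u n.+1) i.+1 = u i.+1 by rewrite nth_mkseq ?ltnS.
    by have -> : nth 0 (mkseq u n.+1) i = u i by rewrite nth_mkseq// ltnS ltnW.
  - apply/(sortedP 0) => i; rewrite size_mkseq => ni.
    by rewrite !nth_mkseq// ltnW.
  - move=> x xm; have [j] := elimT (seq.nthP 0) xm.
    rewrite size_mkseq ltnS => nj <-; rewrite nth_mkseq ?ltnS//.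
    by rewrite in_itv /=; exact: uab.
have tel (f : R -> R) : f b - f a = \sum_(i < n) (f (u i.+1) - f (u i)).
  rewrite -(big_mkord xpredT (fun i => f (u i.+1) - f (u i))).
  by rewrite (telescope_sumr (fun i => f (u i)))// un u0.
have : Vq b - Vq a <= M + 2 * (Ve b - Ve a) + 2 * eta * (b - a).
  rewrite (tel Vq) (tel Ve).
  have -> : 2 * eta * (b - a) = \sum_(i < n) 2 * eta * (u i.+1 - u i).
    by rewrite -mulr_sumr -(tel id).
  rewrite mulr_sumr.
  apply: (@le_trans _ _ (\sum_(i < n) (cabs (p (u i.+1) - p (u i)) +
      2 * (Ve (u i.+1) - Ve (u i)) + 2 * eta * (u i.+1 - u i)))).
    apply: ler_sum => i _; have /andP[a1 a2] := uab i (ltnW (ltn_ord i)).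
    have /andP[a3 a4] := uab i.+1 (ltn_ord i).
    by apply: loc => //; [exact/ltW|rewrite uS].
  by rewrite !big_split /= lerD2r lerD2r.
have -> : Vq a = 0 by rewrite /Vq set_itv1 Rintegral_set1.
have -> : Ve a = 0 by rewrite /Ve set_itv1 Rintegral_set1.
rewrite !subr0 => /le_trans; apply; rewrite -addrA lerD2l.
apply: (@le_trans _ _ (2 * eta + 2 * eta * (b - a))).
  by rewrite lerD2r ler_pM2l.
rewrite /eta -{1}[2 * _]mulr1 -mulrDr mulrAC mulrA.
by rewrite mulrAC divff ?mul1r// gt_eqF// mulr_gt0// ltr_wpDr// subr_ge0 ltW.
Qed.

Lemma integral_itvoo (f : R -> \bar R) a b : measurable_fun `[a, b] f ->
  (\int[mu]_(u in `]a, b[) f u = \int[mu]_(u in `[a, b]) f u)%E.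
Proof.
move=> mf; rewrite integral_itv_bndo_bndc; last first.
  by apply: measurable_funS mf => //; apply: subset_itv; rewrite bnd_simp.
rewrite integral_itv_obnd_cbnd//.
by apply: measurable_funS mf => //; apply: subset_itv; rewrite bnd_simp.
Qed.

Theorem curve_length_density p q a b : a < b -> has_density p q a b ->
  curve_length p `[a, b] = (\int[mu]_(u in `]a, b[) (cabs (q u))%:E)%E.
Proof.
move=> ab hd; have ic := integrable_cabs (measurable_itv `[a, b]) hd.1.
rewrite integral_itvoo; last exact: measurable_int ic.
have If : (\int[mu]_(u in `[a, b]) (cabs (q u))%:E)%E \is a fin_num.
  exact: integrable_fin_num ic.
rewrite -[RHS]fineK//; apply/eqP; rewrite eq_le; apply/andP; split.
  apply: ge_ereal_sup => _ [l [sl lab] <-].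
  by rewrite lee_fin; exact: (has_density_le (ltW ab) hd).
have H (l : seq R) : sorted <%R l -> {subset l <= `[a, b]} ->
    ((polygon_length p l)%:E <= curve_length p `[a, b])%E.
  by move=> sl lab; apply: ereal_sup_ubound; exists l.
(* The empty polygon excludes the value [-oo] of the supremum. *)
have := H [::] isT; case E : (curve_length p `[a, b]) => [M| |] HM.
- rewrite lee_fin; apply: (has_density_ge ab hd) => l sl lab.
  by have := H l sl lab; rewrite E lee_fin.
- by rewrite leey.
- by have := HM (fun x => ltac:(by [])); rewrite leNgt ltNyr.
Qed.

End Length.

(** * Peak functions of a finite family of intervals *)

Section Peak.
Variable R : realType.
Local Notation C := R[i].
Local Notation mu := (@lebesgue_measure R).
Implicit Types (s : seq (R * R)) (p : R * R) (k d t : R) (w : C).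

(** A pair [p] encodes the interval of centre [p.1] and radius [p.2]; [pole p] vanishes at
    [p.1 - i p.2], below the real line. *)
Definition pole p w : C := w - p.1%:C + 'i * p.2%:C.

Definition pole_sum s k w : C := k%:C * \sum_(p <- s) 'i * p.2%:C * (pole p w)^-1.

Definition pole_sum' s k w : C :=
  - (k%:C * \sum_(p <- s) 'i * p.2%:C * (pole p w) ^- 2).

(* For [k > 0]: bounded by 1 on the upper half-plane, at most [2 / k] within
   [p.2] of the point [p.1] on the real line, and close to 1 away from these
   points if the sum of the [p.2] is small compared to [k^-1]. *)
Definition peak s k w : C := (1 + pole_sum s k w)^-1.

Definition peak' s k w : C := - pole_sum' s k w * (peak s k w) ^+ 2.

Definition radii_pos s := forall p, p \in s -> 0 < p.2.

Lemma poleE p w :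
  pole p w = (complex.Re w - p.1) +i* (complex.Im w + p.2).
Proof. by apply: complex_ext; rewrite /pole; case: w => x y /=; ring. Qed.

Lemma pole_neq0 p w : 0 < p.2 -> 0 <= complex.Im w -> pole p w != 0.
Proof.
move=> p0 w0; rewrite poleE eq_complex negb_and /= orbC gt_eqF//.
exact: ltr_wpDl.
Qed.

Lemma Re_pole_term p w : 0 < p.2 -> 0 <= complex.Im w ->
  complex.Re ('i * p.2%:C * (pole p w)^-1) =
  p.2 * (complex.Im w + p.2) / cabs (pole p w) ^+ 2.
Proof.
move=> p0 w0; rewrite ReM ReV ImV poleE /=; ring.
Qed.

Lemma Re_pole_sum s k w : complex.Re (pole_sum s k w) =
  k * \sum_(p <- s) complex.Re ('i * p.2%:C * (pole p w)^-1).
Proof.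
rewrite /pole_sum ReM /= mul0r subr0; congr (_ * _).
by elim/big_ind2 : _ => // x1 x2 y1 y2 <- <-; rewrite ReD.
Qed.

Lemma Re_pole_sum_ge0 s k w : radii_pos s -> 0 <= k -> 0 <= complex.Im w ->
  0 <= complex.Re (pole_sum s k w).
Proof.
move=> s0 k0 w0; rewrite Re_pole_sum mulr_ge0// big_seq; apply: sumr_ge0 => p ps.
have p0 := s0 p ps; rewrite Re_pole_term// divr_ge0// ?sqr_ge0//.
by rewrite mulr_ge0// ?addr_ge0// ltW.
Qed.

(** On the real line the term of [p] has real part [p.2 ^+ 2 / ((t - p.1) ^+ 2 + p.2 ^+ 2)], which
    is at least [1 / 2] on its interval; the other terms have nonnegative real part. *)
Lemma Re_pole_sum_ge s k t p : radii_pos s -> 0 <= k -> p \in s ->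
  `|t - p.1| <= p.2 -> k / 2 <= complex.Re (pole_sum s k t%:C).
Proof.
move=> s0 k0 ps tp; rewrite Re_pole_sum; apply: ler_wpM2l => //.
rewrite (big_rem p)// -[_^-1]addr0 lerD//.
  have p0 := s0 p ps; rewrite (Re_pole_term (w := t%:C))// cabs_sqr poleE /= add0r.
  have tp2 : (t - p.1) ^+ 2 <= p.2 ^+ 2.
    by rewrite -[leLHS]real_normK ?num_real// ler_sqr ?nnegrE// ltW.
  have q0 : 0 < p.2 ^+ 2 by rewrite exprn_gt0.
  have n0 : 0 < (t - p.1) ^+ 2 + p.2 ^+ 2 by rewrite ltr_wpDl// sqr_ge0.
  rewrite ler_pdivlMr// -expr2.
  by move: tp2; set u := _ ^+ 2; set v := _ ^+ 2 => uv; lra.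
rewrite big_seq; apply: sumr_ge0 => q /mem_rem qs.
have q0 := s0 q qs; rewrite Re_pole_term// divr_ge0// ?sqr_ge0//.
by rewrite mulr_ge0// ?addr_ge0// ltW.
Qed.

Lemma pole_sum_le s k w d : radii_pos s -> 0 <= k -> 0 < d ->
  (forall p, p \in s -> d <= cabs (pole p w)) ->
  cabs (pole_sum s k w) <= k * (\sum_(p <- s) p.2) / d.
Proof.
move=> s0 k0 d0 H; rewrite /pole_sum cabsM cabs_real ger0_norm// -mulrA.
apply: ler_wpM2l => //; rewrite mulr_suml.
apply: (@le_trans _ _ (\sum_(p <- s) cabs ('i * p.2%:C * (pole p w)^-1))).
  elim/big_ind2 : _ => [|x1 x2 y1 y2 h1 h2|//]; first by rewrite cabs0.
  by apply: le_trans (cabsD _ _) _; exact: lerD.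
rewrite big_seq [leRHS]big_seq; apply: ler_sum => p ps; have p0 := s0 p ps.
rewrite !cabsM cabs_i mul1r cabs_real gtr0_norm// cabsV ler_pM2l//.
by rewrite lef_pV2 ?posrE ?H//; exact: lt_le_trans (H _ ps).
Qed.

Lemma pole_sum'_le s k w d : radii_pos s -> 0 <= k -> 0 < d ->
  (forall p, p \in s -> d <= cabs (pole p w)) ->
  cabs (pole_sum' s k w) <= k * (\sum_(p <- s) p.2) / d ^+ 2.
Proof.
move=> s0 k0 d0 H; rewrite /pole_sum' cabsN cabsM cabs_real ger0_norm// -mulrA.
apply: ler_wpM2l => //; rewrite mulr_suml.
apply: (@le_trans _ _ (\sum_(p <- s) cabs ('i * p.2%:C * (pole p w) ^- 2))).
  elim/big_ind2 : _ => [|x1 x2 y1 y2 h1 h2|//]; first by rewrite cabs0.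
  by apply: le_trans (cabsD _ _) _; exact: lerD.
rewrite big_seq [leRHS]big_seq; apply: ler_sum => p ps; have p0 := s0 p ps.
rewrite !cabsM cabs_i mul1r cabs_real gtr0_norm// cabsV cabsX ler_pM2l//.
have d1 : 0 < cabs (pole p w) by exact: lt_le_trans (H _ ps).
rewrite lef_pV2 ?posrE ?exprn_gt0// ler_sqr ?nnegrE; [exact: H|exact: ltW|exact: ltW].
Qed.

Lemma cdiff_pole p w : cdiff (pole p) w 1.
Proof.
have := cdiffD (cdiff_subr p.1%:C w) (cdiff_cst ('i * p.2%:C) w).
by rewrite addr0.
Qed.

Lemma cdiff_pole_sum s k w : radii_pos s -> 0 <= complex.Im w ->
  cdiff (pole_sum s k) w (pole_sum' s k w).
Proof.
move=> s0 w0; rewrite /pole_sum'.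
have H : cdiff (fun w => \sum_(p <- s) 'i * p.2%:C * (pole p w)^-1) w
    (- \sum_(p <- s) 'i * p.2%:C * (pole p w) ^- 2).
  elim: s s0 => [|p s IH] s0.
    rewrite big_nil oppr0; apply: cdiff_near (cdiff_cst 0 w).
    by apply: nearW => z; rewrite big_nil.
  have p0 : 0 < p.2 by apply: s0; rewrite mem_head.
  have /IH {}IH : radii_pos s by move=> q qs; apply: s0; rewrite in_cons qs orbT.
  have := cdiffD (cdiffM (cdiff_cst ('i * p.2%:C) w)
    (cdiffV (pole_neq0 p0 w0) (cdiff_pole p w))) IH.
  rewrite mul0r add0r mulN1r mulrN -opprD big_cons; apply: cdiff_near.
  by apply: nearW => z; rewrite big_cons.
by have := cdiffM (cdiff_cst k%:C w) H; rewrite mul0r add0r mulrN.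
Qed.

Lemma cdiff_pole_sum' s k w : radii_pos s -> 0 <= complex.Im w ->
  cdiffable (pole_sum' s k) w.
Proof.
move=> s0 w0; have [l H] : cdiffable
    (fun w => \sum_(p <- s) 'i * p.2%:C * (pole p w) ^- 2) w.
  elim: s s0 => [|p s IH] s0.
    exists 0; apply: cdiff_near (cdiff_cst 0 w).
    by apply: nearW => z; rewrite big_nil.
  have p0 : 0 < p.2 by apply: s0; rewrite mem_head.
  have /IH [l IHl] : radii_pos s by move=> q qs; apply: s0; rewrite in_cons qs orbT.
  have := cdiffD (cdiffM (cdiff_cst ('i * p.2%:C) w)
    (cdiffX 2 (cdiffV (pole_neq0 p0 w0) (cdiff_pole p w)))) IHl.
  move=> d; eexists; apply: cdiff_near d.
  by apply: nearW => z; rewrite big_cons exprVn.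
by eexists; exact: (cdiffN (cdiffM (cdiff_cst k%:C w) H)).
Qed.

Lemma cabs_one_add w : 0 <= complex.Re w -> 1 <= cabs (1 + w).
Proof.
move=> w0; apply: le_trans (cabs_ler_Re _); rewrite ReD /=.
by rewrite ger0_norm ?addr_ge0// lerDl.
Qed.

Section bounds.
Variables (s : seq (R * R)) (k : R).
Hypotheses (s0 : radii_pos s) (k0 : 0 <= k).

Lemma peak_den_neq0 w : 0 <= complex.Im w -> 1 + pole_sum s k w != 0.
Proof.
move=> w0; rewrite -cabs_gt0; apply: lt_le_trans ltr01 _.
by apply: cabs_one_add; exact: Re_pole_sum_ge0.
Qed.

Lemma cdiff_peak w : 0 <= complex.Im w -> cdiff (peak s k) w (peak' s k w).
Proof.
move=> w0; have := cdiffV (f := fun w => 1 + pole_sum s k w) (peak_den_neq0 w0)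
  (cdiffD (cdiff_cst 1 w) (cdiff_pole_sum k s0 w0)).
by rewrite add0r /peak' /peak exprVn.
Qed.

Lemma cdiff_peak' w : 0 <= complex.Im w -> cdiffable (peak' s k) w.
Proof.
move=> w0; have [l dl] := cdiff_pole_sum' k s0 w0.
by eexists; exact: (cdiffM (cdiffN dl) (cdiffX 2 (cdiff_peak w0))).
Qed.

Lemma peak_le1 w : 0 <= complex.Im w -> cabs (peak s k w) <= 1.
Proof.
move=> w0; rewrite /peak cabsV invf_le1 ?cabs_one_add ?Re_pole_sum_ge0//.
by apply: lt_le_trans ltr01 _; rewrite cabs_one_add ?Re_pole_sum_ge0.
Qed.

Lemma peak_small t p : p \in s -> `|t - p.1| <= p.2 -> 0 < k ->
  cabs (peak s k t%:C) <= 2 / k.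
Proof.
move=> ps tp kp; have h := Re_pole_sum_ge s0 k0 ps tp.
have h1 : k / 2 <= cabs (1 + pole_sum s k t%:C).
  apply: le_trans (cabs_ler_Re _); rewrite ReD /=.
  by rewrite (le_trans _ (ler_norm _))// (le_trans h)// lerDr.
have k2 : 0 < k / 2 by rewrite divr_gt0.
rewrite /peak cabsV -invf_div lef_pV2 ?posrE//; exact: lt_le_trans h1.
Qed.

Lemma peak_sub1 w d : 0 <= complex.Im w -> 0 < d ->
  (forall p, p \in s -> d <= cabs (pole p w)) ->
  cabs (peak s k w - 1) <= k * (\sum_(p <- s) p.2) / d.
Proof.
move=> w0 d0 H; apply: le_trans (pole_sum_le s0 k0 d0 H).
have -> : peak s k w - 1 = - pole_sum s k w * peak s k w.
  by rewrite /peak; field; exact: peak_den_neq0.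
by rewrite cabsM cabsN ler_piMr ?cabs_ge0// peak_le1.
Qed.

Lemma peak'_le w d : 0 <= complex.Im w -> 0 < d ->
  (forall p, p \in s -> d <= cabs (pole p w)) ->
  cabs (peak' s k w) <= k * (\sum_(p <- s) p.2) / d ^+ 2.
Proof.
move=> w0 d0 H; apply: le_trans (pole_sum'_le s0 k0 d0 H).
rewrite /peak' cabsM cabsN cabsX ler_piMr ?cabs_ge0//.
by rewrite expr_le1// ?cabs_ge0// peak_le1.
Qed.

End bounds.

(** The outer measure supplies open intervals and compactness finitely many of them. Only those that
    meet [K] are kept: they are nonempty, so their radii are positive, and they stay close to
    [K]. *)
Lemma compact_cover_seq (K : set R) e : compact K -> (mu K < e%:E)%E ->
  exists s, [/\ radii_pos s, \sum_(p <- s) p.2 <= e,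
    forall t, K t -> exists2 p, p \in s & `|t - p.1| <= p.2 &
    forall p, p \in s -> exists2 c, K c & `|c - p.1| <= p.2].
Proof.
move=> cK Ke.
have : (((wlength idfun)^* K)%mu < e%:E)%E by exact: Ke.
rewrite outer_measure_open_itv_cover => /ereal_inf_lt[_ [F [oF KF] <-] Fe].
have /choice[ab Fab] j : exists ab : R * R, F j = `]ab.1, ab.2[%classic.
  by have [x ->] := oF j; exists x.
move: cK; rewrite compact_cover => /(_ nat setT F).
have oF' j : setT j -> open (F j) by move=> _; rewrite Fab; exact: interval_open.
move=> /(_ oF' KF)[D _ KD].
pose n := (\max_(j <- finmap.enum_fset D) j.+1)%N.
pose P j := `[< exists2 t, K t & F j t >].
pose q j : R * R := (((ab j).1 + (ab j).2) / 2, ((ab j).2 - (ab j).1) / 2).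
have Pab j : P j -> (ab j).1 < (ab j).2.
  move/asboolP => [t _]; rewrite Fab /= in_itv /= => /andP[h1 h2].
  exact: lt_trans h2.
have Fq j t : F j t -> `|t - (q j).1| <= (q j).2.
  rewrite Fab /= in_itv /= /q /= => /andP[h1 h2].
  by rewrite ler_norml; apply/andP; split; lra.
exists [seq q j | j <- iota 0 n & P j]; split.
- move=> p /mapP[j]; rewrite mem_filter => /andP[/Pab Pk _] ->.
  by rewrite divr_gt0// subr_gt0.
- rewrite -lee_fin; apply/ltW; apply: le_lt_trans Fe.
  apply: le_trans (nneseries_lim_ge n _); last by move=> j _ _; exact: wlength_ge0.
  rewrite big_map big_filter -sumEFin big_mkcond /= /index_iota subn0.
  apply: lee_sum => j _; case: ifPn => Pk; last exact: wlength_ge0.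
  have abk := Pab j Pk; rewrite Fab wlength_itv /= lte_fin abk -EFinB lee_fin /q /=.
  by move: abk; lra.
- move=> t Kt; have [j kD Fkt] := KD t Kt.
  exists (q j); last exact: Fq.
  apply/mapP; exists j => //; rewrite mem_filter; apply/andP; split.
    by apply/asboolP; exists t.
  rewrite mem_iota /= add0n; apply: (@leq_bigmax_seq _ _ xpredT (fun j => j.+1)) => //.
- move=> p /mapP[j]; rewrite mem_filter => /andP[/asboolP[t Kt Fkt] _] ->.
  by exists t => //; exact: Fq.
Qed.

End Peak.

(** * Stieltjes measures, regularity and the Jordan decomposition *)

Section Stieltjes.
Variable R : realType.
Local Notation C := R[i].
Local Notation mu := (@lebesgue_measure R).
Local Notation T := (measurableTypeR R).
Implicit Types (a b s t u : R).

(** Over [n] equal pieces the bounds telescope to [k * (b - a) * (V b - V a) / n], which tends to 0.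
    Both integrations by parts rest on this: their defect is additive and is bounded by a product of
    two increments. *)
Lemma additive_second_order (D : R -> R -> C) (V : R -> R) (k : R) a b :
  a <= b ->
  (forall s t u, a <= s -> s <= t -> t <= u -> u <= b -> D s u = D s t + D t u) ->
  (forall s t, a <= s -> s <= t -> t <= b ->
     cabs (D s t) <= k * (t - s) * (V t - V s)) -> D a b = 0.
Proof.
move=> ab Dadd Dle; apply/eqP; rewrite -cabs_eq0 eq_le cabs_ge0 andbT.
apply/ler_addgt0Pr => e e0; rewrite add0r.
have [n n0 ne] : exists2 n : nat, 0 < n%:R :> R &
    `|k * (b - a) * (V b - V a)| / n%:R <= e.
  near \oo => n; exists n; first by near: n; exact: nbhs_infty_gtr.
  rewrite ler_pdivrMr; last by near: n; exact: nbhs_infty_gtr.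
  rewrite -ler_pdivrMl// mulrC; near: n; exact: nbhs_infty_ger.
pose u (j : nat) := a + j%:R * ((b - a) / n%:R).
have u0 : u 0%N = a by rewrite /u mul0r addr0.
have un : u n = b by rewrite /u mulrC divfK ?gt_eqF// addrC subrK.
have uS j : u j.+1 - u j = (b - a) / n%:R.
  by rewrite /u opprD addrACA subrr add0r -mulrBl -natrB// subSnn mul1r.
have h0 : 0 <= (b - a) / n%:R by rewrite divr_ge0 ?subr_ge0// ltW.
have um i j : (i <= j)%N -> u i <= u j.
  by move=> ij; rewrite /u lerD2l ler_wpM2r// ler_nat.
have Dsum m : (m <= n)%N -> D a (u m) = \sum_(j < m) D (u j) (u j.+1).
  elim: m => [|m IH] mn.
    rewrite big_ord0 u0; have := Dadd a a a (lexx a) (lexx a) (lexx a) ab.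
    by move/eqP; rewrite -subr_eq0 opprD addrA subrr sub0r oppr_eq0 => /eqP.
  rewrite big_ord_recr /= -IH ?(ltnW mn)//; apply: Dadd.
  - exact: lexx.
  - by rewrite -u0 um.
  - exact: um.
  - by rewrite -un um.
have := Dsum n (leqnn n); rewrite un => ->.
apply: (@le_trans _ _ (\sum_(j < n) k * ((b - a) / n%:R) * (V (u j.+1) - V (u j)))).
  have H : forall j : 'I_n, cabs (D (u j) (u j.+1)) <=
      k * ((b - a) / n%:R) * (V (u j.+1) - V (u j)).
    move=> j; rewrite -(uS j); apply: Dle; first by rewrite -u0 um.
      exact: um.
    by rewrite -un um.
  apply: (@le_trans _ _ (\sum_(j < n) cabs (D (u j) (u j.+1)))).
    elim/big_ind2 : _ => [|x1 x2 y1 y2 h1 h2|//]; first by rewrite cabs0.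
    by apply: le_trans (cabsD _ _) _; exact: lerD.
  exact: ler_sum.
rewrite -mulr_sumr -(big_mkord xpredT (fun j => V (u j.+1) - V (u j))).
rewrite (telescope_sumr (fun j => V (u j)))// un u0.
apply: le_trans ne; apply: le_trans (ler_norm _) _.
have -> : k * ((b - a) / n%:R) * (V b - V a) = k * (b - a) * (V b - V a) / n%:R by ring.
by rewrite normrM normfV (ger0_norm (ltW n0)).
Unshelve. all: by end_near. Qed.

Lemma stieltjes_itvoc (f : cumulative R R) s t : s <= t ->
  lebesgue_stieltjes_measure f `]s, t]%classic = (f t - f s)%:E.
Proof.
move=> st; rewrite /lebesgue_stieltjes_measure/= /measure_extension/=.
by rewrite measurable_mu_extE//; [exact: wlength_itv_bnd|exact: is_ocitv].
Qed.

Definition regular_measure (nu : set T -> \bar R) := forall X : set T,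
  measurable X -> forall e : R, 0 < e -> exists K U : set R,
  [/\ closed K, open U, K `<=` X, X `<=` U & (nu (U `\` K) < e%:E)%E].

(** The sets that can be approximated form a sigma-algebra. It contains the half-open intervals
    because [nu] is dominated by the increments of the right-continuous [k]. *)
Lemma finite_measure_regular (nu : {finite_measure set T -> \bar R}) (k : R -> R) :
  (forall s t, s <= t -> (nu `]s, t]%classic <= (k t - k s)%:E)%E) ->
  right_continuous k -> regular_measure nu.
Proof.
move=> nuk rk.
have mo (U : set R) : open U -> measurable (U : set T) by exact: open_measurable.
have mc (U : set R) : closed U -> measurable (U : set T) by exact: closed_measurable.
pose reg (X : set T) := forall e : R, 0 < e -> exists K U : set R,
  [/\ closed K, open U, K `<=` X, X `<=` U & (nu (U `\` K) < e%:E)%E].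
suff H : <<s R.-ocitv.-measurable >> `<=` reg by move=> X /H.
apply: smallest_sub.
  split.
  - move=> e e0; exists set0, set0; rewrite setD0 measure0 lte_fin.
    split; [exact: closed0|exact: open0|by []|by []|exact: e0].
  - move=> X rX e /rX[K [U [cK oU KX XU KU]]]; exists (~` U), (~` K).
    split; [exact: open_closedC|exact: closed_openC| | |].
    + by rewrite setTD; exact: subsetC.
    + by rewrite setTD; exact: subsetC.
    + by rewrite setDE setCK setIC -setDE.
  - move=> X rX e e0.
    (* These tolerances sum to [e / 2]; the other half pays for truncating the union of the closed
       sets. *)
    have e2 (n : nat) : 0 < e / (2 ^ n.+2)%:R by rewrite divr_gt0// ltr0n expn_gt0.
    have /choice[KU KUP] (n : nat) : exists KU : set R * set R,
      [/\ closed KU.1, open KU.2, KU.1 `<=` X n, X n `<=` KU.2 &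
       (nu (KU.2 `\` KU.1) < (e / (2 ^ n.+2)%:R)%:E)%E].
      by have [K [U H]] := rX n _ (e2 n); exists (K, U).
    pose U := \bigcup_n (KU n).2; pose V := \bigcup_n (KU n).1.
    (* The countable union [V] of closed sets need not be closed. Continuity from above of the
       finite measure [nu] yields a finite union [W n] that misses at most [e / 2] of [V]. *)
    pose W n := \bigcup_(j < n) (KU j).1.
    have mU : measurable (U : set T).
      by apply: bigcup_measurable => n _; apply: mo; case: (KUP n).
    have mV : measurable (V : set T).
      by apply: bigcup_measurable => n _; apply: mc; case: (KUP n).
    have cW n : closed (W n) by apply: closed_bigcup => // j _; case: (KUP j).
    have mW n : measurable (V `\` W n : set T) by apply: measurableD => //; apply: mc; exact: cW.
    have [n Wn] : exists n, (nu (V `\` W n) < (e / 2)%:E)%E.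
      have W0 : \bigcap_n (V `\` W n) = set0.
        apply/seteqP; split => // x VW; have [[j _ Kx] _] := VW 0%N I.
        by have [_] := VW j.+1 I; apply; exists j => /=.
      have W0fin : (nu (V `\` W 0%N) < +oo)%E.
        by rewrite -ge0_fin_numE ?measure_ge0//; exact: fin_num_measure.
      have mI : measurable (\bigcap_n (V `\` W n) : set T) by rewrite W0; exact: measurable0.
      have Wdec : {homo (fun n => V `\` W n) : n m / (n <= m)%N >-> (m <= n)%O}.
        move=> n m nm; apply/subsetPset; apply: setDS => x [j /= jn Kx].
        by exists j => //=; exact: leq_trans nm.
      have := nonincreasing_cvg_mu W0fin mW mI Wdec.
      rewrite W0 measure0 => /fine_cvgP[_ /cvgrPdist_lt /(_ (e / 2))].
      rewrite divr_gt0// => /(_ isT)[n _ /(_ n (leqnn n))] /=.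
      rewrite sub0r normrN ger0_norm ?fine_ge0// => H; exists n.
      by rewrite -[ltLHS]fineK ?lte_fin//; exact: fin_num_measure.
    exists (W n), U; split.
    + exact: cW.
    + by apply: bigcup_open => j _; case: (KUP j).
    + by move=> x [j _ Kx]; exists j => //; case: (KUP j) => _ _ KX _ _; exact: KX.
    + by move=> x [j _ Xx]; exists j => //; case: (KUP j) => _ _ _ XU _; exact: XU.
    + pose Z := \bigcup_j ((KU j).2 `\` (KU j).1).
      have mKU j : measurable ((KU j).2 `\` (KU j).1 : set T).
        by case: (KUP j) => h1 h2 _ _ _; apply: measurableD; [exact: mo|exact: mc].
      have mZ : measurable (Z : set T) by apply: bigcup_measurable => j _; exact: mKU.
      apply: (@le_lt_trans _ _ (nu (Z `|` (V `\` W n)))).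
        apply: le_measure; rewrite ?inE; [|exact: measurableU|].
          by apply: measurableD => //; apply: mc; exact: cW.
        move=> x [[j _ Ux] Wx]; have [Kx|Kx] := pselect ((KU j).1 x).
          by right; split => //; exists j.
        by left; exists j.
      apply: (@le_lt_trans _ _ (nu Z + nu (V `\` W n))%E).
        exact: measureU2.
      rewrite [e in (_ < e%:E)%E](splitr e) EFinD; apply: lee_ltD => //.
        exact: fin_num_measure.
      apply: le_trans (measure_sigma_subadditive _ mKU mZ (@subset_refl _ _)) _.
      have e20 : 0 <= e / 2 by rewrite divr_ge0// ltW.
      apply: le_trans (epsilon_trick0 xpredT e20); apply: lee_nneseries => // j _.
      case: (KUP j) => _ _ _ _ /ltW /le_trans; apply.
      by rewrite lee_fin (expnS 2 j.+1) natrM invfM mulrA.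
move=> _ [[s t] _ <-] e e0 /=.
(* The interval []s, t]] lies between [[s + d, t]] and []s, t + d[], which differ only inside []s, s
   + d]] and []t, t + d]]. *)
have [d d0 [kd1 kd2]] : exists2 d, 0 < d & k (s + d) - k s < e / 2 /\ k (t + d) - k t < e / 2.
  have H r : \forall d \near 0^'+, k (r + d) - k r < e / 2.
    have e2 : 0 < e / 2 by rewrite divr_gt0.
    have := rk r => /cvgrPdist_lt /(_ _ e2).
    rewrite !near_withinE !near_simpl => /(@nbhs0P _ R); apply: filterS => d h d0.
    apply: le_lt_trans (ler_norm _) _; rewrite distrC; apply: h.
    by rewrite ltrDl.
  have /filter_ex[d [d0 [h1 h2]]] : \forall d \near 0^'+, 0 < d /\
      (k (s + d) - k s < e / 2 /\ k (t + d) - k t < e / 2).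
    by apply: filterI; [exact: nbhs_right_gt|apply: filterI; exact: H].
  by exists d.
exists `[s + d, t]%classic, `]s, t + d[%classic; split.
- exact: interval_closed.
- exact: interval_open.
- by apply: subset_itv; rewrite bnd_simp// ltrDl.
- by apply: subset_itv; rewrite bnd_simp// ltrDl.
have d1 r : r <= r + d by rewrite lerDl ltW.
apply: (@le_lt_trans _ _ (nu (`]s, s + d]%classic `|` `]t, t + d]%classic))).
  apply: le_measure; rewrite ?inE.
  - by apply: measurableD; exact: measurable_itv.
  - by apply: measurableU; exact: measurable_itv.
  - move=> x [] /=; rewrite !in_itv /= => /andP[sx xt] /negP; rewrite negb_and -!ltNge.
    move=> /orP[xs|tx]; [left|right]; rewrite ?sx ?tx ltW//.
apply: (@le_lt_trans _ _ (nu `]s, (s + d)%R]%classic + nu `]t, (t + d)%R]%classic)%E).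
  by apply: measureU2; exact: measurable_itv.
apply: (@le_lt_trans _ _ ((k (s + d) - k s)%:E + (k (t + d) - k t)%:E)%E).
  by apply: leeD; exact: nuk.
by rewrite -EFinD lte_fin [ltRHS]splitr ltrD.
Qed.

(** Restricting the Stieltjes measure of [A] to []a, b]] makes it finite, and the restriction still
    satisfies the domination that regularity asks for. *)
Lemma stieltjes_measure_exists (A : R -> R) a b : a <= b ->
  nondecreasing A -> continuous A ->
  exists nu : {finite_measure set T -> \bar R},
    (forall s t, a <= s -> s <= t -> t <= b -> nu `]s, t]%classic = (A t - A s)%:E) /\
    nu (~` `]a, b]%classic) = 0%E /\ regular_measure nu.
Proof.
move=> ab ndA cA; have rA := right_continuousW cA.
pose F : cumulative R R := HB.pack A (isCumulative.Build R _ R A ndA rA).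
have mD : measurable (`]a, b]%classic : set T) by exact: measurable_itv.
pose nu0 := mrestr (lebesgue_stieltjes_measure F) mD.
have fin : fin_num_fun nu0.
  move=> X mX; rewrite ge0_fin_numE ?measure_ge0//.
  apply: (@le_lt_trans _ _ (lebesgue_stieltjes_measure F `]a, b]%classic)).
    by rewrite /nu0 /mrestr; apply: le_measure; rewrite ?inE//; apply: measurableI.
  by rewrite stieltjes_itvoc// ltry.
pose nu : {finite_measure set T -> \bar R} := HB.pack nu0 (Measure_isFinite.Build _ _ _ nu0 fin).
exists nu; split.
  move=> s t as_ st tb; rewrite /= /nu0 /mrestr setIidl.
    by rewrite stieltjes_itvoc.
  by apply: subset_itv; rewrite bnd_simp.
split; first by rewrite /= /nu0 /mrestr setICl measure0.
apply: (@finite_measure_regular nu A) => // s t st; rewrite -(@stieltjes_itvoc F)//.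
rewrite /= /nu0 /mrestr; apply: le_measure; rewrite ?inE//; apply: measurableI => //.
Qed.

Lemma bounded_variation_decomp (f : R -> R) a b : a < b -> continuous f ->
  bounded_variation a b f -> exists A B : R -> R,
  [/\ nondecreasing A, continuous A, nondecreasing B, continuous B &
    forall t, a <= t -> t <= b -> f t = A t - B t].
Proof.
move=> ab cf bvf.
(* Composition with the clamping map extends the variation functions from [[a, b]] to the line and
   preserves monotonicity and continuity. *)
pose cl t := Num.max a (Num.min b t).
have clin t : cl t \in `[a, b].
  by rewrite in_itv /= /cl le_max lexx /= ge_max ltW// ge_min lexx.
have cln : {homo cl : s t / s <= t}.
  move=> s t st; rewrite /cl ge_max !le_max lexx /=; apply/orP; right.
  by rewrite le_min !ge_min lexx st orbT.
have clE t : a <= t -> t <= b -> cl t = t.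
  by move=> at_ tb; rewrite /cl (min_idPr tb) (max_idPr at_).
have ccl : continuous cl.
  move=> t; apply: (@continuous_max _ _ (cst a) (fun t => Num.min b t)).
    exact: cvg_cst.
  by apply: (@continuous_min _ _ (cst b) id); [exact: cvg_cst|exact: cvg_id].
have ccomp (g : R -> R) : {within `[a, b], continuous g} -> continuous (g \o cl).
  move=> cg t; apply: (@cvg_comp _ _ _ cl g _ (within [set` `[a, b]] (nbhs (cl t)))).
    move=> P wP.
    have H : nbhs t (fun x => cl x \in `[a, b] -> P (cl x)) := ccl t _ wP.
    apply: (@filterS _ (nbhs t) _ _ _ _ H) => x Hx; exact/Hx/clin.
  have := cg (cl t); rewrite /from_subspace nbhs_subspace_in//.
  exact: clin.
have ctv (g : R -> R) : continuous g -> bounded_variation a b g ->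
    nondecreasing (fine \o neg_tv a g \o cl) /\ continuous (fine \o neg_tv a g \o cl).
  move=> cg bvg; split.
    by move=> s t st; apply: (fine_neg_tv_nondecreasing bvg (clin s) (clin t)); exact: cln.
  apply: ccomp; have cwg : {within `[a, b], continuous g} by exact: continuous_subspaceT.
  have ctv := total_variation_continuous ab cwg bvg.
  apply: (@subspace_eq_continuous _ _ _ (fun t => (fine (total_variation a t g) - g t) * 2^-1)).
    move=> t /set_mem /=; rewrite in_itv /= => /andP[at_ tb]; rewrite /neg_tv /from_subspace /=.
    have ft : total_variation a t g \is a fin_num.
      by apply/bounded_variationP => //; exact: (bounded_variationl at_ tb bvg).
    by rewrite -[in RHS](fineK ft) -EFinD -EFinM.
  move=> t; apply: cvgM; last exact: cvg_cst.
  by apply: cvgB; [exact: ctv|exact: cwg].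
(* The positive variation of [f] is the negative variation of [- f], so [ctv] serves for both. *)
have bvN : bounded_variation a b (\- f) by exact/bounded_variationN.
have cN : continuous (\- f) by move=> t; apply: cvgN; exact: cf.
have [nA cA] := ctv _ cN bvN; have [nB cB] := ctv _ cf bvf.
exists (fine \o pos_tv a f \o cl), (fine \o neg_tv a f \o cl); split => // t at_ tb.
rewrite (bounded_variation_pos_neg_tvE bvf) ?in_itv /= ?at_ ?tb//.
by rewrite /= clE.
Qed.

End Stieltjes.

(** * The boundary Stieltjes measure on compact null sets *)

Section Riesz.
Variable R : realType.
Local Notation C := R[i].
Local Notation mu := (@lebesgue_measure R).
Local Notation T := (measurableTypeR R).
Implicit Types (a b s t u : R) (K : set R).

(** The modulus of [pole p w] dominates both [p.2] and [|w - p.1|], and the sum of these is at least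
    [|w - c|]. *)
Lemma pole_far (p : R * R) (w : C) (c d : R) : 0 < p.2 -> 0 <= complex.Im w ->
  `|c - p.1| <= p.2 -> d <= cabs (w - c%:C) -> d / 2 <= cabs (pole p w).
Proof.
move=> p0 w0 cp dw.
have h1 : p.2 <= cabs (pole p w).
  apply: le_trans (cabs_ler_Im _); rewrite poleE /=.
  by rewrite ger0_norm ?lerDr// addr_ge0// ltW.
have h2 : cabs (w - p.1%:C) <= cabs (pole p w).
  rewrite -ler_sqr ?nnegrE ?cabs_ge0// !cabs_sqr poleE /=.
  case: w w0 {dw h1} => x y /= y0; rewrite lerD2l subr0 ler_sqr ?nnegrE//.
    by rewrite lerDl ltW.
  by rewrite addr_ge0// ltW.
have h3 : cabs (w - c%:C) <= cabs (w - p.1%:C) + `|c - p.1|.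
  have -> : w - c%:C = (w - p.1%:C) - (c - p.1)%:C by rewrite rmorphB /=; ring.
  by apply: le_trans (cabsB _ _) _; rewrite cabs_real.
by move: h1 h2 h3 cp dw; lra.
Qed.

(** The weight is [n.+1] and the total radius at most [n.+1%:R ^- 2]: the weight tends to infinity,
    so the peaks tend to 0 on [K], while weight times total radius is at most [1 / n.+1], which
    governs the behaviour off [K]. *)
Lemma peak_sequence K : compact K -> mu K = 0%E ->
  exists s : nat -> seq (R * R), [/\ forall n, radii_pos (s n),
    forall n t, K t -> cabs (peak (s n) n.+1%:R t%:C) <= 2 / n.+1%:R,
    forall n (d : R) (w : C), 0 < d -> 0 <= complex.Im w -> (forall c, K c -> d <= cabs (w - c%:C)) ->
      cabs (peak (s n) n.+1%:R w - 1) <= 2 / d / n.+1%:R &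
    forall n (d : R) (w : C), 0 < d -> 0 <= complex.Im w -> (forall c, K c -> d <= cabs (w - c%:C)) ->
      cabs (peak' (s n) n.+1%:R w) <= 4 / d ^+ 2 / n.+1%:R].
Proof.
move=> cK K0.
have e0 n : 0 < (n.+1%:R ^- 2 : R) by rewrite invr_gt0 exprn_gt0.
have /choice[s sP] (n : nat) : exists s : seq (R * R), [/\ radii_pos s, \sum_(p <- s) p.2 <= (n.+1%:R ^- 2 : R),
    forall t, K t -> exists2 p, p \in s & `|t - p.1| <= p.2 &
    forall p, p \in s -> exists2 c, K c & `|c - p.1| <= p.2].
  by apply: compact_cover_seq => //; rewrite K0 lte_fin.
have n0 (n : nat) : 0 < n.+1%:R :> R by [].
have far n (d : R) (w : C) : 0 < d -> 0 <= complex.Im w -> (forall c, K c -> d <= cabs (w - c%:C)) ->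
    forall p, p \in s n -> d / 2 <= cabs (pole p w).
  move=> d0 w0 H p ps; have [rp _ _ /(_ p ps)[c Kc cp]] := sP n.
  by apply: (pole_far (rp p ps) w0 cp); exact: H.
have sum_le n : n.+1%:R * \sum_(p <- s n) p.2 <= n.+1%:R^-1.
  have [_ sl _ _] := sP n; rewrite -ler_pdivlMl//.
  by apply: le_trans sl _; rewrite expr2 invfM.
exists s; split.
- by move=> n; case: (sP n).
- move=> n t Kt; have [rp _ /(_ t Kt)[p ps tp] _] := sP n.
  exact: (peak_small rp _ ps tp).
- move=> n d w d0 w0 H; have [rp _ _ _] := sP n.
  apply: le_trans (peak_sub1 rp (ltW (n0 n)) w0 _ (far n d w d0 w0 H)) _.
    by rewrite divr_gt0.
  by rewrite invf_div mulrC ler_pM2l// divr_gt0.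
- move=> n d w d0 w0 H; have [rp _ _ _] := sP n.
  apply: le_trans (peak'_le rp (ltW (n0 n)) w0 _ (far n d w d0 w0 H)) _.
    by rewrite divr_gt0.
  rewrite expr_div_n (_ : 2 ^+ 2 = 4) ?invf_div; last by ring.
  by rewrite mulrC ler_pM2l// divr_gt0// exprn_gt0.
Qed.

Lemma continuous_bounded_itv (g : R -> R) a b : a <= b -> continuous g ->
  exists2 M : R, 0 <= M & forall t, a <= t -> t <= b -> `|g t| <= M.
Proof.
move=> ab cg; have cn : {within `[a, b], continuous (fun t => `|g t|)}.
  apply: continuous_subspaceT => t; apply: cvg_norm; exact: cg.
have [c cab Mc] := EVT_max ab cn; exists `|g c| => // t at_ tb.
by apply: Mc; rewrite in_itv /= at_.
Qed.

Lemma integrable_continuous_itv (g : R -> R) a b : continuous g ->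
  mu.-integrable `[a, b] (EFin \o g).
Proof.
move=> cg; apply: continuous_compact_integrable; first exact: segment_compact.
exact: continuous_subspaceT.
Qed.

Lemma finite_measure_integrable (nu : {finite_measure set T -> \bar R})
    (g : R -> R) s t : continuous g -> nu.-integrable `]s, t] (EFin \o g).
Proof.
move=> cg; have [st|ts] := leP s t; last first.
  rewrite set_itv_ge; last by rewrite bnd_simp -leNgt ltW.
  exact: integrable_set0.
have [M M0 gM] := continuous_bounded_itv st cg.
apply: measurable_bounded_integrable.
- exact: measurable_itv.
- rewrite -ge0_fin_numE ?measure_ge0//; apply: fin_num_measure; exact: measurable_itv.
- by have : measurable_fun setT g := continuous_measurable_fun cg; exact: measurable_funS.
- exists M; split; first exact: num_real.
  move=> N MN x /=; rewrite in_itv /= => /andP[sx xt].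
  by apply: le_trans (ltW MN); apply: gM => //; exact: ltW.
Qed.

(** The defect [D] of the formula is additive over adjacent intervals and at most
    [2 * M * (t - s) * (A t - A s)], so that it vanishes by [additive_second_order]. *)
Lemma stieltjes_parts (nu : {finite_measure set T -> \bar R}) (A k k' : R -> R) a b :
  a <= b -> nondecreasing A -> continuous A ->
  (forall s t, a <= s -> s <= t -> t <= b -> nu `]s, t]%classic = (A t - A s)%:E) ->
  continuous k' -> (forall t : R, is_derive t 1 k (k' t)) ->
  \int[nu]_(t in `]a, b]) k t =
  k b * A b - k a * A a - \int[mu]_(t in `[a, b]) (k' t * A t).
Proof.
move=> ab ndA cA nuA ck' dk.
have ck : continuous k.
  by move=> t; have [dt _] := dk t; exact/differentiable_continuous/derivable1_diffP.
have [M M0 kM] := continuous_bounded_itv ab ck'.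
have ik s t : nu.-integrable `]s, t] (EFin \o k) by exact: finite_measure_integrable.
have ckA : continuous (fun t => k' t * A t) by move=> t; apply: cvgM; [exact: ck'|exact: cA].
have ikA s t : mu.-integrable `[s, t] (EFin \o (fun t => k' t * A t)).
  exact: integrable_continuous_itv.
have ik' s t : mu.-integrable `[s, t] (EFin \o k') by exact: integrable_continuous_itv.
pose D s t := \int[nu]_(x in `]s, t]) k x - (k t * A t - k s * A s) +
  \int[mu]_(x in `[s, t]) (k' x * A x).
have FTC s t : s <= t -> \int[mu]_(x in `[s, t]) k' x = k t - k s.
  by move=> st; apply: Rintegral_FTC => // x _; exact: ck'.
have kle s t u : a <= s -> s <= u -> u <= t -> t <= b -> `|k u - k t| <= M * (t - s).
  move=> as_ su ut tb; rewrite distrC -FTC//.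
  apply: le_trans (le_normr_Rintegral _ (ik' _ _)) _; first exact: measurable_itv.
  apply: (@le_trans _ _ (\int[mu]_(x in `[u, t]) M)).
    apply: le_Rintegral => //; [exact: integrable_normr|exact: integrable_cst_itv|].
    move=> x /=; rewrite in_itv /= => /andP[ux xt].
    by apply: kM; [exact: le_trans as_ (le_trans su ux)|exact: le_trans tb].
  by rewrite Rintegral_cst_itv// ler_wpM2l// lerD2l lerN2.
suff : ((D a b)%:C = 0 :> C).
  by case=> /eqP; rewrite /D addrAC subr_eq0 => /eqP <-; rewrite addrK.
apply: (@additive_second_order _ (fun s t => (D s t)%:C) A (2 * M)) => //.
  move=> s t u as_ st tu ub; rewrite -rmorphD /=; congr (_%:C).
  rewrite /D (Rintegral_itv_split st tu)//.
  have -> : `]s, u]%classic = `]s, t]%classic `|` `]t, u]%classic.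
    by rewrite -itv_bndbnd_setU ?bnd_simp.
  rewrite Rintegral_setU//.
  - by ring.
  - by rewrite -itv_bndbnd_setU ?bnd_simp.
  - apply/disj_setPLR => x /=; rewrite !in_itv /= => /andP[_ xt] /andP[tx _].
    by rewrite ltNge xt in tx.
move=> s t as_ st tb; rewrite cabs_real.
have nuE : fine (nu `]s, t]%classic) = A t - A s by rewrite nuA.
(* Subtracting the constants [k t] and [A s] from the two integrands changes the sum by exactly the
   boundary terms, and leaves two small integrands. *)
have -> : D s t = \int[nu]_(x in `]s, t]) (k x - k t) +
    \int[mu]_(x in `[s, t]) (k' x * A x - A s * k' x).
  rewrite (@RintegralB _ _ _ nu _ k (fun _ => k t))//; last first.
    by apply: finite_measure_integrable => x; exact: cvg_cst.
  rewrite (@RintegralB _ _ _ mu _ (fun x => k' x * A x) (fun x => A s * k' x))//; last first.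
    exact: integrable_scale.
  rewrite RintegralZl// FTC//.
  by rewrite Rintegral_cst// nuE /D; ring.
have A0 : 0 <= A t - A s by rewrite subr_ge0 ndA.
have -> : 2 * M * (t - s) * (A t - A s) = M * (t - s) * (A t - A s) + M * (A t - A s) * (t - s).
  by ring.
apply: le_trans (ler_normD _ _) _; apply: lerD.
  have ckt : continuous (fun x => k x - k t) by move=> x; apply: cvgB; [exact: ck|exact: cvg_cst].
  apply: le_trans (le_normr_Rintegral _ _) _ => //.
    exact: finite_measure_integrable.
  rewrite -nuE -(Rintegral_cst nu)//; apply: le_Rintegral => //.
  - by apply: finite_measure_integrable => x; apply: cvg_norm; exact: ckt.
  - by apply: finite_measure_integrable => x; exact: cvg_cst.
  - by move=> x /=; rewrite in_itv /= => /andP[sx xt]; apply: kle => //; exact: ltW.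
have ckA2 : continuous (fun x => k' x * A x - A s * k' x).
  by move=> x; apply: cvgB; [exact: ckA|apply: cvgM; [exact: cvg_cst|exact: ck']].
apply: le_trans (le_normr_Rintegral _ _) _ => //; first exact: integrable_continuous_itv.
rewrite -Rintegral_cst_itv//; apply: le_Rintegral => //.
- by apply: integrable_continuous_itv => x; apply: cvg_norm; exact: ckA2.
- exact: integrable_cst_itv.
- move=> x /=; rewrite in_itv /= => /andP[sx xt].
  rewrite (mulrC (A s)) -mulrBr normrM; apply: ler_pM => //.
    by apply: kM; [exact: le_trans sx|exact: le_trans tb].
  by rewrite ger0_norm ?subr_ge0 ?ndA// lerD2r ndA.
Qed.

(** By Cauchy's theorem the integral along the bottom equals, up to sign, the one along the three
    other sides. *)
Lemma bottom_bound (f : C -> C) x0 x1 y0 y1 (M : R) : x0 <= x1 -> y0 <= y1 ->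
  hol_rect x0 x1 y0 y1 f ->
  (forall z, inrect x0 x1 y0 y1 z ->
    [|| complex.Re z == x0, complex.Re z == x1 | complex.Im z == y1] -> cabs (f z) <= M) ->
  cabs (cint `[x0, x1] (fun t => f (t +i* y0))) <= M * (x1 - x0 + 2 * (y1 - y0)).
Proof.
move=> x01 y01 hf fM; have := goursat_bottom x01 y01 hf; rewrite /rint.
have bf : bcont x0 x1 y0 y1 f by move=> z /inrect_bdry; exact: hf.1.
have [_ f2 f3 f4] := bcont_sides x01 y01 bf.
have /= h2 := cint_bound x01 f2 (fun t h => fM (t +i* y1) (inrect_bdry (bdry_top y01 h)) _).
have /= h3 := cint_bound y01 f3 (fun t h => fM (x0 +i* t) (inrect_bdry (bdry_left x01 h)) _).
have /= h4 := cint_bound y01 f4 (fun t h => fM (x1 +i* t) (inrect_bdry (bdry_right x01 h)) _).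
set c1 := cint _ _; set c2 := cint _ _ in h2 *; set c4 := cint _ _ in h4 *.
set c3 := cint _ _ in h3 * => E.
have -> : c1 = c2 - 'i * (c4 - c3) by apply/eqP; rewrite -subr_eq0 -E; apply/eqP; ring.
apply: le_trans (cabsB _ _) _; rewrite cabsM cabs_i mul1r.
have := cabsB c4 c3.
have := h2 ltac:(by move=> t; rewrite eqxx !orbT).
have := h3 ltac:(by move=> t; rewrite eqxx).
have := h4 ltac:(by move=> t; rewrite eqxx !orbT).
by lra.
Qed.

Definition stieltjes_of (nu : set T -> \bar R) (A : R -> R) a b :=
  [/\ nondecreasing A, continuous A & forall s t, a <= s -> s <= t -> t <= b ->
    nu `]s, t]%classic = (A t - A s)%:E].

Lemma Rintegral_dominated (nu : {finite_measure set T -> \bar R}) (g : nat -> R -> R)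
    (l : R -> R) a b : (forall n, continuous (g n)) ->
  (forall n t, `|g n t| <= 1) -> measurable_fun setT l ->
  (forall t, a < t -> t <= b -> g n t @[n --> \oo] --> l t) ->
  \int[nu]_(t in `]a, b]) g n t @[n --> \oo] --> \int[nu]_(t in `]a, b]) l t.
Proof.
move=> cg g1 ml gl.
have mD : measurable (`]a, b]%classic : set T) by exact: measurable_itv.
have mg n : measurable_fun `]a, b]%classic (fun t => (g n t)%:E).
  apply/measurable_EFinP; apply: (@measurable_funS _ _ _ _ setT) => //.
  exact: continuous_measurable_fun.
have ml' : measurable_fun `]a, b]%classic (fun t => (l t)%:E).
  apply/measurable_EFinP; apply: (@measurable_funS _ _ _ _ setT) => //.
have ff : {ae nu, forall x, `]a, b]%classic x -> (g n x)%:E @[n --> \oo] --> (l x)%:E}.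
  apply: aeW => x /=; rewrite in_itv /= => /andP[ax xb].
  by apply: cvg_EFin; [exact: nearW|exact: gl].
have i1 : nu.-integrable `]a, b]%classic (EFin \o (fun=> 1 : R)).
  by apply: finite_measure_integrable => x; exact: cvg_cst.
have fg : {ae nu, forall x n, `]a, b]%classic x -> (`|(g n x)%:E| <= (EFin \o (fun=> 1%R)) x)%E}.
  by apply: aeW => x n _; rewrite /= lee_fin.
have [il _ cl] := @dominated_convergence _ _ _ nu _ mD
    (fun n x => (g n x)%:E) (fun x => (l x)%:E) _ mg ml' ff i1 fg.
have fl : (\int[nu]_(x in `]a, b]) (l x)%:E)%E \is a fin_num by exact: integrable_fin_num il.
by move: cl; rewrite -[X in _ --> X](fineK fl) => /fine_cvgP[].
Qed.

Lemma compact_away K (x : R) : compact K -> ~ K x ->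
  exists2 d, 0 < d & forall c, K c -> d <= `|x - c|.
Proof.
move=> cK Kx; have /closed_openC oK := compact_closed (@Rhausdorff R) cK.
have [d /= d0 H] : nbhs x (~` K) by exact: open_nbhs_nbhs.
exists d => // c Kc; rewrite leNgt; apply/negP => xc.
exact: (H c xc).
Qed.

Lemma cvg_le_inv (u : nat -> R) (c : R) :
  (forall n, `|u n| <= c / n.+1%:R) -> u n @[n --> \oo] --> 0.
Proof.
move=> uc; apply/cvgrPdist_le => e e0; near=> n.
rewrite sub0r normrN (le_trans (uc n))// ler_pdivrMr//.
rewrite -ler_pdivrMl// mulrC; apply: (@le_trans _ _ n%:R); last by rewrite ler_nat.
by near: n; exact: nbhs_infty_ger.
Unshelve. all: by end_near. Qed.

Lemma ccvg_le_inv (u : nat -> C) (l : C) (c : R) :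
  (forall n, cabs (u n - l) <= c / n.+1%:R) -> ccvg \oo u l.
Proof.
move=> uc e e0; have /cvgrPdist_lt /(_ e e0) : cabs (u n - l) @[n --> \oo] --> 0.
  by apply: (@cvg_le_inv _ c) => n; rewrite ger0_norm ?cabs_ge0.
by apply: filterS => n; rewrite sub0r normrN ger0_norm ?cabs_ge0.
Qed.

(** By Cauchy's theorem the integral of [F * H' n] along the bottom is [O(1 / n)]. After integration
    by parts its real part tends to the increment of [Re F] minus the integral of the indicator of
    the complement of [K]. The measures of [Im F] are paired with [Im (H n)], which tends to 0 at
    every real point because both limit values of [H n] are real. *)
Theorem riesz_compact (F : C -> C) a b (h M : R) (A1 A2 A3 A4 : R -> R)
    (nu1 nu2 nu3 nu4 : {finite_measure set T -> \bar R}) K :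
  a <= b -> 0 < h -> hol_rect a b 0 h F -> (forall z, cabs (F z) <= M) ->
  (forall t, a <= t -> t <= b -> complex.Re (F (t +i* 0)) = A1 t - A2 t) ->
  (forall t, a <= t -> t <= b -> complex.Im (F (t +i* 0)) = A3 t - A4 t) ->
  stieltjes_of nu1 A1 a b -> stieltjes_of nu2 A2 a b ->
  stieltjes_of nu3 A3 a b -> stieltjes_of nu4 A4 a b ->
  compact K -> K `<=` `]a, b[ -> mu K = 0%E -> nu1 K = nu2 K.
Proof.
move=> ab h0 hF FM FR FI S1 S2 S3 S4 cK Kab K0.
have mK : measurable (K : set T) by apply: closed_measurable; exact: compact_closed.
(* Since [K] is compact in the open interval, the three sides off the real line keep a positive
   distance from it; there [H' n] is [O(1 / n)]. *)
have [d d0 dK] : exists2 d : R, 0 < d & forall z, inrect a b 0 h z ->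
    [|| complex.Re z == a, complex.Re z == b | complex.Im z == h] ->
    forall c, K c -> d <= cabs (z - c%:C).
  have [|d1 d10 H1] := @compact_away K a cK.
    by move=> /Kab /=; rewrite in_itv /= ltxx.
  have [|d2 d20 H2] := @compact_away K b cK.
    by move=> /Kab /=; rewrite in_itv /= ltxx andbF.
  exists (Num.min h (Num.min d1 d2)); first by rewrite !lt_min h0 d10.
  move=> z zr /or3P[] /eqP zE c Kc; rewrite !ge_min; apply/orP.
  - right; apply/orP; left; apply: le_trans (H1 c Kc) _; rewrite -zE.
    by have := cabs_ler_Re (z - c%:C); rewrite ReD ReN.
  - right; apply/orP; right; apply: le_trans (H2 c Kc) _; rewrite -zE.
    by have := cabs_ler_Re (z - c%:C); rewrite ReD ReN.
  - left; rewrite -zE; have := cabs_ler_Im (z - c%:C); rewrite ImD ImN /= subr0.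
    exact/le_trans/ler_norm.
have [s [s0 sK s1 s'1]] := peak_sequence cK K0.
pose H n z := peak (s n) n.+1%:R z; pose H' n z := peak' (s n) n.+1%:R z.
pose HR n t := complex.Re (H n (t +i* 0)); pose HI n t := complex.Im (H n (t +i* 0)).
pose HR' n t := complex.Re (H' n (t +i* 0)); pose HI' n t := complex.Im (H' n (t +i* 0)).
have n0 (n : nat) : 0 <= n.+1%:R :> R by [].
have dH n z : 0 <= complex.Im z -> cdiff (H n) z (H' n z).
  by move=> z0; exact: cdiff_peak.
have dH' n z : 0 <= complex.Im z -> cdiffable (H' n) z.
  by move=> z0; exact: cdiff_peak'.
have cH' n (t : R) : pcont (fun t => H' n (t +i* 0)) t.
  have t0 : 0 <= complex.Im (t +i* 0) by [].
  by apply: pcont_hline; have [l /cdiff_cont] := dH' n _ t0.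
have cH n (t : R) : pcont (fun t => H n (t +i* 0)) t.
  by apply: pcont_hline; apply: cdiff_cont; apply: dH => /=.
have cHR n : continuous (HR n) by move=> t; have /ccvgP[] := cH n t.
have cHI n : continuous (HI n) by move=> t; have /ccvgP[] := cH n t.
have cHR' n : continuous (HR' n) by move=> t; have /ccvgP[] := cH' n t.
have cHI' n : continuous (HI' n) by move=> t; have /ccvgP[] := cH' n t.
have rH n (t : R) : rdiff (fun t => H n (t +i* 0)) t (H' n (t +i* 0)).
  by apply: rdiff_hline; apply: dH => /=.
have H1 n z : 0 <= complex.Im z -> cabs (H n z) <= 1 by move=> z0; exact: peak_le1.
pose B n := cint `[a, b] (fun t => F (t +i* 0) * H' n (t +i* 0)).
have M0 : 0 <= M by apply: le_trans (FM 0); exact: cabs_ge0.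
have B0 : complex.Re (B n) @[n --> \oo] --> 0.
  apply: (@cvg_le_inv _ (M * (4 / d ^+ 2) * (b - a + 2 * (h - 0)))) => n.
  apply: le_trans (cabs_ler_Re _) _; rewrite mulrAC.
  apply: (bottom_bound (f := fun z => F z * H' n z)) => //; first exact: ltW.
    have Im0 z : inrect a b 0 h z -> 0 <= complex.Im z by move=> /andP[_ /andP[]].
    split.
      move=> z zr; apply: ccvgM; first exact: hF.1.
      by have [l /cdiff_cont] := dH' n z (Im0 z zr).
    move=> z zr z0; have [l dF] := hF.2 z zr z0; have [l' dl'] := dH' n z (ltW z0).
    by eexists; exact: (cdiffM dF dl').
  move=> z zr zs; rewrite cabsM -mulrA; apply: ler_pM; rewrite ?cabs_ge0//.
  by apply: s'1 => //; [move: zr => /andP[_ /andP[]]|exact: dK].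
pose l : R -> R := \1_(~` K).
pose E n := HR n b * (A1 b - A2 b) - HR n a * (A1 a - A2 a)
  - (HI n b * (A3 b - A4 b) - HI n a * (A3 a - A4 a))
  - (\int[nu1]_(t in `]a, b]) HR n t - \int[nu2]_(t in `]a, b]) HR n t
     - (\int[nu3]_(t in `]a, b]) HI n t - \int[nu4]_(t in `]a, b]) HI n t)).
have BE n : complex.Re (B n) = E n.
  have -> : complex.Re (B n) = \int[mu]_(t in `[a, b]) (HR' n t * A1 t - HR' n t * A2 t
      - (HI' n t * A3 t - HI' n t * A4 t)).
    apply: eq_Rintegral => t; rewrite inE /= in_itv /= => /andP[at_ tb].
    rewrite ReM FR// FI// /HR' /HI'; ring.
  have iM (k A : R -> R) : continuous k -> continuous A ->
      mu.-integrable `[a, b] (EFin \o (fun t => k t * A t)).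
    by move=> ck cA; apply: integrable_continuous_itv => t; apply: cvgM; [exact: ck|exact: cA].
  have [nA1 cA1 dA1] := S1; have [nA2 cA2 dA2] := S2.
  have [nA3 cA3 dA3] := S3; have [nA4 cA4 dA4] := S4.
  have dR (t : R) : is_derive t 1 (HR n) (HR' n t) by exact: (rH n t).1.
  have dI (t : R) : is_derive t 1 (HI n) (HI' n t) by exact: (rH n t).2.
  rewrite RintegralB//; [|apply: integrable_sub => //; exact: iM..].
  rewrite RintegralB//; [|exact: iM..].
  rewrite [X in _ - X]RintegralB//; [|exact: iM..].
  have := stieltjes_parts ab nA1 cA1 dA1 (cHR' n) dR.
  have := stieltjes_parts ab nA2 cA2 dA2 (cHR' n) dR.
  have := stieltjes_parts ab nA3 cA3 dA3 (cHI' n) dI.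
  have := stieltjes_parts ab nA4 cA4 dA4 (cHI' n) dI.
  rewrite /E => -> -> -> ->; ring.
have lim1 (t : R) : ~ K t -> ccvg \oo (fun n => H n (t +i* 0)) 1.
  move=> Kt; have [e e0 eK] := compact_away cK Kt.
  apply: (@ccvg_le_inv _ _ (2 / e)) => n; apply: s1 => // c Kc.
  apply: le_trans (eK c Kc) _.
  by have := cabs_ler_Re ((t +i* 0) - c%:C); rewrite ReD ReN.
have lim0 t : K t -> ccvg \oo (fun n => H n (t +i* 0)) 0.
  move=> Kt; apply: (@ccvg_le_inv _ _ 2) => n; rewrite subr0; exact: sK.
have limR (nu : {finite_measure set T -> \bar R}) :
    \int[nu]_(t in `]a, b]) HR n t @[n --> \oo] --> \int[nu]_(t in `]a, b]) l t.
  apply: Rintegral_dominated => //.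
  - by move=> n t; apply: le_trans (cabs_ler_Re _) _; apply: H1 => /=.
  - by apply: measurable_indic; exact: measurableC.
  - move=> t _ _; rewrite /l indicE; case: (pselect (K t)) => Kt.
      by rewrite memNset//; have /ccvgP[] := lim0 t Kt.
    by rewrite mem_set//; have /ccvgP[] := lim1 t Kt.
have limI (nu : {finite_measure set T -> \bar R}) :
    \int[nu]_(t in `]a, b]) HI n t @[n --> \oo] --> (0 : R).
  have -> : 0 = \int[nu]_(t in `]a, b]) (0 : R) by rewrite Rintegral_cst ?mul0r.
  apply: Rintegral_dominated => //.
  - by move=> n t; apply: le_trans (cabs_ler_Im _) _; apply: H1 => /=.
  - move=> t _ _; case: (pselect (K t)) => Kt.
      by have /ccvgP[] := lim0 t Kt.
    by have /ccvgP[] := lim1 t Kt.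
have EL : E n @[n --> \oo] --> (A1 b - A2 b) - (A1 a - A2 a) -
    (\int[nu1]_(t in `]a, b]) l t - \int[nu2]_(t in `]a, b]) l t).
  have La : ~ K a by move=> /Kab /=; rewrite in_itv /= ltxx.
  have Lb : ~ K b by move=> /Kab /=; rewrite in_itv /= ltxx andbF.
  have [/ccvgP[aR aI] /ccvgP[bR bI]] := (lim1 a La, lim1 b Lb).
  have -> : A1 b - A2 b - (A1 a - A2 a) -
     (\int[nu1]_(t in `]a, b]) l t - \int[nu2]_(t in `]a, b]) l t) =
     1 * (A1 b - A2 b) - 1 * (A1 a - A2 a) - (0 * (A3 b - A4 b) - 0 * (A3 a - A4 a)) -
     (\int[nu1]_(t in `]a, b]) l t - \int[nu2]_(t in `]a, b]) l t - (0 - 0)) by ring.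
  apply: cvgB; first apply: cvgB.
  - by apply: cvgB; apply: cvgM => //; exact: cvg_cst.
  - by apply: cvgB; apply: cvgM => //; exact: cvg_cst.
  - by apply: cvgB; apply: cvgB; [exact: limR|exact: limR|exact: limI|exact: limI].
have lE (nu : {finite_measure set T -> \bar R}) A : stieltjes_of nu A a b ->
    \int[nu]_(t in `]a, b]) l t = A b - A a - fine (nu K).
  move=> [_ _ nuA]; have mI : measurable (`]a, b]%classic : set T) by exact: measurable_itv.
  have mCK : measurable (~` K : set T) by exact: measurableC.
  rewrite /Rintegral (integral_indic nu mI mCK).
  have KI : `]a, b] `&` K = K.
    rewrite setIC setIidl// => x /Kab; apply: subset_itv; rewrite bnd_simp//.
  have E1 : nu `]a, b]%classic = (nu (`]a, b] `\` K) + nu K)%E.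
    by rewrite -{2}KI; exact: measureDI.
  have fK : nu K \is a fin_num by exact: fin_num_measure.
  have fD : nu (`]a, b] `\` K) \is a fin_num by apply: fin_num_measure; exact: measurableD.
  move: E1; rewrite (nuA a b)// setIC -setDE => /(congr1 fine).
  by rewrite fineD//= => ->; rewrite addrK.
(* The full increment minus the part off [K] is [nu1 K - nu2 K]. *)
have : (A1 b - A2 b) - (A1 a - A2 a) -
    (\int[nu1]_(t in `]a, b]) l t - \int[nu2]_(t in `]a, b]) l t) = 0.
  apply: (@cvg_unique _ _ (E n @[n --> \oo])) => //.
  by rewrite (_ : E = fun n => complex.Re (B n)) //; apply/funext => n; rewrite BE.
rewrite (lE _ _ S1) (lE _ _ S2) => HE.
by rewrite -(fineK (fin_num_measure nu1 _ mK)) -(fineK (fin_num_measure nu2 _ mK));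
  congr EFin; lra.
Qed.

End Riesz.

(** * Absolute continuity of the boundary values *)

Section Density.
Variable R : realType.
Local Notation C := R[i].
Local Notation mu := (@lebesgue_measure R).
Local Notation T := (measurableTypeR R).
Implicit Types (a b s t u : R) (K : set R).

Lemma polygon_bounded_variation (p : R -> C) (f : R -> R) a b (L : R) :
  (forall x y, `|f x - f y| <= cabs (p x - p y)) ->
  (forall l, sorted <%R l -> {subset l <= `[a, b]} -> polygon_length p l <= L) ->
  bounded_variation a b f.
Proof.
move=> fp pL; exists L => _ [l Hl <-]; have [pl ll] := Hl.
apply: le_trans (pL (a :: l) pl _).
  rewrite /variation /polygon_length big_mkord /=; apply: ler_sum => j _.
  apply: le_trans (fp _ _) _.
  by rewrite [nth b l j](set_nth_default 0)// [nth b (a :: l) j](set_nth_default 0)//= ltnS ltnW.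
move=> x xl; have [j] := elimT (seq.nthP b) xl; rewrite /= ltnS => jl <-.
rewrite in_itv /=; apply/andP; split; last exact: (itv_partition_nth_le jl Hl).
exact: (itv_partition_nth_ge jl Hl).
Qed.

(** Regularity passes from compact to measurable null sets: a closed set inside []a, b[] is compact,
    and it carries all but [e] of [nu1]. The inequality is later used in both directions. *)
Lemma regular_null_le (nu1 nu2 : {finite_measure set T -> \bar R}) a b :
  regular_measure nu1 ->
  (forall K, compact K -> K `<=` `]a, b[ -> mu K = 0%E -> nu1 K = nu2 K) ->
  forall N : set T, measurable N -> N `<=` `]a, b[%classic -> mu N = 0%E ->
  (nu1 N <= nu2 N)%E.
Proof.
move=> r1 H N mN Nab N0; apply/lee_addgt0Pr => e e0.
have [K [U [cK oU KN NU Ke]]] := r1 N mN e e0.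
have mK : measurable (K : set T) by exact: closed_measurable.
have mU : measurable (U : set T) by exact: open_measurable.
have E : nu1 K = nu2 K.
  apply: H.
  - apply: (subclosed_compact cK (@segment_compact _ a b)) => x /KN /Nab.
    by apply: subset_itv; rewrite bnd_simp.
  - by move=> x /KN /Nab.
  - by apply: subset_measure0 N0 => //.
apply: (@le_trans _ _ (nu1 K + nu1 (U `\` K))%E).
  rewrite -measureU//; last 2 first.
    exact: measurableD.
    by rewrite setDE setIC -setIA setICl setI0.
  apply: le_measure; rewrite ?inE//.
    by apply: measurableU => //; exact: measurableD.
  by move=> x /NU Ux; have [Kx|Kx] := pselect (K x); [left|right].
rewrite E; apply: leeD; last exact: ltW.
by apply: le_measure; rewrite ?inE.
Qed.

(** Restricted to the open interval, the charge [nu1 - nu2] vanishes on Lebesgue null sets, and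
    Radon and Nikodym provide [g]. Compact sets inside []a, b[] say nothing about the end points,
    whence the strict inequalities on [s] and [t]. *)
Lemma stieltjes_density (nu1 nu2 : {finite_measure set T -> \bar R}) (A1 A2 : R -> R) a b :
  stieltjes_of nu1 A1 a b -> stieltjes_of nu2 A2 a b ->
  regular_measure nu1 -> regular_measure nu2 ->
  (forall K, compact K -> K `<=` `]a, b[ -> mu K = 0%E -> nu1 K = nu2 K) ->
  exists2 g : R -> R, mu.-integrable setT (EFin \o g) &
    forall s t, a < s -> s <= t -> t < b ->
    A1 t - A2 t - (A1 s - A2 s) = \int[mu]_(x in `[s, t]) g x.
Proof.
move=> [_ _ S1] [_ _ S2] r1 r2 H.
have mD : measurable (`]a, b[%classic : set T) by exact: measurable_itv.
pose k0 : {charge set T -> \bar R} := 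
  cadd (charge_of_finite_measure nu1) (copp (charge_of_finite_measure nu2)).
pose k : {charge set T -> \bar R} := crestr0 k0 mD.
have kE (X : set T) : measurable X -> k X = (nu1 (X `&` `]a, b[%classic) - nu2 (X `&` `]a, b[%classic))%E.
  by move=> mX; rewrite /k /= /crestr0 mem_set.
have kmu : k `<< mu.
  apply/null_content_dominatesP => X mX X0; rewrite kE//.
  have mI : measurable (X `&` `]a, b[%classic : set T) by exact: measurableI.
  have I0 : mu (X `&` `]a, b[%classic) = 0%E by apply: subset_measure0 X0 => //.
  suff -> : nu1 (X `&` `]a, b[%classic) = nu2 (X `&` `]a, b[%classic).
    by rewrite subee//; exact: fin_num_measure.
  apply/eqP; rewrite eq_le; apply/andP; split.
    by apply: (regular_null_le r1 H) => //.
  by apply: (regular_null_le r2 (fun K h1 h2 h3 => esym (H K h1 h2 h3))) => //.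
pose g t := fine (Radon_Nikodym k mu t).
have gE : EFin \o g = Radon_Nikodym k mu.
  by apply/funext => t; rewrite /g /= fineK//; exact: Radon_Nikodym_fin_num.
exists g; first by rewrite gE; exact: Radon_Nikodym_integrable.
move=> s t as_ st tb.
have mI : measurable (`]s, t]%classic : set T) by exact: measurable_itv.
have sub : `]s, t]%classic `&` `]a, b[%classic = `]s, t]%classic.
  by apply/setIidl; apply: subset_itv; rewrite bnd_simp// ltW.
have e1 := S1 s t (ltW as_) st (ltW tb); have e2 := S2 s t (ltW as_) st (ltW tb).
have kst : k `]s, t]%classic = ((A1 t - A1 s)%:E - (A2 t - A2 s)%:E)%E.
  by rewrite (kE _ mI) sub e1 e2.
have := Radon_Nikodym_integral kmu mI.
rewrite kst -gE => E.
rewrite -[RHS]Rintegral_itv_obnd_cbnd; last first.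
  apply: (@integrableS _ _ _ _ setT) => //.
  by rewrite gE; exact: Radon_Nikodym_integrable.
rewrite /Rintegral -E /=; ring.
Qed.

Theorem riesz_density (F : C -> C) a b (h M L : R) :
  a < b -> 0 < h -> hol_rect a b 0 h F -> (forall z, cabs (F z) <= M) ->
  (forall t : R, ccont F (t +i* 0)) ->
  (forall l, sorted <%R l -> {subset l <= `[a, b]} ->
     polygon_length (fun t => F (t +i* 0)) l <= L) ->
  exists2 q : R -> C, cintegrable setT q &
    forall s t, a < s -> s <= t -> t < b ->
    F (t +i* 0) - F (s +i* 0) = cint `[s, t] q.
Proof.
move=> ab h0 hF FM cF FL.
have cR : continuous (fun t : R => complex.Re (F (t +i* 0))).
  by move=> t; have /ccvgP[] := pcont_hline (cF t).
have cI : continuous (fun t : R => complex.Im (F (t +i* 0))).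
  by move=> t; have /ccvgP[] := pcont_hline (cF t).
have bR : bounded_variation a b (fun t : R => complex.Re (F (t +i* 0))).
  by apply: polygon_bounded_variation FL => x y; rewrite -ReN -ReD cabs_ler_Re.
have bI : bounded_variation a b (fun t : R => complex.Im (F (t +i* 0))).
  by apply: polygon_bounded_variation FL => x y; rewrite -ImN -ImD cabs_ler_Im.
have [A1 [A2 [n1 c1 n2 c2 E12]]] := bounded_variation_decomp ab cR bR.
have [A3 [A4 [n3 c3 n4 c4 E34]]] := bounded_variation_decomp ab cI bI.
have [nu1 [S1 [_ r1]]] := stieltjes_measure_exists (ltW ab) n1 c1.
have [nu2 [S2 [_ r2]]] := stieltjes_measure_exists (ltW ab) n2 c2.
have [nu3 [S3 [_ r3]]] := stieltjes_measure_exists (ltW ab) n3 c3.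
have [nu4 [S4 [_ r4]]] := stieltjes_measure_exists (ltW ab) n4 c4.
have T1 : stieltjes_of nu1 A1 a b by [].
have T2 : stieltjes_of nu2 A2 a b by [].
have T3 : stieltjes_of nu3 A3 a b by [].
have T4 : stieltjes_of nu4 A4 a b by [].
have H12 K : compact K -> K `<=` `]a, b[ -> mu K = 0%E -> nu1 K = nu2 K.
  exact: (riesz_compact (ltW ab) h0 hF FM E12 E34 T1 T2 T3 T4).
have [g gi gE] := stieltjes_density T1 T2 r1 r2 H12.
(* Multiplication by [-i] turns [Im F] into the real part and [- Re F] into the imaginary part, so
   the theorem for real parts also treats [nu3] and [nu4]. *)
have hF' : hol_rect a b 0 h (fun z => - 'i * F z).
  split=> [z zr|z zr z0]; first by apply: ccvgM; [exact: ccvg_cst|exact: hF.1].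
  have [l dl] := hF.2 z zr z0; eexists; exact: (cdiffM (cdiff_cst _ _) dl).
have FM' z : cabs (- 'i * F z) <= M by rewrite cabsM cabsN cabs_i mul1r.
have E12' t : a <= t -> t <= b -> complex.Re (- 'i * F (t +i* 0)) = A3 t - A4 t.
  by move=> h1 h2; rewrite -E34// ReM /=; ring.
have E34' t : a <= t -> t <= b -> complex.Im (- 'i * F (t +i* 0)) = A2 t - A1 t.
  by move=> h1 h2; rewrite -opprB -E12// ImM /=; ring.
have H34 K : compact K -> K `<=` `]a, b[ -> mu K = 0%E -> nu3 K = nu4 K.
  exact: (riesz_compact (ltW ab) h0 hF' FM' E12' E34' T3 T4 T2 T1).
have [g' gi' gE'] := stieltjes_density T3 T4 r3 r4 H34.
exists (fun t => g t +i* g' t) => // s t as_ st tb.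
have bds u : s <= u -> u <= t -> a <= u /\ u <= b.
  by move=> su ut; split; apply/ltW; [exact: lt_le_trans su|exact: le_lt_trans tb].
have [? ?] := bds _ (lexx s) st; have [? ?] := bds _ st (lexx t).
apply: complex_ext; rewrite ?ReD ?ReN ?ImD ?ImN.
  by rewrite E12// E12// gE.
by rewrite E34// E34// gE'.
Qed.

End Density.

(** * Estimates for the derivative and the local Poisson representation *)

Section Representation.
Variable R : realType.
Local Notation C := R[i].
Local Notation mu := (@lebesgue_measure R).
Implicit Types (a b : R) (z w : C).

Lemma pcont_bounded (k : R -> C) a b : a <= b -> (forall t, a <= t <= b -> pcont k t) ->
  exists2 m : R, 0 <= m & forall t, a <= t <= b -> cabs (k t) <= m.
Proof.
move=> ab ck; have cn : {within `[a, b], continuous (fun t => cabs (k t))}.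
  apply: continuous_in_subspaceT => t; rewrite inE /= in_itv /= => tab.
  exact: (ccvg_cabs (ck t tab)).
have [c cab Mc] := EVT_max ab cn; exists (cabs (k c)); first exact: cabs_ge0.
by move=> t tab; apply: Mc; rewrite in_itv.
Qed.

Lemma cintegrable_mul_cont (q k : R -> C) a b : a <= b -> cintegrable `[a, b] q ->
  (forall t, a <= t <= b -> pcont k t) -> cintegrable `[a, b] (fun t => q t * k t).
Proof.
move=> ab iq ck; have [m m0 km] := pcont_bounded ab ck.
have [kR kI] := cintegrable_measurable (cintegrable_cont ck).
have [qR qI] := cintegrable_measurable iq.
have mI : measurable (`[a, b]%classic : set R) by exact: measurable_itv.
apply: (@cintegrable_le _ _ _ (fun t => m * cabs (q t))) => //.
- rewrite (_ : (fun t => _) = fun t => complex.Re (q t) * complex.Re (k t) -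
      complex.Im (q t) * complex.Im (k t)); last by apply/funext => t; rewrite ReM.
  by apply: measurable_funB; exact: measurable_funM.
- rewrite (_ : (fun t => _) = fun t => complex.Re (q t) * complex.Im (k t) +
      complex.Im (q t) * complex.Re (k t)); last by apply/funext => t; rewrite ImM.
  by apply: measurable_funD; exact: measurable_funM.
- by apply: integrable_scale => //; exact: integrable_cabs.
- move=> t /=; rewrite in_itv /= => tab; rewrite cabsM mulrC.
  by apply: ler_wpM2r; [exact: cabs_ge0|exact: km].
Qed.

(** The defect argument of [stieltjes_parts] again, with the integral of [|q|] up to [t] as the
    monotone function [V]. *)
Lemma density_parts (p q k k' : R -> C) a b : a <= b -> has_density p q a b ->
  (forall t, a <= t <= b -> pcont p t) ->
  (forall t, a <= t <= b -> pcont k' t) -> (forall t, a <= t <= b -> rdiff k t (k' t)) ->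
  cint `[a, b] (fun t => p t * k' t) =
  p b * k b - p a * k a - cint `[a, b] (fun t => q t * k t).
Proof.
move=> ab [iq pq] cp ck' dk.
have ck t : a <= t <= b -> pcont k t by move=> tab; exact: rdiff_cont (dk t tab).
have [m m0 km] := pcont_bounded ab ck'.
have itvS s t : a <= s -> t <= b -> `[s, t]%classic `<=` `[a, b].
  by move=> as_ tb; apply: subset_itv; rewrite bnd_simp.
have iqS s t : a <= s -> t <= b -> cintegrable `[s, t] q.
  by move=> as_ tb; apply: cintegrableS iq => //; exact: itvS.
have iqk s t : a <= s -> s <= t -> t <= b -> cintegrable `[s, t] (fun t => q t * k t).
  move=> as_ st tb; apply: cintegrable_mul_cont => //; first exact: iqS.
  move=> u /andP[su ut]; apply: ck; apply/andP; split; [exact: le_trans su|exact: le_trans tb].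
have ipk s t : a <= s -> t <= b -> cintegrable `[s, t] (fun t => p t * k' t).
  move=> as_ tb; apply: cintegrable_cont => u /andP[su ut].
  have uab : a <= u <= b by apply/andP; split; [exact: le_trans su|exact: le_trans tb].
  by apply: ccvgM; [exact: cp|exact: ck'].
have ik s t : a <= s -> t <= b -> cintegrable `[s, t] k'.
  move=> as_ tb; apply: cintegrable_cont => u /andP[su ut]; apply: ck'.
  by apply/andP; split; [exact: le_trans su|exact: le_trans tb].
have kFTC s t : a <= s -> s <= t -> t <= b -> cint `[s, t] k' = k t - k s.
  move=> as_ st tb; apply: cint_FTC => // u /andP[su ut]; [apply: ck'|apply: dk];
  by apply/andP; split; [exact: le_trans su|exact: le_trans tb].
have ic := integrable_cabs (measurable_itv `[a, b]) iq.
pose V t := \int[mu]_(u in `[a, t]) cabs (q u).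
have VE s t : a <= s -> s <= t -> t <= b -> \int[mu]_(u in `[s, t]) cabs (q u) = V t - V s.
  by move=> as_ st tb; apply: Rintegral_itv_ge0_le ic.
pose D s t := cint `[s, t] (fun u => q u * k u) - (p t * k t - p s * k s) +
  cint `[s, t] (fun u => p u * k' u).
suff : D a b = 0 by rewrite /D => /eqP; rewrite addr_eq0 => /eqP E;
  rewrite -[LHS]opprK -E; ring.
apply: (@additive_second_order _ D V (2 * m)) => //.
  move=> s t u as_ st tu ub; rewrite /D.
  rewrite (cint_split st tu (iqk _ _ as_ (le_trans st tu) ub)).
  by rewrite (cint_split st tu (ipk _ _ as_ ub)); ring.
move=> s t as_ st tb.
have -> : D s t = cint `[s, t] (fun u => q u * k u - k t * q u) +
    cint `[s, t] (fun u => p u * k' u - p s * k' u).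
  rewrite cintB//; [|exact: iqk|by apply: cintegrableZ => //; exact: iqS].
  rewrite cintB//; [|exact: ipk|by apply: cintegrableZ => //; exact: ik].
  rewrite !cintZ//; [|exact: ik|exact: iqS].
  by rewrite kFTC// -pq// /D; ring.
have -> : 2 * m * (t - s) * (V t - V s) = m * (t - s) * (V t - V s) + (V t - V s) * m * (t - s).
  by ring.
apply: le_trans (cabsD _ _) _; apply: lerD.
  rewrite -VE// -RintegralZl//; last first.
    exact: (integrable_cabs (measurable_itv `[s, t]) (iqS _ _ as_ tb)).
  apply: cint_le => //.
  - by apply: cintegrableB => //; [exact: iqk|apply: cintegrableZ => //; exact: iqS].
  - apply: integrable_scale => //.
    exact: (integrable_cabs (measurable_itv `[s, t]) (iqS _ _ as_ tb)).
  - move=> u /=; rewrite in_itv /= => /andP[su ut].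
    have -> : q u * k u - k t * q u = (k u - k t) * q u by ring.
    rewrite cabsM; apply: ler_wpM2r; first exact: cabs_ge0.
    rewrite cabs_distC -kFTC//; [|exact: le_trans su].
    apply: le_trans (cint_bound (M := m) ut _ _) _.
    + by apply: ik => //; exact: le_trans su.
    + move=> x /andP[ux xt]; apply: km; apply/andP; split; last exact: le_trans tb.
      exact: le_trans as_ (le_trans su ux).
    + by rewrite ler_wpM2l// lerD2l lerN2.
apply: cint_bound => //.
  by apply: cintegrableB => //; [exact: ipk|apply: cintegrableZ => //; exact: ik].
move=> u /andP[su ut]; rewrite -mulrBl cabsM; apply: ler_pM; rewrite ?cabs_ge0//; last first.
  by apply: km; apply/andP; split; [exact: le_trans su|exact: le_trans tb].
rewrite pq//; last exact: le_trans tb.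
apply: le_trans (cabs_cint _ (iqS _ _ as_ (le_trans ut tb))) _ => //.
rewrite VE//; last exact: le_trans tb.
rewrite lerD2r -subr_ge0 -VE//; last exact: le_trans su.
by apply: Rintegral_ge0 => x _; exact: cabs_ge0.
Qed.

Lemma inv_sqr_diff z w w' (e : R) : 0 < e -> e <= cabs (z - w) -> e <= cabs (z - w') ->
  cabs ((z - w') ^- 2 - (z - w) ^- 2) <= 2 / e ^+ 3 * cabs (w' - w).
Proof.
move=> e0 h1 h2; have z1 : z - w != 0 by rewrite -cabs_gt0; exact: lt_le_trans h1.
have z2 : z - w' != 0 by rewrite -cabs_gt0; exact: lt_le_trans h2.
have -> : (z - w') ^- 2 - (z - w) ^- 2 =
    ((z - w)^-1 * (z - w')^-1 ^+ 2 + (z - w)^-1 ^+ 2 * (z - w')^-1) * (w' - w).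
  by field; rewrite z1 z2.
rewrite cabsM; apply: ler_wpM2r; first exact: cabs_ge0.
have i1 : cabs (z - w)^-1 <= e^-1 by rewrite cabsV lef_pV2 ?posrE//; exact: lt_le_trans h1.
have i2 : cabs (z - w')^-1 <= e^-1 by rewrite cabsV lef_pV2 ?posrE//; exact: lt_le_trans h2.
have -> : 2 / e ^+ 3 = e^-1 * e^-1 ^+ 2 + e^-1 ^+ 2 * e^-1 by field; rewrite gt_eqF.
apply: le_trans (cabsD _ _) _; rewrite !expr2 !cabsM.
by apply: lerD; rewrite !ler_pM// ?mulr_ge0 ?cabs_ge0.
Qed.

Definition hol_square w (d : R) (f : C -> C) := forall z,
  inrect (complex.Re w - d) (complex.Re w + d) (complex.Im w - d) (complex.Im w + d) z ->
  cdiffable f z.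

Lemma hol_square_rect w (d : R) f : hol_square w d f ->
  hol_rect (complex.Re w - d) (complex.Re w + d) (complex.Im w - d) (complex.Im w + d) f.
Proof. by move=> hf; split=> [z /hf[l /cdiff_cont]//|z /hf]. Qed.

Lemma square_bdry_dist w z (d : R) : 0 <= d ->
  bdry (complex.Re w - d) (complex.Re w + d) (complex.Im w - d) (complex.Im w + d) z ->
  d <= cabs (z - w).
Proof.
move=> d0 /andP[_] /or4P[] /eqP zE.
- apply: le_trans (cabs_ler_Re _); rewrite ReD ReN zE addrAC subrr sub0r normrN.
  exact: ler_norm.
- apply: le_trans (cabs_ler_Re _); rewrite ReD ReN zE addrAC subrr add0r.
  exact: ler_norm.
- apply: le_trans (cabs_ler_Im _); rewrite ImD ImN zE addrAC subrr sub0r normrN.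
  exact: ler_norm.
- apply: le_trans (cabs_ler_Im _); rewrite ImD ImN zE addrAC subrr add0r.
  exact: ler_norm.
Qed.

Lemma ccont_inv_sqr w z : z != w -> ccont (fun t => (t - w) ^- 2) z.
Proof.
move=> zw; rewrite (_ : (fun t => _) = fun t => (t - w)^-1 ^+ 2).
  by apply: ccvgX; exact: ccont_invr.
by apply/funext => t; rewrite exprVn.
Qed.

Lemma cabs_2pii : cabs ((2 * pi)%:C * 'i : C) = 2 * pi.
Proof. by rewrite cabsM cabs_i mulr1 cabs_real ger0_norm// mulr_ge0// pi_ge0. Qed.

(** The perimeter [8 * d] times [M / d ^+ 2] is [8 * M / d], and the factor [2 * pi] on the other
    side is at least 4. *)
Lemma cauchy_estimate w l (d M : R) f : 0 < d -> hol_square w d f ->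
  (forall z, inrect (complex.Re w - d) (complex.Re w + d) (complex.Im w - d)
    (complex.Im w + d) z -> cabs (f z) <= M) ->
  cdiff f w l -> cabs l <= 2 * M / d.
Proof.
move=> d0 hf fM dl.
have xd : complex.Re w - d < complex.Re w < complex.Re w + d by rewrite ltrDl gtrBl d0.
have yd : complex.Im w - d < complex.Im w < complex.Im w + d by rewrite ltrDl gtrBl d0.
have := cauchy_derivative (hol_square_rect hf) xd yd dl => /(congr1 (@cabs R)).
rewrite cabsM cabs_2pii => E.
have : 2 * pi * cabs l <= 2 * (M / d ^+ 2) * (2 * d + 2 * d).
  rewrite -E; apply: le_trans (rint_bound (M := M / d ^+ 2) _ _ _ _) _.
  - by rewrite ltW//; lra.
  - by rewrite ltW//; lra.
  - move=> z zb; apply: ccvgM; first by have [? /cdiff_cont] := hf z (inrect_bdry zb).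
    by apply: ccont_inv_sqr; exact: square_bdry_neq zb.
  - move=> z zb; rewrite cabsM; apply: ler_pM; rewrite ?cabs_ge0//.
      exact: fM (inrect_bdry zb).
    rewrite cabsV cabsX lef_pV2 ?posrE ?exprn_gt0//.
      by rewrite ler_sqr ?nnegrE ?cabs_ge0 ?(ltW d0)//; exact: square_bdry_dist (ltW d0) zb.
    by apply: (lt_le_trans d0); exact: square_bdry_dist (ltW d0) zb.
  - by rewrite le_eqVlt; apply/orP; left; apply/eqP; ring.
have -> : 2 * (M / d ^+ 2) * (2 * d + 2 * d) = 4 * (2 * M / d) by field; rewrite gt_eqF.
have l0 := cabs_ge0 l; have p2 := pi_ge2 R => H.
have : 4 * cabs l <= 4 * (2 * M / d).
  by apply: le_trans H; apply: ler_wpM2r => //; lra.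
by rewrite ler_pM2l.
Qed.

(** Both points stay at distance at least [d / 2] from the boundary of the square, so [inv_sqr_diff]
    gives [8 * d * M * 2 / (d / 2) ^+ 3]; division by 4, a lower bound of [2 * pi], leaves
    [32 * M / d ^+ 2]. *)
Lemma derivative_lipschitz w w' l l' (d M : R) f : 0 < d -> hol_square w d f ->
  (forall z, inrect (complex.Re w - d) (complex.Re w + d) (complex.Im w - d)
    (complex.Im w + d) z -> cabs (f z) <= M) ->
  cdiff f w l -> cdiff f w' l' -> cabs (w' - w) <= d / 2 ->
  cabs (l' - l) <= 32 * M / d ^+ 2 * cabs (w' - w).
Proof.
move=> d0 hf fM dl dl' ww'.
have xd : complex.Re w - d < complex.Re w < complex.Re w + d by rewrite ltrDl gtrBl d0.
have yd : complex.Im w - d < complex.Im w < complex.Im w + d by rewrite ltrDl gtrBl d0.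
have := cabs_ler_Re (w' - w); have := cabs_ler_Im (w' - w).
rewrite ReD ReN ImD ImN !ler_norml => /andP[i1 i2] /andP[r1 r2].
have xd' : complex.Re w - d < complex.Re w' < complex.Re w + d by apply/andP; split; lra.
have yd' : complex.Im w - d < complex.Im w' < complex.Im w + d by apply/andP; split; lra.
have hr := hol_square_rect hf.
have far z : bdry (complex.Re w - d) (complex.Re w + d) (complex.Im w - d) (complex.Im w + d) z ->
    d / 2 <= cabs (z - w) /\ d / 2 <= cabs (z - w').
  move=> zb; have h := square_bdry_dist (ltW d0) zb; split; first by lra.
  have : cabs (z - w) <= cabs (z - w') + cabs (w' - w).
    by apply: le_trans (cabsD _ _); rewrite addrA subrK.
  by lra.
have d2 : 0 < d / 2 by rewrite divr_gt0.
have neq z u : d / 2 <= cabs (z - u) -> z != u.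
  by move=> h; rewrite -subr_eq0 -cabs_gt0; exact: lt_le_trans h.
have bc u : (forall z, bdry (complex.Re w - d) (complex.Re w + d) (complex.Im w - d)
    (complex.Im w + d) z -> z != u) -> bcont (complex.Re w - d) (complex.Re w + d) (complex.Im w - d) (complex.Im w + d) (fun z => f z * (z - u) ^- 2).
  move=> zu z zb; apply: ccvgM; first exact: hr.1 (inrect_bdry zb).
  by apply: ccont_inv_sqr; exact: zu.
have b1 := bc w (fun z zb => neq _ _ (far z zb).1).
have b2 := bc w' (fun z zb => neq _ _ (far z zb).2).
have xx : complex.Re w - d <= complex.Re w + d by lra.
have yy : complex.Im w - d <= complex.Im w + d by lra.
have := rintB xx yy b2 b1; rewrite (cauchy_derivative hr xd yd dl) (cauchy_derivative hr xd' yd' dl').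
rewrite -mulrBr => /(congr1 (@cabs R)); rewrite [in RHS]cabsM cabs_2pii => E.
have : 2 * pi * cabs (l' - l) <= 2 * (M * (2 / (d / 2) ^+ 3 * cabs (w' - w))) * (2 * d + 2 * d).
  rewrite -E; apply: le_trans (rint_bound (M := M * (2 / (d / 2) ^+ 3 * cabs (w' - w))) xx yy (bcontB b2 b1) _) _.
    move=> z zb; rewrite -mulrBr cabsM; apply: ler_pM; rewrite ?cabs_ge0//.
      exact: fM (inrect_bdry zb).
    by have [h1 h2] := far z zb; exact: inv_sqr_diff.
  by rewrite le_eqVlt; apply/orP; left; apply/eqP; ring.
have -> : 2 * (M * (2 / (d / 2) ^+ 3 * cabs (w' - w))) * (2 * d + 2 * d) =
    4 * (32 * M / d ^+ 2 * cabs (w' - w)) by field; rewrite gt_eqF.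
have l0 := cabs_ge0 (l' - l); have p2 := pi_ge2 R => H.
have : 4 * cabs (l' - l) <= 4 * (32 * M / d ^+ 2 * cabs (w' - w)).
  by apply: le_trans H; apply: ler_wpM2r => //; lra.
by rewrite ler_pM2l.
Qed.

(** Truncation makes the density integrable on the whole line, where Poisson integrals are taken. *)
Definition cutoff (q : R -> C) a b (t : R) : C := if a <= t <= b then q t else 0.

(* The difference of the Cauchy kernels of [w] and its conjugate has primitive
   [-2i pker] on the real line and is [O(Im w)] away from [w]. *)
Lemma poisson_representation (F : C -> C) (q : R -> C) a b (h M e : R) : a < b -> 0 < h ->
  0 < e -> hol_rect a b 0 h F -> (forall z, cabs (F z) <= M) ->
  (forall t : R, ccont F (t +i* 0)) ->
  has_density (fun t => F (t +i* 0)) q a b ->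
  exists2 k : R, 0 <= k & forall w l, a + e <= complex.Re w -> complex.Re w <= b - e ->
    0 < complex.Im w -> complex.Im w <= h - e -> cdiff F w l ->
    cabs (l - (poisson (fun t => complex.Re (cutoff q a b t)) (complex.Re w) (complex.Im w) +i*
               poisson (fun t => complex.Im (cutoff q a b t)) (complex.Re w) (complex.Im w)))
    <= k * complex.Im w.
Proof.
move=> ab h0 e0 hF FM cF hd.
have M0 : 0 <= M by apply: le_trans (FM 0); exact: cabs_ge0.
(* The first term bounds the two end-point terms of the integration by parts, each at most
   [M * 2 / e ^+ 2] times the height. The second bounds the three sides off the real line, of total
   length [b - a + 2 * h]. *)
pose k := 4 * M / e ^+ 2 + 4 * M / e ^+ 3 * (b - a + 2 * h).
have k0 : 0 <= k.
  have bh : 0 <= b - a + 2 * h by lra.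
  by rewrite /k addr_ge0// !mulr_ge0// ?invr_ge0 ?exprn_ge0// ltW.
exists k => // w l aw wb w0 wh dl.
set y := complex.Im w in w0 wh *; set x := complex.Re w in aw wb *.
pose w' : C := x +i* (- y).
have ww' : w - w' = 2 * 'i * y%:C by rewrite /w' /x /y; case: (w) => u v; apply: complex_ext => /=; ring.
pose kw z := (z - w) ^- 2 - (z - w') ^- 2.
have far z : inrect a b 0 h z -> [|| complex.Re z == a, complex.Re z == b | complex.Im z == h] ->
    e <= cabs (z - w) /\ e <= cabs (z - w').
  move=> _ zs.
  have := cabs_ler_Re (z - w); have := cabs_ler_Im (z - w).
  have := cabs_ler_Re (z - w'); have := cabs_ler_Im (z - w').
  rewrite !ReD !ReN !ImD !ImN /= -/x -/y !ler_norml => /andP[i1 i2] /andP[r1 r2] /andP[i3 i4] /andP[r3 r4].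
  by case/or3P: zs => /eqP zE; rewrite zE in i1 i2 r1 r2 i3 i4 r3 r4; split;
    move: aw wb w0 wh i1 i2 r1 r2 i3 i4 r3 r4; clear; lra.
have upper (z : C) : 0 <= complex.Im z -> z != w'.
  by move=> z0; apply/eqP => zE; move: z0; rewrite zE /= oppr_ge0 leNgt w0.
have xw : a < complex.Re w < b by rewrite -/x; apply/andP; split; lra.
have yw : 0 < complex.Im w < h by rewrite -/y w0 /=; lra.
have E1 := cauchy_derivative hF xw yw dl.
(* The conjugate point [w'] lies below the rectangle, so its kernel can be subtracted without
   changing the integral. *)
have E2 : rint a b 0 h (fun z => F z * (z - w') ^- 2) = 0.
  apply: goursat_bottom; [exact: ltW|exact: ltW|split].
    move=> z zr; apply: ccvgM; first exact: hF.1.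
    by apply: ccont_inv_sqr; apply: upper; case/andP: zr => _ /andP[].
  move=> z zr z0; have [m dm] := hF.2 z zr z0.
  have d2 := cdiffM dm (cdiffX 2 (cdiff_invr (upper z (ltW z0)))); eexists.
  by apply: cdiff_near d2; apply: nearW => t; rewrite exprVn.
have bc1 : bcont a b 0 h (fun z => F z * (z - w) ^- 2).
  move=> z zb; apply: ccvgM; first exact: hF.1 (inrect_bdry zb).
  apply: ccont_inv_sqr; apply/eqP => zE; case/andP: zb => _.
  rewrite zE -/x -/y => /or4P[] /eqP; lra.
have bc2 : bcont a b 0 h (fun z => F z * (z - w') ^- 2).
  move=> z zb; apply: ccvgM; first exact: hF.1 (inrect_bdry zb).
  apply: ccont_inv_sqr; apply: upper.
  by have /andP[_ /andP[]] := inrect_bdry zb.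
have bc : bcont a b 0 h (fun z => F z * kw z).
  by move=> z zb; have := bcontB bc1 bc2 zb; rewrite /ccont; under eq_fun do rewrite -mulrBr; rewrite -mulrBr.
have E3 : rint a b 0 h (fun z => F z * kw z) = (2 * pi)%:C * 'i * l.
  rewrite -E1 -[RHS]subr0 -E2 -rintB ?ltW//; congr rint; apply/funext => z.
  by rewrite -mulrBr.
pose K (t : R) : C := - (2 * 'i * (pker x y t)%:C).
have tw (t : R) : (t +i* 0) != w by apply/eqP => tE; move: w0; rewrite /y -tE /= ltxx.
have tw' (t : R) : (t +i* 0) != w' by exact: upper.
have KE (t : R) : K t = - (((t +i* 0) - w)^-1 - ((t +i* 0) - w')^-1).
  have D0 := pker_den_gt0 x t w0.
  have DE : ((t +i* 0) - w) * ((t +i* 0) - w') = ((t - x) ^+ 2 + y ^+ 2)%:C.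
    by rewrite /w' /x /y; case: (w) => u v; apply: complex_ext => /=; ring.
  have n1 : (t +i* 0) - w != 0 by rewrite subr_eq0.
  have n2 : (t +i* 0) - w' != 0 by rewrite subr_eq0.
  have -> : ((t +i* 0) - w)^-1 - ((t +i* 0) - w')^-1 = (w - w') * (((t +i* 0) - w) * ((t +i* 0) - w'))^-1.
    by field; rewrite n1 n2.
  by rewrite ww' DE /K /pker rmorphM /= fmorphV /=; ring.
have dK (t : R) : rdiff K t (kw (t +i* 0)).
  rewrite (_ : K = fun t : R => - (((t +i* 0) - w)^-1 - ((t +i* 0) - w')^-1)); last exact/funext.
  apply: (@rdiff_hline _ (fun z => - ((z - w)^-1 - (z - w')^-1))).
  have := cdiffN (cdiffB (cdiff_invr (tw t)) (cdiff_invr (tw' t))).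
  by rewrite opprB opprK addrC /kw.
have parts : cint `[a, b] (fun t => F (t +i* 0) * kw (t +i* 0)) =
    F (b +i* 0) * K b - F (a +i* 0) * K a - cint `[a, b] (fun t => q t * K t).
  apply: density_parts => // [|t _|t _].
  - exact: ltW.
  - exact: pcont_hline.
  - by apply: (@pcont_hline _ kw); apply: ccvgB; apply: ccont_inv_sqr.
have main : cint `[a, b] (fun t => q t * K t) = - (2 * 'i * pi%:C *
     (poisson (fun t => complex.Re (cutoff q a b t)) x y +i*
      poisson (fun t => complex.Im (cutoff q a b t)) x y)).
  have mI : measurable (`[a, b]%classic : set R) by exact: measurable_itv.
  have [[iR iI] _] := hd.
  have cut (g : R -> R) : \int[mu]_(t in `[a, b]) (pker x y t * g t) =
      \int[mu]_t (pker x y t * (if a <= t <= b then g t else 0)).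
    rewrite Rintegral_mkcond; apply: eq_Rintegral => t _; rewrite patchE.
    case: ifPn => tab; case: ifPn => // tab'; rewrite ?mulr0//.
      by move: tab; rewrite inE /= in_itv /= (negPf tab').
    by move: tab; rewrite notin_setE /= in_itv /= tab'.
  have PE g : poisson (fun t => if a <= t <= b then g t else 0) x y =
      pi^-1 * \int[mu]_(t in `[a, b]) (pker x y t * g t) by rewrite /poisson cut.
  have -> : (fun t => complex.Re (cutoff q a b t)) = fun t => if a <= t <= b then complex.Re (q t) else 0.
    by apply/funext => t; rewrite /cutoff; case: ifP.
  have -> : (fun t => complex.Im (cutoff q a b t)) = fun t => if a <= t <= b then complex.Im (q t) else 0.
    by apply/funext => t; rewrite /cutoff; case: ifP.
  have pi0 : pi != 0 :> R by rewrite gt_eqF// pi_gt0.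
  rewrite !PE /cint; apply: complex_ext => /=.
    transitivity (2 * \int[mu]_(t in `[a, b]) (pker x y t * complex.Im (q t))).
      rewrite -RintegralZl//; last exact: integrable_pkerM.
      by apply: eq_Rintegral => t _; rewrite /K ReM /=; ring.
    by set I1 := Rintegral _ _ _; set I2 := Rintegral _ _ _; move: (pi : R) pi0 => p p0; field.
  transitivity (- 2 * \int[mu]_(t in `[a, b]) (pker x y t * complex.Re (q t))).
    rewrite -RintegralZl//; last exact: integrable_pkerM.
    by apply: eq_Rintegral => t _; rewrite /K ImM /=; ring.
  by set I1 := Rintegral _ _ _; set I2 := Rintegral _ _ _; move: (pi : R) pi0 => p p0; field.
have [s1 s2 s3 s4] := bcont_sides (ltW ab) (ltW h0) bc.
set P := _ +i* _ in main *.
have sides : cabs ((2 * pi)%:C * 'i * (l - P)) <= M * (4 / e ^+ 2 * y) + M * (4 / e ^+ 3 * y) * (b - a + 2 * h).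
  have -> : (2 * pi)%:C * 'i * (l - P) = (F (b +i* 0) * K b - F (a +i* 0) * K a) -
      (cint `[a, b] (fun t => F (t +i* h) * kw (t +i* h)) -
       'i * (cint `[0, h] (fun s => F (b +i* s) * kw (b +i* s)) -
             cint `[0, h] (fun s => F (a +i* s) * kw (a +i* s)))).
    rewrite mulrBr -E3 /rint parts main rmorphM /=; ring.
  have two : (2 : C) = (2 : R)%:C by apply: complex_ext => /=; ring.
  have kwle z : inrect a b 0 h z -> [|| complex.Re z == a, complex.Re z == b | complex.Im z == h] ->
      cabs (F z * kw z) <= M * (4 / e ^+ 3 * y).
    move=> zr zs; have [h1 h2] := far z zr zs; rewrite cabsM; apply: ler_pM; rewrite ?cabs_ge0//.
    apply: le_trans (inv_sqr_diff e0 h2 h1) _.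
    rewrite ww' !cabsM cabs_i cabs_real (gtr0_norm w0).
    rewrite two cabs_real ger0_norm//.
    by rewrite le_eqVlt; apply/orP; left; apply/eqP; ring.
  have Kle (t : R) : e <= `|t - x| -> cabs (F (t +i* 0) * K t) <= M * (2 / e ^+ 2 * y).
    move=> et; rewrite cabsM; apply: ler_pM; rewrite ?cabs_ge0//.
    rewrite /K cabsN !cabsM cabs_i cabs_real (ger0_norm (pker_ge0 _ _ w0)) mulr1.
    rewrite two cabs_real ger0_norm//.
    rewrite -!mulrA ler_pM2l// mulrC; exact: pker_far.
  have ha : e <= `|a - x| by rewrite distrC; apply: le_trans (ler_norm _); lra.
  have hb : e <= `|b - x| by apply: le_trans (ler_norm _); lra.
  have B2 := cint_bound (ltW ab) s2 (fun t ht => kwle (t +i* h) (inrect_bdry (bdry_top (ltW h0) ht)) ltac:(by rewrite /= eqxx !orbT)).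
  have B3 := cint_bound (ltW h0) s3 (fun t ht => kwle (a +i* t) (inrect_bdry (bdry_left (ltW ab) ht)) ltac:(by rewrite /= eqxx)).
  have B4 := cint_bound (ltW h0) s4 (fun t ht => kwle (b +i* t) (inrect_bdry (bdry_right (ltW ab) ht)) ltac:(by rewrite /= eqxx orbT)).
  have Ba := Kle a ha; have Bb := Kle b hb.
  apply: le_trans (cabsB _ _) _; apply: lerD.
    apply: le_trans (cabsB _ _) _; apply: le_trans (lerD Bb Ba) _.
    by rewrite le_eqVlt; apply/orP; left; apply/eqP; ring.
  apply: le_trans (cabsB _ _) _; rewrite cabsM cabs_i mul1r.
  apply: le_trans (lerD B2 (le_trans (cabsB _ _) (lerD B4 B3))) _.
  by rewrite subr0 le_eqVlt; apply/orP; left; apply/eqP; ring.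
rewrite cabsM cabs_2pii in sides.
have p2 := pi_ge2 R; have lP0 := cabs_ge0 (l - P).
have H : 1 * cabs (l - P) <= 2 * pi * cabs (l - P) by apply: ler_wpM2r => //; lra.
rewrite mul1r in H; apply: le_trans H (le_trans sides _).
by rewrite /k le_eqVlt; apply/orP; left; apply/eqP; ring.
Qed.

End Representation.

(** * Boundary behaviour of the derivative in the half-plane *)

Section BoundaryValues.
Variable R : realType.
Local Notation C := R[i].
Local Notation mu := (@lebesgue_measure R).
Implicit Types (a b : R) (z w : C).

(** The square around [w] of half-side [Im w / 2] stays in the upper half-plane, and on it the
    Lipschitz bound of [derivative_lipschitz] holds. *)
Lemma derivative_cont (F F' : C -> C) (M : R) w : (forall z, cabs (F z) <= M) ->
  (forall z, 0 < complex.Im z -> cdiff F z (F' z)) -> 0 < complex.Im w -> ccont F' w.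
Proof.
move=> FM dF w0; pose d := complex.Im w / 2; have d0 : 0 < d by rewrite divr_gt0.
have hs : hol_square w d F.
  move=> z /andP[_ /andP[z1 _]]; exists (F' z); apply: dF; apply: lt_le_trans z1.
  by rewrite /d; lra.
move=> e e0; pose k := 32 * M / d ^+ 2.
have M0 : 0 <= M by apply: le_trans (FM 0); exact: cabs_ge0.
have k0 : 0 <= k by rewrite /k divr_ge0// ?mulr_ge0 ?exprn_ge0// ltW.
have ke : 0 < e / (k + 1) by rewrite divr_gt0// ltr_wpDl.
have d2 : 0 < d / 2 by rewrite divr_gt0.
exists (Num.min (d / 2) (e / (k + 1))); first by rewrite lt_min d2.
move=> z; rewrite lt_min => /andP[zd ze].
have z0 : 0 < complex.Im z.
  have := cabs_ler_Im (z - w); rewrite ImD ImN ler_norml => /andP[h _].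
  by move: zd h; rewrite /d; lra.
apply: le_lt_trans (derivative_lipschitz d0 hs (fun z _ => FM z) (dF w w0) (dF z z0) (ltW zd)) _.
rewrite -/k; apply: (@le_lt_trans _ _ (k * (e / (k + 1)))).
  by apply: ler_wpM2l => //; exact: ltW.
by rewrite mulrA ltr_pdivrMr ?ltr_wpDl// mulrC ltr_pM2l// ltrDl.
Qed.

Lemma ae_imply2 (P Q S : R -> Prop) : (forall x, P x -> Q x -> S x) ->
  {ae mu, forall x, P x} -> {ae mu, forall x, Q x} -> {ae mu, forall x, S x}.
Proof.
by move=> PQS; exact: (@filterS2 _ _ (ae_filter_ringOfSetsType mu) P Q S).
Qed.

Definition cpoisson (q : R -> C) x y : C :=
  poisson (fun t => complex.Re (q t)) x y +i* poisson (fun t => complex.Im (q t)) x y.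

Lemma cintegrable_cutoff (q : R -> C) a b : cintegrable `[a, b] q ->
  cintegrable setT (cutoff q a b).
Proof.
have mI : measurable (`[a, b]%classic : set R) by exact: measurable_itv.
have H (g' : C -> R) : g' 0 = 0 -> mu.-integrable `[a, b] (EFin \o (fun t => g' (q t))) ->
    mu.-integrable setT (EFin \o (fun t => g' (cutoff q a b t))).
  move=> g0 ig; rewrite (_ : EFin \o _ = (EFin \o (fun t => g' (q t))) \_ `[a, b]).
    by rewrite -integrable_mkcond.
  apply/funext => t; rewrite patchE /cutoff /=.
  have -> : (t \in `[a, b]%classic) = (a <= t <= b) by apply/idP/idP; rewrite inE /= in_itv.
  by case: ifP => // _; rewrite g0.
by move=> [qR qI]; split; apply: H.
Qed.

Lemma cpoisson_nontangential (q : R -> C) : cintegrable setT q ->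
  {ae mu, forall u, forall k e : R, 0 <= k -> 0 < e -> exists2 d : R, 0 < d &
    forall x y, 0 < y < d -> `|x - u| <= k * y -> cabs (cpoisson q x y - q u) <= e}.
Proof.
move=> [qR qI].
have lR := lebesgue_differentiation (open_integrable_locally openT qR).
have lI := lebesgue_differentiation (open_integrable_locally openT qI).
apply: (ae_imply2 _ lR lI) => u uR uI k e k0 e0.
have e2 : 0 < e / 2 by rewrite divr_gt0.
have [d1 d10 H1] := poisson_nontangential qR uR k0 e2.
have [d2 d20 H2] := poisson_nontangential qI uI k0 e2.
exists (Num.min d1 d2); first by rewrite lt_min d10.
move=> x y /andP[y0]; rewrite lt_min => /andP[yd1 yd2] xu.
apply: le_trans (cabs_le_ReIm _) _; rewrite ReD ReN ImD ImN [leRHS]splitr.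
by apply: lerD; [apply: H1 => //|apply: H2 => //]; rewrite y0.
Qed.

Lemma poissonB (g1 g2 : R -> R) x y : 0 < y -> mu.-integrable setT (EFin \o g1) ->
  mu.-integrable setT (EFin \o g2) ->
  poisson (fun t => g1 t - g2 t) x y = poisson g1 x y - poisson g2 x y.
Proof.
move=> y0 i1 i2; rewrite /poisson -mulrBr -RintegralB//; [|exact: integrable_pkerM..].
by congr (_ * _); apply: eq_Rintegral => t _; rewrite mulrBr.
Qed.

Lemma poisson_L1 (g : R -> R) a b : a <= b -> mu.-integrable setT (EFin \o g) ->
  (forall t, ~ `[a, b]%classic t -> g t = 0) ->
  (forall y, 0 < y -> mu.-integrable `[a, b] (EFin \o (fun x => poisson g x y - g x))) /\
  \int[mu]_(x in `[a, b]) `|poisson g x y - g x| @[y --> 0^'+] --> (0 : R).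
Proof.
move=> ab ig gab.
pose gp t := Num.max (g t) 0; pose gn t := Num.max (- g t) 0.
have gE t : g t = gp t - gn t.
  rewrite /gp /gn; case: (leP (g t) 0) => h.
    by rewrite (max_idPl _) ?oppr_ge0// sub0r opprK.
  by rewrite (max_idPr _) ?oppr_le0 ?(ltW h)// subr0.
have mg : measurable_fun setT g by apply/measurable_EFinP; exact: measurable_int ig.
have ip : mu.-integrable setT (EFin \o gp).
  apply: le_integrable ig => //.
    by apply/measurable_EFinP; apply: measurable_maxr => //; exact: measurable_cst.
  move=> t _; rewrite /= lee_fin /gp; case: (leP (g t) 0) => h; last by [].
  by rewrite normr0.
have in_ : mu.-integrable setT (EFin \o gn).
  apply: le_integrable ig => //.
    apply/measurable_EFinP; apply: measurable_maxr => //; first exact: measurable_funN.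
  move=> t _; rewrite /= lee_fin /gn; case: (leP (- g t) 0) => h; last by rewrite normrN.
  by rewrite normr0.
have p0 t : 0 <= gp t by rewrite le_max lexx orbT.
have n0 t : 0 <= gn t by rewrite le_max lexx orbT.
have pab t : ~ `[a, b]%classic t -> gp t = 0 by move=> /gab; rewrite /gp => ->; rewrite maxxx.
have nab t : ~ `[a, b]%classic t -> gn t = 0 by move=> /gab; rewrite /gn => ->; rewrite oppr0 maxxx.
have iab (f : R -> R) y : 0 < y -> mu.-integrable setT (EFin \o f) -> (forall t, 0 <= f t) ->
    mu.-integrable `[a, b] (EFin \o (fun x => poisson f x y - f x)).
  move=> y0 iF f0; apply: integrable_sub => //; first by have [] := poisson_total ab y0 iF f0.
  exact: integrableS iF.
have gE' : g = fun t => gp t - gn t by exact/funext.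
have E y x : 0 < y -> poisson g x y - g x = (poisson gp x y - gp x) - (poisson gn x y - gn x).
  move=> y0; have := poissonB x y0 ip in_; rewrite -gE' => ->.
  by rewrite [g x]gE; ring.
split.
  move=> y y0; rewrite (_ : (fun x => _) = fun x => (poisson gp x y - gp x) - (poisson gn x y - gn x)).
    by apply: integrable_sub => //; exact: iab.
  by apply/funext => x; exact: E.
have lp := poisson_L1_ge0 ab ip p0 pab; have ln := poisson_L1_ge0 ab in_ n0 nab.
have := cvgD lp ln; rewrite addr0 => l0.
apply: (@squeeze_cvgr _ _ _ _ (cst 0) (fun y => \int[mu]_(x in `[a, b]) `|poisson gp x y - gp x| + \int[mu]_(x in `[a, b]) `|poisson gn x y - gn x|)); [|exact: cvg_cst|exact: l0].
near=> y.
have y0 : 0 < y by near: y; exact: nbhs_right_gt.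
apply/andP; split; first by apply: Rintegral_ge0.
have mI : measurable (`[a, b]%classic : set R) by exact: measurable_itv.
have i1 := integrable_normr (iab _ _ y0 ip p0); have i2 := integrable_normr (iab _ _ y0 in_ n0).
rewrite -RintegralD//; apply: le_Rintegral => //.
- apply: integrable_normr; rewrite (_ : (fun x => _) = fun x => (poisson gp x y - gp x) - (poisson gn x y - gn x)).
    by apply: integrable_sub => //; exact: iab.
  by apply/funext => x; exact: E.
- exact: integrable_add.
- by move=> x _; rewrite E// ler_normB.
Unshelve. all: by end_near. Qed.

Theorem strip_boundary_values (F F' : C -> C) (q : R -> C) a b (M e : R) : a < b -> 0 < e ->
  (forall z, cabs (F z) <= M) -> (forall z, ccont F z) ->
  (forall z, 0 < complex.Im z -> cdiff F z (F' z)) ->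
  has_density (fun t => F (t +i* 0)) q a b ->
  {ae mu, forall u, a + e < u < b - e -> forall k eta : R, 0 <= k -> 0 < eta ->
    exists2 d : R, 0 < d & forall w, 0 < complex.Im w < d ->
      `|complex.Re w - u| <= k * complex.Im w -> cabs (F' w - q u) <= eta} /\
  \int[mu]_(x in `[a + e, b - e]) cabs (F' (x +i* y) - q x) @[y --> 0^'+] --> (0 : R).
Proof.
move=> ab e0 FM cF dF hd.
(* With a rectangle of height [e + 1] the representation holds up to height 1. *)
have h0 : 0 < e + 1 by rewrite addr_gt0.
have hF : hol_rect a b 0 (e + 1) F.
  by split=> [z _|z _ z0]; [exact: cF|exists (F' z); exact: dF].
have [k k0 rep] := poisson_representation ab h0 e0 hF FM (fun t => cF _) hd.
pose q0 := cutoff q a b.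
have iq0 : cintegrable setT q0 by exact: cintegrable_cutoff hd.1.
have {}rep w : a + e <= complex.Re w -> complex.Re w <= b - e -> 0 < complex.Im w ->
    complex.Im w <= 1 -> cabs (F' w - cpoisson q0 (complex.Re w) (complex.Im w)) <= k * complex.Im w.
  by move=> aw wb w0 w1; apply: rep => //; [rewrite addrC addKr|exact: dF].
have q0E u : a <= u <= b -> q0 u = q u by rewrite /q0 /cutoff => ->.
split.
  apply: ae_imply (cpoisson_nontangential iq0) => u H /andP[au ub] l eta l0 eta0.
  have e2 : 0 < eta / 2 by rewrite divr_gt0.
  have [d d0 Hd] := H l _ l0 e2.
  pose m := Num.min (u - (a + e)) (b - e - u).
  have m0 : 0 < m by rewrite lt_min !subr_gt0 au.
  (* In a cone of slope [l], heights below [m / (l + 1)] keep [Re w] inside [[a + e, b - e]]; the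
     last bound makes the error [k * Im w] of the representation at most [eta / 2]. *)
  exists (Num.min (Num.min d 1) (Num.min (m / (l + 1)) (eta / 2 / (k + 1)))).
    by rewrite !lt_min d0 ltr01 !divr_gt0// ltr_wpDl.
  move=> w /andP[w0]; rewrite !lt_min => /andP[/andP[wd w1] /andP[wm we]] wu.
  have wum : `|complex.Re w - u| < m.
    apply: le_lt_trans wu _; move: wm; rewrite ltr_pdivlMr ?ltr_wpDl// => wm.
    by apply: le_lt_trans wm; rewrite mulrC ler_pM2l// lerDl.
  move: wum; rewrite ltr_norml lt_min => /andP[].
  rewrite /m ltrNl lt_min => /andP[h1 _] /andP[_ h2].
  have [aw wb] : a + e <= complex.Re w /\ complex.Re w <= b - e.
    by move: h1 h2; clear; split; lra.
  have := rep w aw wb w0 (ltW w1).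
  have kw : k * complex.Im w <= eta / 2.
    move: we; rewrite ltr_pdivlMr ?ltr_wpDl// => we.
    by apply: le_trans (ltW we); rewrite mulrC ler_pM2l// lerDl.
  have := Hd (complex.Re w) (complex.Im w); rewrite w0 wd => /(_ isT wu).
  rewrite q0E; last by apply/andP; move: au ub e0; clear; split; lra.
  move=> h3 h4; have -> : F' w - q u = (F' w - cpoisson q0 (complex.Re w) (complex.Im w)) +
    (cpoisson q0 (complex.Re w) (complex.Im w) - q u) by rewrite addrA subrK.
  by apply: le_trans (cabsD _ _) _; move: h3 h4 kw; clear; lra.
have q0ab t : ~ `[a, b]%classic t -> q0 t = 0.
  by rewrite /= in_itv /= /q0 /cutoff => /negP /negPf ->.
have [iR LR] := @poisson_L1 (fun t => complex.Re (q0 t)) a b (ltW ab) iq0.1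
  (fun t h => congr1 (@complex.Re R) (q0ab t h)).
have [iI LI] := @poisson_L1 (fun t => complex.Im (q0 t)) a b (ltW ab) iq0.2
  (fun t h => congr1 (@complex.Im R) (q0ab t h)).
have [ae_lt|ae_ge] := ltP (b - e) (a + e).
  rewrite set_itv_ge ?bnd_simp -?ltNge// (_ : (fun y => _) = fun _ => 0); first exact: cvg_cst.
  by apply/funext => y; rewrite Rintegral_set0.
(* The two [L^1] errors of the Poisson integrals over the larger interval, plus the representation
   error [k * y] integrated over the smaller one. *)
pose U y := \int[mu]_(x in `[a, b]) `|poisson (fun t => complex.Re (q0 t)) x y - complex.Re (q0 x)| +
   \int[mu]_(x in `[a, b]) `|poisson (fun t => complex.Im (q0 t)) x y - complex.Im (q0 x)| + k * (b - e - (a + e)) * y.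
apply: (@squeeze_cvgr _ _ _ _ (cst 0) U); [|exact: cvg_cst|]; last first.
  rewrite [X in _ --> X](_ : 0 = 0 + 0 + k * (b - e - (a + e)) * 0); last by rewrite mulr0 !addr0.
  apply: cvgD; first by apply: cvgD; [exact: LR|exact: LI].
  apply: cvgM; first exact: cvg_cst.
  exact: cvg_at_right_filter.
near=> y.
have y0 : 0 < y by near: y; exact: nbhs_right_gt.
have y1 : y < 1 by near: y; exact: nbhs_right_lt.
apply/andP; split; first by apply: Rintegral_ge0 => x _; exact: cabs_ge0.
have sub : `[a + e, b - e]%classic `<=` `[a, b].
  by apply: subset_itv; rewrite bnd_simp ?lerDl ?gerBl ltW.
have mI : measurable (`[a + e, b - e]%classic : set R) by exact: measurable_itv.
have nR := integrable_normr (iR _ y0); have nI := integrable_normr (iI _ y0).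
have nR' : mu.-integrable `[a + e, b - e] (EFin \o (fun x => `|poisson (fun t => complex.Re (q0 t)) x y - complex.Re (q0 x)|)).
  exact: integrableS nR.
have nI' : mu.-integrable `[a + e, b - e] (EFin \o (fun x => `|poisson (fun t => complex.Im (q0 t)) x y - complex.Im (q0 x)|)).
  exact: integrableS nI.
have iF : cintegrable `[a + e, b - e] (fun x => F' (x +i* y) - q x).
  apply: cintegrableB => //; last exact: cintegrableS hd.1.
  apply: cintegrable_cont => t _; apply: pcont_hline.
  exact: derivative_cont FM dF _.
apply: (@le_trans _ _ (\int[mu]_(x in `[a + e, b - e])
   ((`|poisson (fun t => complex.Re (q0 t)) x y - complex.Re (q0 x)| +
    `|poisson (fun t => complex.Im (q0 t)) x y - complex.Im (q0 x)|) + k * y))).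
  apply: le_Rintegral => //.
  - exact: integrable_cabs.
  - apply: integrable_add => //; first exact: integrable_add.
    exact: integrable_cst_itv.
  - move=> x /=; rewrite in_itv /= => /andP[ax xb].
    have := rep (x +i* y) ax xb y0 (ltW y1); rewrite /= => h1.
    have -> : F' (x +i* y) - q x = (cpoisson q0 x y - q0 x) + (F' (x +i* y) - cpoisson q0 x y).
      rewrite q0E; first by ring.
      by apply/andP; split; [apply: le_trans ax; rewrite lerDl ltW|apply: le_trans xb _; rewrite gerBl ltW].
    apply: le_trans (cabsD _ _) _; apply: lerD h1.
    by apply: le_trans (cabs_le_ReIm _) _; rewrite ReD ReN ImD ImN.
rewrite RintegralD//; [|exact: integrable_add|exact: integrable_cst_itv].
rewrite RintegralD// Rintegral_cst_itv//.
rewrite /U; apply: lerD; last by rewrite le_eqVlt; apply/orP; left; apply/eqP; ring.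
apply: lerD; apply: Rintegral_subset => //.
Unshelve. all: by end_near. Qed.

End BoundaryValues.

(** * The density vanishes almost nowhere *)

Section Uniqueness.
Variable R : realType.
Local Notation C := R[i].
Local Notation mu := (@lebesgue_measure R).
Implicit Types (a b : R) (z w : C).

(** [k'] is the derivative of [k]. In the contour integral of [F * k'] the two Cauchy formulas
    combine so that the terms with [F z0] cancel and [l * H z0 ^+ n] remains. Integration by parts
    along the bottom brings in [q], and with it the zeros of the density. *)
Lemma weighted_cauchy (F H H' : C -> C) (q : R -> C) a b (h M B0 B : R) (n : nat) z0 l :
  a < b -> 0 < h -> hol_rect a b 0 h F -> (forall z, cabs (F z) <= M) ->
  (forall t : R, ccont F (t +i* 0)) -> has_density (fun t => F (t +i* 0)) q a b ->
  (forall z, 0 <= complex.Im z -> cdiff H z (H' z)) ->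
  (forall z, 0 <= complex.Im z -> cdiffable H' z) ->
  a < complex.Re z0 < b -> 0 < complex.Im z0 < h -> cdiff F z0 l ->
  let k z := H z ^+ n * (z - z0)^-1 in
  let k' z := n%:R * H z ^+ n.-1 * H' z * (z - z0)^-1 - H z ^+ n * (z - z0) ^- 2 in
  cabs (k (a +i* 0)) <= B0 -> cabs (k (b +i* 0)) <= B0 ->
  (forall z, inrect a b 0 h z ->
    [|| complex.Re z == a, complex.Re z == b | complex.Im z == h] -> cabs (k' z) <= B) ->
  2 * pi * (cabs l * cabs (H z0) ^+ n) <=
  2 * (M * B0) + \int[mu]_(t in `[a, b]) cabs (q t * k (t +i* 0)) + M * B * (b - a + 2 * h).
Proof.
move=> ab h0 hF FM cF hd dH dH' xz yz dl k k' ka kb k'B.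
have M0 : 0 <= M by apply: le_trans (FM 0); exact: cabs_ge0.
have cH' z : 0 <= complex.Im z -> ccont H' z by move=> /dH'[? /cdiff_cont].
have cH z : 0 <= complex.Im z -> ccont H z by move=> /dH /cdiff_cont.
have rz z : inrect a b 0 h z -> 0 <= complex.Im z by move=> /andP[_ /andP[]].
have z00 : 0 <= complex.Im z0 by case/andP: yz => /ltW.
pose g z := n%:R * H z ^+ n.-1 * H' z.
have cg z : 0 <= complex.Im z -> ccont g z.
  by move=> z1; apply: ccvgM; [apply: ccvgM; [exact: ccvg_cst|apply: ccvgX; exact: cH]|exact: cH'].
have dg z : 0 <= complex.Im z -> cdiffable g z.
  move=> z1; have [m dm] := dH' z z1; eexists.
  exact: (cdiffM (cdiffM (cdiff_cst n%:R z) (cdiffX n.-1 (dH z z1))) dm).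
have h1 : hol_rect a b 0 h (fun z => F z * g z).
  split=> [z zr|z zr z1]; first by apply: ccvgM; [exact: hF.1|exact: cg (rz z zr)].
  have [m dm] := hF.2 z zr z1; have [m' dm'] := dg z (rz z zr).
  by eexists; exact: (cdiffM dm dm').
have h2 : hol_rect a b 0 h (fun z => F z * H z ^+ n).
  split=> [z zr|z zr z1]; first by apply: ccvgM; [exact: hF.1|apply: ccvgX; exact: cH (rz z zr)].
  have [m dm] := hF.2 z zr z1.
  by eexists; exact: (cdiffM dm (cdiffX n (dH z (rz z zr)))).
have E1 := cauchy_formula h1 xz yz.
have E2 := cauchy_derivative h2 xz yz (cdiffM dl (cdiffX n (dH z0 z00))).
have bz z : bdry a b 0 h z -> z != z0.
  move=> /andP[_ zb]; apply: contraTneq zb => ->.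
  by case/andP: xz => x1 x2; case/andP: yz => y1 y2; apply/negP => /or4P[] /eqP; lra.
have b1 : bcont a b 0 h (fun z => F z * g z * (z - z0)^-1).
  move=> z zb; apply: ccvgM; first exact: h1.1 (inrect_bdry zb).
  by apply: ccont_invr; exact: bz.
have b2 : bcont a b 0 h (fun z => F z * H z ^+ n * (z - z0) ^- 2).
  move=> z zb; apply: ccvgM; first exact: h2.1 (inrect_bdry zb).
  by apply: ccont_inv_sqr; exact: bz.
have FE : (fun z => F z * k' z) =
    fun z => F z * g z * (z - z0)^-1 - F z * H z ^+ n * (z - z0) ^- 2.
  by apply/funext => z; rewrite /k' /g; ring.
have E : rint a b 0 h (fun z => F z * k' z) = - ((2 * pi)%:C * 'i * (l * H z0 ^+ n)).
  by rewrite FE rintB ?ltW// E1 E2 /g; ring.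
have bc : bcont a b 0 h (fun z => F z * k' z) by rewrite FE; exact: bcontB.
have [s1 s2 s3 s4] := bcont_sides (ltW ab) (ltW h0) bc.
have t0 (t : R) : 0 <= complex.Im (t +i* 0) by [].
have tz (t : R) : (t +i* 0) != z0.
  by apply/eqP => tE; case/andP: yz; rewrite -tE /= ltxx.
have dk (t : R) : rdiff (fun t => k (t +i* 0)) t (k' (t +i* 0)).
  apply: rdiff_hline; have := cdiffM (cdiffX n (dH _ (t0 t))) (cdiff_invr (tz t)).
  by rewrite mulrN.
have parts : cint `[a, b] (fun t => F (t +i* 0) * k' (t +i* 0)) =
    F (b +i* 0) * k (b +i* 0) - F (a +i* 0) * k (a +i* 0) -
    cint `[a, b] (fun t => q t * k (t +i* 0)).
  apply: (density_parts (k := fun t => k (t +i* 0)) (k' := fun t => k' (t +i* 0)) (ltW ab) hd) => // t _.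
    exact: pcont_hline.
  apply: (@pcont_hline _ k'); apply: ccvgB; apply: ccvgM.
  - exact: cg.
  - exact: ccont_invr.
  - by apply: ccvgX; exact: cH.
  - exact: ccont_inv_sqr.
have iqk : cintegrable `[a, b] (fun t => q t * k (t +i* 0)).
  apply: cintegrable_mul_cont; [exact: ltW|exact: hd.1|].
  by move=> t _; exact: rdiff_cont (dk t).
have FB z : inrect a b 0 h z -> [|| complex.Re z == a, complex.Re z == b | complex.Im z == h] ->
    cabs (F z * k' z) <= M * B.
  by move=> zr zs; rewrite cabsM ler_pM ?cabs_ge0// k'B.
have B2 := cint_bound (ltW ab) s2 (fun t ht => FB (t +i* h) (inrect_bdry (bdry_top (ltW h0) ht)) ltac:(by rewrite /= eqxx !orbT)).
have B3 := cint_bound (ltW h0) s3 (fun t ht => FB (a +i* t) (inrect_bdry (bdry_left (ltW ab) ht)) ltac:(by rewrite /= eqxx)).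
have B4 := cint_bound (ltW h0) s4 (fun t ht => FB (b +i* t) (inrect_bdry (bdry_right (ltW ab) ht)) ltac:(by rewrite /= eqxx orbT)).
have Bq := cabs_cint (measurable_itv `[a, b]) iqk.
rewrite -cabsX -cabsM -cabs_2pii -cabsM -cabsN -E /rint parts.
apply: le_trans (cabsD _ _) _; rewrite cabsM cabs_i mul1r.
have -> : 2 * (M * B0) + \int[mu]_(t in `[a, b]) cabs (q t * k (t +i* 0)) + M * B * (b - a + 2 * h) =
  ((M * B0 + M * B0 + \int[mu]_(t in `[a, b]) cabs (q t * k (t +i* 0))) + M * B * (b - a)) +
  (M * B * (h - 0) + M * B * (h - 0)) by ring.
apply: lerD; last exact: le_trans (cabsB _ _) (lerD B4 B3).
apply: le_trans (cabsB _ _) _; apply: lerD B2.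
apply: le_trans (cabsB _ _) _; apply: lerD Bq.
by apply: le_trans (cabsB _ _) _; apply: lerD; rewrite cabsM ler_pM ?cabs_ge0.
Qed.

Lemma pole_ge (p : R * R) z : 0 < p.2 -> 0 <= complex.Im z ->
  cabs (z - p.1%:C) <= cabs (pole p z) /\ p.2 <= cabs (pole p z).
Proof.
move=> p0 z0; split; last first.
  apply: le_trans (cabs_ler_Im _); rewrite poleE /=.
  by rewrite ger0_norm ?lerDr// addr_ge0// ltW.
rewrite -ler_sqr ?nnegrE ?cabs_ge0// !cabs_sqr poleE /=.
case: z z0 => x y /= y0; rewrite lerD2l subr0 ler_sqr ?nnegrE//.
  by rewrite lerDl ltW.
by rewrite addr_ge0// ltW.
Qed.

Section TestFunction.
Variables (x0 r : R) (s : seq (R * R)).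
Hypotheses (r0 : 0 < r) (s0 : radii_pos s) (s_small : \sum_(p <- s) p.2 <= r / 1024).
Hypothesis s_near : forall p, p \in s ->
  exists2 c, x0 - r / 2 < c < x0 + r / 2 & `|c - p.1| <= p.2.

Let p0 : R * R := (x0, r / 16).
Let p00 : 0 < p0.2. Proof. by rewrite /p0 /= divr_gt0. Qed.
Let z0 : C := x0 +i* (r / 16).

(** The first factor is at most 1, at most [(r / 16) / (r / 2) = 1 / 8] at distance [r / 2] from
    [x0], and [1 / 2] at [z0]. A peak of weight 16 is at most [2 / 16 = 1 / 8] on the intervals of
    [s], yet at least [3 / 4] at [z0]. This leaves [3 / 8] against [1 / 8]. *)
Definition testfun z : C := (r / 16)%:C * (pole p0 z)^-1 * peak s 16 z.
Definition testfun' z : C := - ((r / 16)%:C * (pole p0 z) ^- 2) * peak s 16 z +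
  (r / 16)%:C * (pole p0 z)^-1 * peak' s 16 z.

Lemma cdiff_testfun z : 0 <= complex.Im z -> cdiff testfun z (testfun' z).
Proof.
move=> zi; have d1 := cdiffV (pole_neq0 p00 zi) (cdiff_pole p0 z).
have := cdiffM (cdiffM (cdiff_cst (r / 16)%:C z) d1) (cdiff_peak s0 (ler0n _ 16) zi).
by rewrite mul0r add0r mulN1r mulrN.
Qed.

Lemma cdiff_testfun' z : 0 <= complex.Im z -> cdiffable testfun' z.
Proof.
move=> zi; have d1 := cdiffV (pole_neq0 p00 zi) (cdiff_pole p0 z).
have [l dl] := cdiff_peak' s0 (ler0n R 16) zi.
have d2 := cdiffM (cdiffN (cdiffM (cdiff_cst (r / 16)%:C z) (cdiffX 2 d1))) (cdiff_peak s0 (ler0n _ 16) zi).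
have d3 := cdiffM (cdiffM (cdiff_cst (r / 16)%:C z) d1) dl.
eexists; apply: cdiff_near (cdiffD d2 d3).
by apply: nearW => w; rewrite /testfun' exprVn.
Qed.

Let H0_le z (d : R) : 0 < d -> d <= cabs (pole p0 z) ->
  cabs ((r / 16)%:C * (pole p0 z)^-1) <= r / 16 / d.
Proof.
move=> d0 dz; have r16 : 0 <= r / 16 by rewrite divr_ge0// ltW.
rewrite cabsM cabs_real ger0_norm// cabsV ler_wpM2l// lef_pV2 ?posrE//.
exact: lt_le_trans dz.
Qed.

Lemma testfun_le1 z : 0 <= complex.Im z -> cabs (testfun z) <= 1.
Proof.
move=> zi; have [_ h] := pole_ge p00 zi; rewrite /testfun cabsM.
apply: mulr_ile1; rewrite ?cabs_ge0 ?peak_le1//.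
by apply: le_trans (H0_le p00 h) _; rewrite divff// gt_eqF.
Qed.

Let far_le z : 0 <= complex.Im z -> r / 2 <= cabs (z - x0%:C) ->
  cabs ((r / 16)%:C * (pole p0 z)^-1) <= 8^-1.
Proof.
move=> zi rz; have [h _] := pole_ge p00 zi; have r2 : 0 < r / 2 by rewrite divr_gt0.
apply: le_trans (H0_le r2 (le_trans rz h)) _.
by rewrite le_eqVlt; apply/orP; left; apply/eqP; field; rewrite gt_eqF.
Qed.

Lemma testfun_far z : 0 <= complex.Im z -> r / 2 <= cabs (z - x0%:C) ->
  cabs (testfun z) <= 8^-1.
Proof.
move=> zi rz; rewrite /testfun cabsM -[leRHS]mulr1.
by apply: ler_pM; rewrite ?cabs_ge0 ?far_le ?peak_le1.
Qed.

Lemma testfun_peak (t : R) p : p \in s -> `|t - p.1| <= p.2 -> cabs (testfun t%:C) <= 8^-1.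
Proof.
move=> ps tp; have zi : 0 <= complex.Im (t%:C : C) by [].
have [_ h] := pole_ge p00 zi; rewrite /testfun cabsM -[leRHS]mul1r.
apply: ler_pM; rewrite ?cabs_ge0//.
  by apply: le_trans (H0_le p00 h) _; rewrite divff// gt_eqF.
apply: le_trans (peak_small s0 (ler0n _ 16) ps tp _) _ => //.
by rewrite le_eqVlt; apply/orP; left; apply/eqP; field.
Qed.

Lemma testfun_center : 3 / 8 <= cabs (testfun z0).
Proof.
have zi : 0 <= complex.Im z0 by rewrite /= divr_ge0// ltW.
have r16 : 0 < r / 16 by rewrite divr_gt0.
have -> : cabs (testfun z0) = 2^-1 * cabs (peak s 16 z0).
  rewrite /testfun cabsM; congr (_ * _).
  have -> : pole p0 z0 = (2 * (r / 16))%:C * 'i by rewrite poleE; apply: complex_ext => /=; ring.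
  have n2 : `|2 * (r / 16)| = 2 * (r / 16) by rewrite ger0_norm// mulr_ge0// ltW.
  rewrite cabsM cabsV cabsM cabs_i !cabs_real n2 (ger0_norm (ltW r16)).
  by field; rewrite gt_eqF.
have far p : p \in s -> r / 16 <= cabs (pole p z0).
  move=> ps; apply: le_trans (cabs_ler_Im _); rewrite poleE /=.
  by apply: le_trans (ler_norm _); rewrite lerDl; apply: ltW; exact: s0.
have := peak_sub1 s0 (ler0n _ 16) zi r16 far.
(* The bound [r / 1024] on the total radius makes the left side at most
   [16 * (r / 1024) / (r / 16) = 1 / 4]. *)
have h1 : 16 * (\sum_(p <- s) p.2) / (r / 16) <= 4^-1.
  rewrite ler_pdivrMr//; apply: le_trans (ler_wpM2l _ s_small) _ => //.
  by rewrite le_eqVlt; apply/orP; left; apply/eqP; field.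
have := cabs_ler_dist 1 (peak s 16 z0); rewrite cabs_distC.
have -> : cabs (1 : C) = 1 by rewrite (cabs_real 1) normr1.
rewrite ler_norml => /andP[_ h2] h3; move: h1 h2 h3; lra.
Qed.

(** Each summand of the product rule is at most [1 / (4 * r)]: the first because its two reciprocal
    factors give [1 / 8] and [2 / r], the second because [16 * (r / 1024) / (r / 4) ^+ 2] is
    [1 / (4 * r)]. *)
Lemma testfun'_far z : 0 <= complex.Im z ->
  (forall c, x0 - r / 2 < c < x0 + r / 2 -> r / 2 <= cabs (z - c%:C)) ->
  r / 2 <= cabs (z - x0%:C) -> cabs (testfun' z) <= r^-1 / 2.
Proof.
move=> zi zc rz; have r2 : 0 < r / 2 by rewrite divr_gt0.
have [h _] := pole_ge p00 zi; have hr := le_trans rz h.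
have far p : p \in s -> r / 4 <= cabs (pole p z).
  move=> ps; have [c cx cp] := s_near ps.
  by have := pole_far (s0 ps) zi cp (zc c cx); lra.
have r4 : 0 < r / 4 by rewrite divr_gt0.
have H1 : cabs (peak' s 16 z) <= r^-1 / 4.
  apply: le_trans (peak'_le s0 (ler0n _ 16) zi r4 far) _.
  rewrite ler_pdivrMr ?exprn_gt0//; apply: le_trans (ler_wpM2l _ s_small) _ => //.
  by rewrite le_eqVlt; apply/orP; left; apply/eqP; field; rewrite gt_eqF.
have H2 : cabs ((r / 16)%:C * (pole p0 z) ^- 2) <= r^-1 / 4.
  have -> : (r / 16)%:C * (pole p0 z) ^- 2 = ((r / 16)%:C * (pole p0 z)^-1) * (pole p0 z)^-1.
    by rewrite -exprVn; ring.
  rewrite cabsM; apply: le_trans (ler_pM _ _ (far_le zi rz) (_ : _ <= (r / 2)^-1)) _; rewrite ?cabs_ge0//.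
    by rewrite cabsV lef_pV2 ?posrE//; exact: lt_le_trans hr.
  by rewrite le_eqVlt; apply/orP; left; apply/eqP; field; rewrite gt_eqF.
have ri : 0 < r^-1 by rewrite invr_gt0.
rewrite /testfun'; apply: le_trans (cabsD _ _) _; rewrite [cabs (- _ * _)]cabsM cabsN [X in _ + X]cabsM.
have -> : r^-1 / 2 = r^-1 / 4 * 1 + 1 * (r^-1 / 4) by field; rewrite gt_eqF.
apply: lerD; apply: ler_pM; rewrite ?cabs_ge0 ?peak_le1//.
by apply: le_trans (far_le zi rz) _; rewrite invf_le1// ler1n.
Qed.

End TestFunction.

(** Since [n.+1 ^ 2 <= 2 * 3 ^ n], the hypothesis gives [L * n.+1 <= 2 * c] for every [n]. *)
Lemma geometric_vanish (L c : R) : 0 <= L -> 0 <= c ->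
  (forall n, L * 3 ^+ n <= c * n.+1%:R) -> L = 0.
Proof.
move=> L0 c0 H.
have H3 n : n.+1%:R ^+ 2 <= 2 * 3 ^+ n :> R.
  elim: n => [|n IH]; first by rewrite expr0 expr1n mulr1 ler1n.
  have e1 : n.+1%:R = n%:R + 1 :> R by rewrite natr1.
  have e2 : n.+2%:R = n%:R + 2 :> R by rewrite -addn2 natrD.
  rewrite [3 ^+ _]exprS e2; move: IH; rewrite e1; case: n {e1 e2} => [|n] IH.
    by rewrite expr0; lra.
  have x1 : 1 <= n.+1%:R :> R by rewrite ler1n.
  by move: x1 IH; set x := n.+1%:R; set y := 3 ^+ n.+1; nra.
have LH n : L * n.+1%:R <= 2 * c.
  have n0 : 0 < n.+1%:R :> R by [].
  rewrite -(ler_pM2r n0) -mulrA -expr2.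
  apply: le_trans (ler_wpM2l L0 (H3 n)) _; rewrite mulrCA -mulrA ler_pM2l//.
have : (fun _ : nat => L) n @[n --> \oo] --> 0.
  by apply: (@cvg_le_inv _ _ (2 * c)) => n; rewrite ger0_norm// ler_pdivlMr.
by move=> /(cvg_unique _ (cvg_cst L)); apply.
Qed.

(* Cauchy's formula for [F'(x0 + i r/16)] weighted with [H ^+ n], where
   [|H| <= 1/8] on the contour except where [q] vanishes and [|H| >= 3/8] at the
   point; then let [n] tend to infinity. *)
Lemma vanishing_derivative (F : C -> C) (q : R -> C) (x0 r M : R) (E : set R) l :
  0 < r -> (forall z, cabs (F z) <= M) -> (forall z, ccont F z) ->
  (forall z, 0 < complex.Im z -> cdiffable F z) ->
  has_density (fun t => F (t +i* 0)) q (x0 - r) (x0 + r) ->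
  measurable E -> (forall t, E t -> q t = 0) ->
  (mu (`](x0 - r / 2)%R, (x0 + r / 2)%R[ `\` E) < (r / 1024)%:E)%E ->
  cdiff F (x0 +i* (r / 16)) l -> l = 0.
Proof.
move=> r0 FM cF dF hd mE qE Esmall dl.
have M0 : 0 <= M by apply: le_trans (FM 0); exact: cabs_ge0.
set a := x0 - r; set b := x0 + r; set z0 := x0 +i* (r / 16).
have ab : a < b by rewrite /a /b; lra.
have hF : hol_rect a b 0 r F by split=> [z _|z _ z1]; [exact: cF|exact: dF].
pose D : set R := `]x0 - r / 2, x0 + r / 2[%classic `\` E.
have mD : measurable (D : set R) by exact: measurableD.
have iq : cintegrable setT (cutoff q a b) by exact: cintegrable_cutoff hd.1.
have ic := integrable_cabs measurableT iq.
pose Q := \int[mu]_(t in `[a, b]) cabs (q t).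
have Q0 : 0 <= Q by apply: Rintegral_ge0 => t _; exact: cabs_ge0.
have mab : measurable (`[a, b]%classic : set R) by exact: measurable_itv.
have icq := integrable_cabs mab hd.1.
have main n eta : 0 < eta -> 2 * pi * (cabs l * (3 / 8) ^+ n) <=
    2 * (M * (8^-1 ^+ n * (2 / r))) + 16 / r * (8^-1 ^+ n * Q + eta) +
    M * (8^-1 ^+ n * (8 * n%:R + 4) / r ^+ 2) * (b - a + 2 * r).
  move=> eta0.
  (* Absolute continuity of the integral gives [d]; the compact [K] then leaves a set of measure
     below [d] in [D], on which [|q|] integrates to at most [eta]. The peak is built on a cover of
     [K]. *)
  have [d [d0 Hd]] := integral_normr_continuous ic eta0.
  have [|K [cK KD Kd]] := lebesgue_regularity_inner mD _ d0.
    by apply: lt_trans Esmall _; exact: ltry.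
  have mK : measurable (K : set R) by apply: closed_measurable; exact: compact_closed.
  have [|s [s0 s_small Ks sK]] := @compact_cover_seq R K (r / 1024) cK.
    by apply: le_lt_trans Esmall; apply: le_measure; rewrite ?inE.
  have s_near p : p \in s -> exists2 c, x0 - r / 2 < c < x0 + r / 2 & `|c - p.1| <= p.2.
    by move=> /sK[c /KD[/=]]; rewrite in_itv /= => cx _ cp; exists c.
  pose H := testfun x0 r s; pose H' := testfun' x0 r s.
  have far z : 0 <= complex.Im z -> r / 2 <= cabs (z - x0%:C) -> cabs (H z) <= 8^-1.
    by move=> zi zx; exact: (testfun_far r0).
  have dist z : inrect a b 0 r z -> [|| complex.Re z == a, complex.Re z == b | complex.Im z == r] ->
      (forall c, x0 - r / 2 < c < x0 + r / 2 -> r / 2 <= cabs (z - c%:C)) /\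
      r / 2 <= cabs (z - z0).
    move=> _ zs; split=> [c /andP[c1 c2]|].
      have := cabs_ler_Re (z - c%:C); have := cabs_ler_Im (z - c%:C).
      rewrite !ReD !ReN !ImD !ImN /= !ler_norml => /andP[i1 i2] /andP[r1 r2].
      by case/or3P: zs => /eqP zE; rewrite zE in i1 i2 r1 r2; move: i1 i2 r1 r2 c1 c2 r0; rewrite /a /b; clear; lra.
    have := cabs_ler_Re (z - z0); have := cabs_ler_Im (z - z0).
    rewrite !ReD !ReN !ImD !ImN /= !ler_norml => /andP[i1 i2] /andP[r1 r2].
    by case/or3P: zs => /eqP zE; rewrite zE in i1 i2 r1 r2; move: i1 i2 r1 r2 r0; rewrite /a /b; clear; lra.
  have x0c : x0 - r / 2 < x0 < x0 + r / 2 by rewrite gtrBl ltrDl divr_gt0.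
  have r2 : 0 < r / 2 by rewrite divr_gt0.
  have inv2 z : r / 2 <= cabs (z - z0) -> cabs (z - z0)^-1 <= 2 / r.
    move=> h; rewrite cabsV -[2 / r]invf_div lef_pV2 ?posrE//; exact: lt_le_trans h.
  have e0 : 0 <= 8^-1 :> R by rewrite invr_ge0.
  have corner (t : R) : t = a \/ t = b -> cabs (H (t +i* 0) ^+ n * ((t +i* 0) - z0)^-1) <= 8^-1 ^+ n * (2 / r).
    move=> tab; have [h1 h2] : (forall c, x0 - r / 2 < c < x0 + r / 2 -> r / 2 <= cabs ((t +i* 0) - c%:C)) /\
      r / 2 <= cabs ((t +i* 0) - z0).
      by apply: dist; case: tab => ->; rewrite /inrect /= ?lexx ?eqxx ?orbT ?(ltW ab) ?(ltW r0).
    rewrite cabsM cabsX; apply: ler_pM; rewrite ?exprn_ge0 ?cabs_ge0//; last exact: inv2.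
    by rewrite lerXn2r ?nnegrE ?cabs_ge0// far// h1.
  have side z : inrect a b 0 r z -> [|| complex.Re z == a, complex.Re z == b | complex.Im z == r] ->
    cabs (n%:R * H z ^+ n.-1 * H' z * (z - z0)^-1 - H z ^+ n * (z - z0) ^- 2) <=
    8^-1 ^+ n * (8 * n%:R + 4) / r ^+ 2.
    move=> zr zs; have zi : 0 <= complex.Im z by case/andP: zr => _ /andP[].
    have [h1 h2] := dist z zr zs; have Hz := far z zi (h1 _ x0c).
    have H'z : cabs (H' z) <= r^-1 / 2 by exact: (testfun'_far r0 s0 s_small s_near zi h1 (h1 _ x0c)).
    have Hn m : cabs (H z) ^+ m <= 8^-1 ^+ m by rewrite lerXn2r ?nnegrE ?cabs_ge0.
    have zz := inv2 z h2.
    have -> : 8^-1 ^+ n * (8 * n%:R + 4) / r ^+ 2 = n%:R * (8^-1 ^+ n.-1) * (r^-1 / 2) * (2 / r) + 8^-1 ^+ n * (2 / r) ^+ 2.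
      case: (n) => [|m]; first by rewrite !expr0 /=; field; rewrite gt_eqF.
      by rewrite /= exprS; field; rewrite gt_eqF// expf_neq0.
    apply: le_trans (cabsB _ _) _; apply: lerD.
      rewrite 3!cabsM cabsX; apply: ler_pM; rewrite ?mulr_ge0 ?cabs_ge0 ?exprn_ge0 ?cabs_ge0//.
      apply: ler_pM; rewrite ?mulr_ge0 ?cabs_ge0 ?exprn_ge0 ?cabs_ge0//.
      apply: ler_pM; rewrite ?mulr_ge0 ?cabs_ge0 ?exprn_ge0 ?cabs_ge0//.
      by rewrite -(rmorph_nat (@real_complex R)) cabs_real ger0_norm.
    rewrite cabsM cabsX -exprVn cabsX; apply: ler_pM; rewrite ?exprn_ge0 ?cabs_ge0//.
    by rewrite lerXn2r ?nnegrE ?cabs_ge0// divr_ge0 ?ltW.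
  have xz : a < complex.Re z0 < b by rewrite /= gtrBl ltrDl r0.
  have yz : 0 < complex.Im z0 < r by rewrite /= divr_gt0//= ltr_pdivrMr// ltr_pMr// ltr1n.
  have := weighted_cauchy (n := n) ab r0 hF FM (fun t => cF _) hd
    (cdiff_testfun x0 r0 s0) (cdiff_testfun' x0 r0 s0) xz yz dl
    (corner a (or_introl erefl)) (corner b (or_intror erefl)) side.
  rewrite -/H => W.
  have low : 2 * pi * (cabs l * (3 / 8) ^+ n) <= 2 * pi * (cabs l * cabs (H z0) ^+ n).
    rewrite ler_pM2l ?mulr_gt0 ?pi_gt0//; apply: ler_wpM2l; first exact: cabs_ge0.
    rewrite lerXn2r ?nnegrE ?cabs_ge0 ?divr_ge0//.
    exact: (testfun_center x0 r0 s0 s_small).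
  apply: le_trans low (le_trans W _).
  rewrite lerD2r lerD2l.
  pose Z : set R := D `\` K.
  have mZ : measurable (Z : set R) by exact: measurableD.
  have Zab : Z `<=` `[a, b]%classic.
    move=> t [[/=]]; rewrite !in_itv /= => /andP[t1 t2] _ _.
    by rewrite /a /b; move: t1 t2 r0; clear=> *; apply/andP; split; lra.
  have IZ : \int[mu]_(t in Z) cabs (q t) <= eta.
    apply: ltW; apply: le_lt_trans (Hd Z mZ Kd).
    rewrite le_eqVlt; apply/orP; left; apply/eqP; apply: eq_Rintegral => t; rewrite inE => /Zab /=.
    by rewrite in_itv /= /cutoff ger0_norm ?cabs_ge0// => ->.
  pose qZ : R -> R := (fun t => cabs (q t)) \_ Z.
  have iqZ : mu.-integrable Z (EFin \o (fun t => cabs (q t))) by exact: integrableS icq.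
  have iZ : mu.-integrable `[a, b] (EFin \o qZ).
    apply: (@integrableS _ _ _ _ setT) => //.
    by rewrite /qZ -restrict_EFin -integrable_mkcond.
  have EZ : \int[mu]_(t in `[a, b]) qZ t = \int[mu]_(t in Z) cabs (q t).
    rewrite Rintegral_mkcond [RHS]Rintegral_mkcond; apply: eq_Rintegral => t _.
    rewrite patchE; case: ifPn => // tab; rewrite patchE ifN//.
    by apply: contra tab; rewrite !inE; exact: Zab.
  have tz (t : R) : (t +i* 0) != z0.
    by apply/eqP => -[_ /esym/eqP]; rewrite gt_eqF// divr_gt0.
  have iqk : cintegrable `[a, b] (fun t => q t * (H (t +i* 0) ^+ n * ((t +i* 0) - z0)^-1)).
    apply: cintegrable_mul_cont; [exact: ltW|exact: hd.1|move=> t _].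
    apply: (@pcont_hline _ (fun z => H z ^+ n * (z - z0)^-1)); apply: ccvgM; last exact: ccont_invr.
    by apply: ccvgX; apply: cdiff_cont; apply: cdiff_testfun.
  have lc := @Rintegral_lincomb R _ _ _ (8^-1 ^+ n) 1 mab icq iZ.
  apply: (@le_trans _ _ (16 / r * \int[mu]_(t in `[a, b]) (8^-1 ^+ n * cabs (q t) + 1 * qZ t))); last first.
    by rewrite ler_pM2l ?divr_gt0// lc mul1r EZ lerD2l.
  have ilc := @integrable_lincomb R _ _ _ (8^-1 ^+ n) 1 mab icq iZ.
  rewrite -RintegralZl//; apply: le_Rintegral => //.
  - exact: integrable_cabs.
  - exact: integrable_scale.
  move=> t tab; rewrite mul1r.
  have zi : 0 <= complex.Im (t +i* 0) by [].
  have tz0 : cabs ((t +i* 0) - z0)^-1 <= 16 / r.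
    rewrite cabsV -[16 / r]invf_div lef_pV2 ?posrE ?divr_gt0 ?cabs_gt0 ?subr_eq0//.
    apply: le_trans (cabs_ler_Im _); rewrite /= sub0r normrN; exact: ler_norm.
  have qZ0 : 0 <= qZ t by rewrite /qZ patchE; case: ifP => // _; exact: cabs_ge0.
  (* Four cases: [q] vanishes on [E]; far from [x0] the first factor of the weight is small; on [K]
     the peak is small; on the remaining set [Z] the weight is bounded by 1 and the integral of
     [|q|] by [eta]. *)
  have [Et|Et] := pselect (E t).
    by rewrite qE// mul0r cabs0 mulr0 add0r; apply: mulr_ge0 => //; rewrite divr_ge0// ltW.
  have kE : cabs (q t * (H (t +i* 0) ^+ n * ((t +i* 0) - z0)^-1)) =
      cabs ((t +i* 0) - z0)^-1 * (cabs (H (t +i* 0)) ^+ n * cabs (q t)).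
    by rewrite cabsM [X in _ * X]cabsM cabsX mulrCA [RHS]mulrCA; congr (_ * _); exact: mulrC.
  have small : cabs (H (t +i* 0)) <= 8^-1 -> cabs (q t * (H (t +i* 0) ^+ n * ((t +i* 0) - z0)^-1))
      <= 16 / r * (8^-1 ^+ n * cabs (q t) + qZ t).
    move=> Hs; apply: (@le_trans _ _ (16 / r * (8^-1 ^+ n * cabs (q t)))).
      rewrite kE; apply: ler_pM; rewrite ?mulr_ge0 ?exprn_ge0 ?cabs_ge0//.
      apply: ler_wpM2r; first exact: cabs_ge0.
      by rewrite lerXn2r ?nnegrE ?cabs_ge0.
    by rewrite ler_pM2l ?divr_gt0// lerDl.
  have [tin|tout] := boolP (x0 - r / 2 < t < x0 + r / 2); last first.
    apply: small; apply: far => //; apply: le_trans (cabs_ler_Re _); rewrite ReD ReN /=.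
    rewrite leNgt; apply: contra tout; rewrite ltr_norml => /andP[].
    by clear=> t1 t2; apply/andP; split; lra.
  have [Kt|Kt] := pselect (K t).
    have [p ps tp] := Ks t Kt.
    by apply: small; exact: (testfun_peak x0 r0 s0 ps tp).
  have Zt : Z t by split => //; split => //=; rewrite in_itv.
  have qZE : qZ t = cabs (q t) by rewrite /qZ patchE mem_set.
  apply: (@le_trans _ _ (16 / r * qZ t)).
    rewrite qZE kE; apply: ler_pM; rewrite ?mulr_ge0 ?exprn_ge0 ?cabs_ge0//.
    rewrite -[leRHS]mul1r; apply: ler_wpM2r; first exact: cabs_ge0.
    by apply: exprn_ile1; [exact: cabs_ge0|exact: (testfun_le1 x0 r0 s0 zi)].
  by rewrite ler_pM2l ?divr_gt0// lerDr mulr_ge0 ?exprn_ge0 ?cabs_ge0.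
have l0 := cabs_ge0 l.
apply/eqP; rewrite -cabs_eq0; apply/eqP.
(* After multiplication by [8 ^+ n] the right side of [main] is [(20 * M + 16 * Q + 32 * M * n) / r]
   up to an arbitrarily small error; this constant times [n.+1] dominates it. *)
apply: (@geometric_vanish _ ((32 * M + 16 * Q) / r)) => //.
  by rewrite divr_ge0 ?addr_ge0 ?mulr_ge0// ltW.
move=> n; apply: (@le_trans _ _ (2 * pi * (cabs l * 3 ^+ n))).
  rewrite -[leLHS]mul1r; apply: ler_wpM2r; first by rewrite mulr_ge0 ?exprn_ge0.
  by have := pi_ge2 R; lra.
have n8 : 0 < 8 ^+ n :> R by rewrite exprn_gt0.
apply/ler_addgt0Pr => eps eps0.
(* [n] is fixed here, so [eta] may depend on it: multiplied by [16 / r] and [8 ^+ n], it becomes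
   [eps]. *)
have eta0 : 0 < eps * r / 16 / 8 ^+ n by rewrite !divr_gt0 ?mulr_gt0.
have := main n _ eta0; rewrite -(ler_pM2r n8).
have -> : 2 * pi * (cabs l * (3 / 8) ^+ n) * 8 ^+ n = 2 * pi * (cabs l * 3 ^+ n).
  rewrite expr_div_n; field; exact: lt0r_neq0.
move=> /le_trans; apply; rewrite exprVn.
have -> : (2 * (M * ((8 ^+ n)^-1 * (2 / r))) + 16 / r * ((8 ^+ n)^-1 * Q + eps * r / 16 / 8 ^+ n) +
   M * ((8 ^+ n)^-1 * (8 * n%:R + 4) / r ^+ 2) * (b - a + 2 * r)) * 8 ^+ n =
   (20 * M + 16 * Q + 32 * M * n%:R) / r + eps.
  by rewrite /a /b; field; rewrite !gt_eqF.
have e1 : n.+1%:R = n%:R + 1 :> R by rewrite natr1.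
rewrite lerD2r e1 [leRHS]mulrAC ler_pM2r ?invr_gt0//.
have nn : 0 <= n%:R :> R by [].
have : 0 <= Q * n%:R by rewrite mulr_ge0.
by move: M0 nn; set x := n%:R; clear; lra.
Qed.

Theorem boundary_nonzero (F : C -> C) (q : R -> C) a b (M : R) :
  (forall z, cabs (F z) <= M) -> (forall z, ccont F z) ->
  (forall z, 0 < complex.Im z -> cdiffable F z) ->
  (forall x s t : R, 0 < s -> 0 < t -> F (x +i* s) = F (x +i* t) -> s = t) ->
  has_density (fun t => F (t +i* 0)) q a b ->
  {ae mu, forall u, a < u < b -> q u != 0}.
Proof.
move=> FM cF dF Finj hd.
have mab : measurable (`[a, b]%classic : set R) by exact: measurable_itv.
have [mR mI] := cintegrable_measurable hd.1.
pose E : set R := (`[a, b]%classic `&` (fun t => complex.Re (q t)) @^-1` [set 0]) `&`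
  (`[a, b]%classic `&` (fun t => complex.Im (q t)) @^-1` [set 0]).
have mE : measurable E.
  by apply: measurableI; [exact: mR|exact: mI].
have qE t : E t -> q t = 0.
  by move=> [[_ tR] [_ tI]]; apply: complex_ext.
(* Almost everywhere the density of [E] equals its indicator, so a zero of [q] may be taken to be a
   density point of the zero set. *)
apply: ae_imply (lebesgue_density mE) => x + /andP[ax xb]; apply: contraPN => /eqP qx.
have Ex : E x.
  by split; split; rewrite /= ?in_itv /= ?qx// ?(ltW ax) ?(ltW xb).
rewrite indicE mem_set// => dens.
(* For a ball of radius [r / 2] this is the bound [r / 1024] of [vanishing_derivative]. *)
have near_small : \forall r \near 0^'+, (mu (ball x r `\` E) < (2 * r / 1024)%:E)%E.
  have /fine_cvgP[_ /cvgrPdist_lt /(_ (1024^-1))] := dens.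
  rewrite invr_gt0 ltr0n => /(_ isT) H; near=> r.
  have r0 : 0 < r by near: r; exact: nbhs_right_gt.
  have mB : measurable (ball x r : set R) by exact: measurable_ball.
  have muB : mu (ball x r) = (2 * r)%:E by rewrite lebesgue_measure_ball ?ltW// mulr_natl.
  have fB : mu (ball x r) \is a fin_num by rewrite muB.
  have fI : mu (E `&` ball x r) \is a fin_num.
    rewrite ge0_fin_numE//; apply: (@le_lt_trans _ _ (mu (ball x r))); last by rewrite muB ltry.
    by apply: le_measure; rewrite ?inE//; exact: measurableI.
  have : `|1 - fine (mu (E `&` ball x r) / mu (ball x r))%E| < 1024^-1 by near: r; exact: H.
  have DI : mu (ball x r) = (mu (ball x r `\` E) + mu (ball x r `&` E))%E by exact: measureDI.
  rewrite muB inver gt_eqF ?mulr_gt0// -[X in (X * _)%E](fineK fI) -EFinM /= ltr_norml => /andP[_].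
  rewrite ltrBlDr -ltrBlDl ltr_pdivlMr ?mulr_gt0// => h.
  move: DI; rewrite muB [_ `&` E]setIC -[X in _ = (_ + X)%E](fineK fI).
  have fD : mu (ball x r `\` E) \is a fin_num.
    rewrite ge0_fin_numE//; apply: (@le_lt_trans _ _ (mu (ball x r))); last by rewrite muB ltry.
    by apply: le_measure; rewrite ?inE//; exact: measurableD.
  by rewrite -(fineK fD) -EFinD lte_fin => -[]; move: h; lra.
have [r0 r00 small] : exists2 r0 : R, 0 < r0 & forall r : R, 0 < r -> r < r0 ->
    (mu (ball x r `\` E) < (2 * r / 1024)%:E)%E.
  move: near_small; rewrite near_withinE => /nbhs_ballP[d d0 H]; exists d => // r r0 rd.
  by apply: H => //; rewrite /ball /= sub0r normrN gtr0_norm.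
pose m := Num.min (r0 * 2) (Num.min (x - a) (b - x)).
have m0 : 0 < m by rewrite !lt_min mulr_gt0// !subr_gt0 ax.
have zero r l : 0 < r -> r < m -> cdiff F (x +i* (r / 16)) l -> l = 0.
  move=> r1; rewrite !lt_min => /andP[rr /andP[ra rb]].
  have r2 : 0 < r / 2 by rewrite divr_gt0.
  have r3 : r / 2 < r0 by rewrite ltr_pdivrMr.
  apply: (vanishing_derivative (q := q) (E := E) r1 FM cF dF) => //.
    split; first by apply: cintegrableS hd.1 => //; apply: subset_itv; rewrite bnd_simp; lra.
    by move=> s t xs st tx; apply: hd.2 => //; lra.
  have := small _ r2 r3; rewrite ball_itv.
  by rewrite (_ : 2 * (r / 2) = r)//; field.
have m16 : 0 < m / 16 by rewrite divr_gt0.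
have E12 : F (x +i* (m / 64)) = F (x +i* (m / 32)).
  apply/eqP; rewrite eq_sym -subr_eq0; apply/eqP.
  have le12 : m / 64 <= m / 32 by lra.
  have <- : cint `[m / 64, m / 32] (fun=> 0 : C) = F (x +i* (m / 32)) - F (x +i* (m / 64)).
    apply: (@cint_FTC _ (fun t => F (x +i* t))) => // t tm; first exact: ccvg_cst.
    case/andP: tm => t1 t2; have t0 : 0 < t by lra.
    have [l dl] := dF (x +i* t) t0.
    have l0 : l = 0.
      (* Height [t] is reached with the radius [16 * t], which is at most [m / 2]. *)
      apply: (zero (16 * t)); [lra|lra|].
      by rewrite (_ : 16 * t / 16 = t)//; field.
    by have := rdiff_vline dl; rewrite l0 mul0r.
  by rewrite cint_cst// mulr0.
have := Finj x (m / 64) (m / 32) ltac:(lra) ltac:(lra) E12; lra.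
Unshelve. all: by end_near. Qed.

End Uniqueness.

(** * Arguments of points on the unit circle *)

Section Arcs.
Variable R : realType.
Local Notation C := R[i].
Implicit Types (p : R -> C) (u v s t m : R).

Lemma cos_cos_le (x : R) : - (pi / 2) < x < pi / 2 -> 0 < cos x.
Proof. by move=> /andP[h1 h2]; apply: cos_gt0_pihalf; rewrite h1. Qed.

(* The branch of the argument centred at [m], by the half-angle formula. *)
Definition arg m (z : C) : R := let z' := z * cis (- m) in
  m + 2 * atan (complex.Im z' / (1 + complex.Re z')).

Lemma cisN_cis m v : cis v * cis (- m) = cis (v - m).
Proof. by rewrite cisD. Qed.

Lemma one_add_cos (x : R) : 1 + cos x = 2 * cos (x / 2) ^+ 2.
Proof.
have -> : cos x = cos (x / 2 + x / 2) by rewrite -splitr.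
by have := cos2Dsin2 (x / 2); rewrite cosD !expr2; lra.
Qed.

Lemma arg_cis m v : `|v - m| < pi -> arg m (cis v) = v.
Proof.
move=> vm; rewrite /arg cisN_cis /=; set x := v - m.
have hx : - (pi / 2) < x / 2 < pi / 2.
  by move: vm; rewrite ltr_norml -/x => /andP[h1 h2]; apply/andP; split; lra.
have c0 : 0 < cos (x / 2) by exact: cos_cos_le.
have -> : sin x / (1 + cos x) = tan (x / 2).
  rewrite one_add_cos /tan {1}(splitr x) sinD.
  by field; rewrite gt_eqF.
rewrite tanK; last by rewrite in_itv.
by rewrite /x; field.
Qed.

(** The excluded value [-1] means that [z] is opposite to [cis m], where the half-angle quotient has
    denominator 0. *)
Lemma cis_arg m (z : C) : cabs z = 1 -> complex.Re (z * cis (- m)) != -1 ->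
  cis (arg m z) = z.
Proof.
move=> z1 zm; rewrite /arg; set w := z * cis (- m).
have w1 : complex.Re w ^+ 2 + complex.Im w ^+ 2 = 1.
  by rewrite -cabs_sqr cabsM z1 cabs_cis mulr1 expr1n.
suff : cis (2 * atan (complex.Im w / (1 + complex.Re w))) = w.
  by rewrite cisD => ->; rewrite mulrCA -cisD subrr cis0 mulr1.
have n0 : 1 + complex.Re w != 0 by rewrite addrC addr_eq0.
set a := atan _; have ta : tan a = complex.Im w / (1 + complex.Re w) by rewrite atanK.
have c0 : 0 < cos a by apply: cos_cos_le; rewrite atan_gtNpi2 atan_ltpi2.
have sa : sin a = complex.Im w / (1 + complex.Re w) * cos a.
  by rewrite -ta /tan divfK// gt_eqF.
have n1 : (1 + complex.Re w) ^+ 2 + complex.Im w ^+ 2 != 0.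
  by rewrite paddr_eq0 ?sqr_ge0// negb_and !sqrf_eq0 n0.
have c2 : cos a ^+ 2 = (1 + complex.Re w) / 2.
  have := cos2Dsin2 a; rewrite sa.
  have -> : cos a ^+ 2 + (complex.Im w / (1 + complex.Re w) * cos a) ^+ 2 =
     cos a ^+ 2 * (((1 + complex.Re w) ^+ 2 + complex.Im w ^+ 2) / (1 + complex.Re w) ^+ 2).
    by field.
  have -> : (1 + complex.Re w) ^+ 2 + complex.Im w ^+ 2 = 2 * (1 + complex.Re w).
    have -> : (1 + complex.Re w) ^+ 2 + complex.Im w ^+ 2 =
      1 + 2 * complex.Re w + (complex.Re w ^+ 2 + complex.Im w ^+ 2) by ring.
    by rewrite w1; ring.
  have -> : 2 * (1 + complex.Re w) / (1 + complex.Re w) ^+ 2 = 2 / (1 + complex.Re w).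
    by field.
  move=> H; have h0 : 2 / (1 + complex.Re w) != 0.
    by rewrite mulf_neq0// invr_eq0.
  by apply: (mulIf h0); rewrite H; field.
rewrite (_ : 2 * a = a + a); last by ring.
apply: complex_ext; rewrite /cis /=.
  rewrite cosD sa.
  have -> : cos a * cos a - complex.Im w / (1 + complex.Re w) * cos a *
     (complex.Im w / (1 + complex.Re w) * cos a) = cos a ^+ 2 *
     (((1 + complex.Re w) ^+ 2 - complex.Im w ^+ 2) / (1 + complex.Re w) ^+ 2) by field.
  have -> : complex.Im w ^+ 2 = 1 - complex.Re w ^+ 2 by lra.
  by rewrite c2; field.
rewrite sinD sa.
have -> : complex.Im w / (1 + complex.Re w) * cos a * cos a +
   cos a * (complex.Im w / (1 + complex.Re w) * cos a) = cos a ^+ 2 *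
   (2 * complex.Im w / (1 + complex.Re w)) by field.
by rewrite c2; field.
Qed.

Lemma continuous_cis t : ccvg (nbhs t) (@cis R) (cis t).
Proof.
by apply/ccvgP; split; [exact: continuous_cos|exact: continuous_sin].
Qed.

Lemma cvg_arg {T : Type} (F : set_system T) {FF : Filter F} (f : T -> C) m (z : C) :
  complex.Re (z * cis (- m)) != -1 -> ccvg F f z -> arg m (f x) @[x --> F] --> arg m z.
Proof.
move=> zm fz.
have /ccvgP[cR cI] : ccvg F (fun x => f x * cis (- m)) (z * cis (- m)).
  by apply: ccvgM => //; exact: ccvg_cst.
apply: cvgD; first exact: cvg_cst.
apply: cvgM; first exact: cvg_cst.
apply: (cvg_comp _ atan); last exact: continuous_atan.
apply: cvgM => //; apply: cvgV; first by rewrite addrC addr_eq0.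
by apply: cvgD => //; exact: cvg_cst.
Qed.

Lemma cis_near_arg m v : `|v - m| < pi -> complex.Re (cis v * cis (- m)) != -1.
Proof.
move=> vm; rewrite cisN_cis /=; set x := v - m.
have hx : - (pi / 2) < x / 2 < pi / 2.
  by move: vm; rewrite ltr_norml -/x => /andP[h1 h2]; apply/andP; split; lra.
have c0 : 0 < cos (x / 2) by exact: cos_cos_le.
rewrite -addr_eq0 addrC one_add_cos.
by rewrite mulf_neq0// sqrf_eq0 gt_eqF.
Qed.

(** The branch of the argument centred at the midpoint of [u] and [v] recovers both. *)
Lemma cis_inj_lt u v : `|u - v| < 2 * pi -> cis u = cis v -> u = v.
Proof.
move=> uv E; pose m := (u + v) / 2.
have um : `|u - m| < pi.
  by rewrite /m (_ : u - (u + v) / 2 = (u - v) / 2); [rewrite normrM (ger0_norm (x := 2^-1))//; lra|lra].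
have vm : `|v - m| < pi.
  by rewrite /m (_ : v - (u + v) / 2 = - ((u - v) / 2)); [rewrite normrN normrM (ger0_norm (x := 2^-1))//; lra|lra].
by rewrite -(arg_cis um) E arg_cis.
Qed.

Lemma cis2pi u : cis (u + 2 * pi) = cis u.
Proof. by rewrite /cis mulr_natl cosD2pi sinD2pi. Qed.


End Arcs.

(** * The boundary map as a parametrization of the Jordan curve *)

Section ArcLength.
Variable R : realType.
Local Notation C := R[i].
Implicit Types (p : R -> C) (u v m : R).

Lemma connected_between {X : topologicalType} (A B : set X) :
  connected A -> A `<=` B -> B `<=` closure A -> connected B.
Proof.
move=> cA AB BA E [x Ex] [U oU EU] [V cV EV].
have Bx : B x by move: Ex; rewrite EU => -[].
have Ux : U x by move: Ex; rewrite EU => -[].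
have AE : A `&` U = A.
  apply: cA.
  - by have [y [Ay Uy]] := BA x Bx U (open_nbhs_nbhs (conj oU Ux)); exists y.
  - by exists U.
  - exists V => //; apply/seteqP; split=> y [Ay yU]; split=> //.
      by have : E y by [rewrite EU; split => //; exact: AB]; rewrite EV => -[].
    by have : E y by [rewrite EV; split => //; exact: AB]; rewrite EU => -[].
have AV : A `<=` V.
  move=> y Ay; have : E y by rewrite EU; split; [exact: AB|have [] : (A `&` U) y by rewrite AE].
  by rewrite EV => -[].
apply/seteqP; split=> y; first by rewrite EV => -[].
move=> By; rewrite EV; split => //; have := BA y By.
by rewrite [X in _ -> X y]((closure_id V).1 cV); exact: closureS.
Qed.

Lemma polygon_length_map p q (f : R -> R) l : (forall u, u \in l -> p u = q (f u)) ->
  polygon_length p l = polygon_length q (map f l).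
Proof.
move=> pq; rewrite /polygon_length size_map; apply: eq_bigr => j _.
have j1 : (j.+1 < size l)%N by rewrite -ltn_predRL.
by rewrite !(nth_map 0)// ?(ltnW j1)// !pq ?mem_nth// ltnW.
Qed.

Lemma polygon_length_rev p l : polygon_length p (rev l) = polygon_length p l.
Proof.
rewrite /polygon_length size_rev (reindex_inj rev_ord_inj)/=; apply: eq_bigr => j _.
have j1 : (j.+1 < size l)%N by rewrite -ltn_predRL.
rewrite nth_rev; last by lia.
rewrite nth_rev; last by lia.
by rewrite cabs_distC; congr (cabs (p (nth _ _ _) - p (nth _ _ _))); lia.
Qed.

Lemma within_ccvg (f : C -> C) (A : set C) {T : Type} (F : set_system T) {FF : Filter F}
    (c : T -> C) (l : C) : {within A, continuous f} -> A l ->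
  (\forall x \near F, A (c x)) -> ccvg F c l -> ccvg F (f \o c) (f l).
Proof.
move=> cf Al Ac cl e e0.
have : nbhs (f l) [set z | cabs (z - f l) < e] by apply/nbhsC; exists e.
move: (cf) => /subspace_continuousP /(_ l Al) H /H /= /nbhsC [d d0 Hd].
by apply: filterS2 Ac (cl d d0) => x Ax cx; exact: Hd.
Qed.

(** The change of parameter [f] is continuous and injective on an interval, hence monotone. It
    carries inscribed polygons to inscribed polygons, in reverse order if it decreases. *)
Lemma arc_length_le (P Q Qi : C -> C) a b m (J : interval R) :
  (forall v, v \in J -> `|v - m| < pi) ->
  (forall v, Qi (Q (cis v)) = cis v) ->
  (forall u, u \in `[a, b] -> exists2 v, v \in J & P (cis u) = Q (cis v)) ->
  (forall u, u \in `[a, b] ->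
     ccvg (within [set` `[a, b]] (nbhs u)) (fun u => Qi (P (cis u))) (Qi (P (cis u)))) ->
  {in `[a, b] &, injective (P \o @cis R)} ->
  (curve_length (P \o @cis R) `[a, b] <= curve_length (Q \o @cis R) J)%E.
Proof.
move=> Jm QiQ PQ cPQ Pinj.
pose f u := arg m (Qi (P (cis u))).
have fP u : u \in `[a, b] -> f u \in J /\ P (cis u) = Q (cis (f u)).
  move=> /PQ[v vJ E]; have fv : f u = v by rewrite /f E QiQ arg_cis// Jm.
  by rewrite fv.
have cf : {within [set` `[a, b]], continuous f}.
  apply/subspace_continuousP => u uI; apply: cvg_arg; last exact: cPQ.
  by have [v vJ E] := PQ u uI; rewrite E QiQ; apply: cis_near_arg; exact: Jm.
have finj : {in `[a, b] &, injective f}.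
  move=> u v uI vI fuv; apply: Pinj => //=.
  by rewrite (fP u uI).2 (fP v vI).2 fuv.
apply: ge_ereal_sup => _ [l [sl lI] <-].
have pl : polygon_length (P \o @cis R) l = polygon_length (Q \o @cis R) (map f l).
  by apply: polygon_length_map => u ul /=; exact: (fP u (lI u ul)).2.
have lall : all (mem `[a, b]) l by apply/allP.
have fJ x : x \in map f l -> x \in J by move=> /mapP[u ul ->]; exact: (fP u (lI u ul)).1.
have [fi|fd] := itv_continuous_inj_mono cf finj.
  apply: ereal_sup_ubound; exists (map f l); last by rewrite pl.
  by split; [exact: (homo_sorted_in fi)|exact: fJ].
apply: ereal_sup_ubound; exists (rev (map f l)); last by rewrite polygon_length_rev pl.
split; last by move=> x; rewrite mem_rev; exact: fJ.
rewrite rev_sorted; apply: (homo_sorted_in _ lall sl) => x y xI yI xy; exact: fd.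
Qed.

(** A limit point [y] of the component that lies off [K] can be added to it without losing
    connectedness, so by maximality it already belongs to it. *)
Lemma component_boundary {X : topologicalType} (K : set X) (x : X) :
  closure (connected_component (~` K) x) `\` connected_component (~` K) x `<=` K.
Proof.
move=> y [yc yn]; apply: contrapT => yK; apply: yn.
have [xK|xK] := pselect ((~` K) x); last first.
  have E : connected_component (~` K) x = set0 by apply: connected_component_out.
  by rewrite E closure0 in yc.
pose B := connected_component (~` K) x `|` [set y].
apply: (@connected_component_max _ _ B x); last by right.
- by left; exact: connected_component_refl.
- by move=> z [/connected_component_sub//|->].
- apply: (@connected_between _ (connected_component (~` K) x)).
  + exact: component_connected.
  + by move=> z; left.
  + by move=> z [|->//]; exact: subset_closure.
Qed.

Lemma within_pcont (f : C -> C) (A : set C) (c : R -> C) u : {within A, continuous f} ->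
  (forall v, A (c v)) -> pcont c u -> pcont (f \o c) u.
Proof. by move=> cf Ac cc; apply: within_ccvg cf _ _ cc => //; exact: nearW. Qed.

Lemma circle_cis (z : C) : unit_circle z -> exists u, z = cis u.
Proof.
move=> z1; have [zm|zm] := eqVneq (complex.Re z) (-1); last first.
  by exists (arg 0 z); rewrite cis_arg// oppr0 cis0 mulr1.
exists pi; apply: complex_ext; rewrite /= ?cospi ?sinpi//.
apply/eqP; rewrite -sqrf_eq0; apply/eqP.
by have := cabs_sqr z; rewrite z1 zm; lra.
Qed.

Section Extension.
Variables (gamma : set C) (h : C -> C) (gammaP : jordan_curve gamma h).
Variables (G : set C) (GP : interior_of_jordan_curve gamma G).
Variables (J : set C) (s t : R) (st : s < t) (JP : arc_of h `]s, t[ J).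
Variable Phi : C -> C.
Hypothesis Phi_conf : conformal_onto (@unit_disk R) G Phi.
Hypothesis Phi_homeo : homeomorphism_onto (@closed_unit_disk R) (closure G) Phi.

(** The point lies in the closure of [G], but not in [G], whose points are already values of [Phi]
    on the open disk and [Phi] is injective on the closed one. Hence it is a boundary point of a
    component. *)
Lemma circle_image u : gamma (Phi (cis u)).
Proof.
have [_ [z0 zg GE]] := GP; have [_ [PG Pinj PS]] := Phi_conf.
have [[PGc Pinjc _] _ _] := Phi_homeo.
have cd : closed_unit_disk (cis u) by rewrite /closed_unit_disk /= cabs_cis.
apply: (@component_boundary _ gamma z0); rewrite -GE; split; first exact: PGc.
move=> /PS[w wd Pw].
have wc : closed_unit_disk w by rewrite /closed_unit_disk /=; exact: ltW.
have E : w = cis u by apply: Pinjc => //; apply: mem_set.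
by move: wd; rewrite E /unit_disk /= cabs_cis ltxx.
Qed.

Lemma circle_image_cont u : pcont (fun u => Phi (cis u)) u.
Proof.
have [_ cP _] := Phi_homeo; apply: (within_pcont (f := Phi) (c := @cis R) cP).
  by move=> v; rewrite /closed_unit_disk /= cabs_cis.
exact: continuous_cis.
Qed.

Lemma jordan_inverse : exists g : C -> C, [/\ forall v, g (h (cis v)) = cis v,
  forall u, pcont (fun u => g (Phi (cis u))) u & forall u, h (g (Phi (cis u))) = Phi (cis u) /\
  cabs (g (Phi (cis u))) = 1].
Proof.
have [[hg hinj hS] _ [g [cg hK]]] := gammaP; exists g.
have gh v : g (h (cis v)) = cis v by apply: hK; apply/mem_set; exact: cabs_cis.
split => // u.
  by apply: (within_pcont cg); [exact: circle_image|exact: circle_image_cont].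
have [z zc zE] := hS _ (circle_image u); have [v vE] := circle_cis zc.
by rewrite -zE vE gh cabs_cis.
Qed.

Lemma arc_width : t - s <= 2 * pi.
Proof.
rewrite leNgt; apply/negP => ts; have [hi _] := JP.
(* Half of the excess over [2 * pi]: it puts both [s + d] and [s + d + 2 * pi] inside the
   interval. *)
pose d := (t - s - 2 * pi) / 2; have d0 : 0 < d by rewrite divr_gt0// subr_gt0.
have pi0 := pi_gt0 R.
have : s + d + 2 * pi = s + d.
  apply: hi; rewrite ?in_itv /=; [|apply/andP; split|].
  - by apply/andP; split; rewrite /d; lra.
  - by rewrite /d; lra.
  - by rewrite /d; lra.
  - by rewrite /= cis2pi.
by move: pi0; lra.
Qed.

(** Openness of [J] in [gamma]: the argument of the preimage under [h] varies continuously and stays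
    in []s, t[]. *)
Lemma arc_good_near u : J (Phi (cis u)) ->
  \forall x \near u, exists2 v, v \in `]s, t[ & Phi (cis x) = h (cis v).
Proof.
have [g [gh cg hg]] := jordan_inverse; have w := arc_width.
have [_ JE] := JP; rewrite JE => -[v /= vst vE].
pose m := (s + t) / 2.
have vm : `|v - m| < pi by move: vst; rewrite in_itv /= ltr_norml /m => /andP[h1 h2]; apply/andP; split; lra.
have gE : g (Phi (cis u)) = cis v by rewrite -vE gh.
have Rm : complex.Re (g (Phi (cis u)) * cis (- m)) != -1 by rewrite gE; exact: cis_near_arg.
have ca : arg m (g (Phi (cis x))) @[x --> nbhs u] --> v.
  have : arg m (g (Phi (cis x))) @[x --> nbhs u] --> arg m (g (Phi (cis u))).
    by apply: cvg_arg => //; exact: cg.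
  by rewrite gE (arg_cis vm).
have cR : complex.Re (g (Phi (cis x)) * cis (- m)) @[x --> nbhs u] -->
    complex.Re (g (Phi (cis u)) * cis (- m)).
  have /ccvgP[] // : ccvg (nbhs u) (fun x => g (Phi (cis x)) * cis (- m)) (g (Phi (cis u)) * cis (- m)).
  by apply: ccvgM; [exact: cg|exact: ccvg_cst].
move: vst; rewrite in_itv /= => /andP[sv vt].
have H1 : \forall x \near u, s < arg m (g (Phi (cis x))) by exact: (cvgr_gt v ca).
have H2 : \forall x \near u, arg m (g (Phi (cis x))) < t by exact: (cvgr_lt v ca).
(* Nearby points also avoid the cut of [arg m], so that their argument really recovers them. *)
have Rm1 : -1 < complex.Re (g (Phi (cis u)) * cis (- m)).
  rewrite lt_neqAle eq_sym Rm /=; have := cabs_ler_Re (g (Phi (cis u)) * cis (- m)).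
  by rewrite cabsM (hg u).2 cabs_cis mulr1 ler_norml => /andP[].
have H3 : \forall x \near u, -1 < complex.Re (g (Phi (cis x)) * cis (- m)) by exact: (cvgr_gt _ cR).
apply: filterS3 H1 H2 H3 => x sx xt Rx; exists (arg m (g (Phi (cis x)))).
  by rewrite in_itv /= sx.
by have [hx gx] := hg x; rewrite cis_arg// gt_eqF.
Qed.

(** Provides the room on both sides: the end points of the compact arc are interior to [J], and on
    the longer arc the inscribed polygons are still bounded by the length of [J]. *)
Lemma arc_extension a b : a < b -> b < a + 2 * pi ->
  (forall u, u \in `[a, b] -> J (Phi (cis u))) -> (curve_length (h \o @cis R) `]s, t[ < +oo)%E ->
  exists e L : R, [/\ 0 < e, b + e < a - e + 2 * pi & forall l, sorted <%R l ->
    {subset l <= `[a - e, b + e]} -> polygon_length (fun u => Phi (cis u)) l <= L].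
Proof.
move=> ab ba Jab fin.
have [g [gh cg hg]] := jordan_inverse.
have aI : a \in `[a, b] by rewrite in_itv /= lexx ltW.
have bI : b \in `[a, b] by rewrite in_itv /= lexx ltW.
have /nbhs_ballP[d1 /= d10 H1] := arc_good_near (Jab a aI).
have /nbhs_ballP[d2 /= d20 H2] := arc_good_near (Jab b bI).
(* The last bound keeps the enlarged interval shorter than [2 * pi], so that [cis] remains injective
   on it. *)
pose e := Num.min (Num.min (d1 / 2) (d2 / 2)) ((a + 2 * pi - b) / 4).
have e0 : 0 < e by rewrite !lt_min !divr_gt0// subr_gt0.
have : e <= e by []. rewrite {2}/e !le_min => /andP[/andP[ed1 ed2] ew].
have good u : u \in `[a - e, b + e] -> exists2 v, v \in `]s, t[ & Phi (cis u) = h (cis v).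
  rewrite in_itv /= => /andP[au ub]; have [ua|ua] := ltP u a.
    by apply: H1; rewrite /ball /= ger0_norm; lra.
  have [bu|bu] := ltP b u; first by apply: H2; rewrite /ball /= ler0_norm; lra.
  have := Jab u; rewrite in_itv /= ua bu => /(_ isT).
  by have [_ ->] := JP => -[v vst vE]; exists v.
have w := arc_width.
have main : (curve_length (Phi \o @cis R) `[(a - e)%R, (b + e)%R] <= curve_length (h \o @cis R) `]s, t[)%E.
  apply: (@arc_length_le Phi h g _ _ ((s + t) / 2)) => //.
  - by move=> v; rewrite in_itv /= ltr_norml => /andP[h1 h2]; apply/andP; split; lra.
  - move=> u _; move: (cg u) => + eps eps0 => /(_ eps eps0).
    exact: cvg_within.
  - move=> u v; rewrite !in_itv /= => /andP[u1 u2] /andP[v1 v2] E.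
    apply: cis_inj_lt; first by rewrite ltr_norml; apply/andP; split; lra.
    have [[_ Pinj _] _ _] := Phi_homeo.
    by apply: Pinj => //; apply/mem_set; rewrite /closed_unit_disk /= cabs_cis.
exists e, (fine (curve_length (h \o @cis R) `]s, t[)); split => //; first by lra.
move=> l sl lI; rewrite -lee_fin fineK; last first.
  rewrite ge0_fin_numE//; apply: le_trans main; apply: ereal_sup_ubound.
  by exists [::]; [split|rewrite /polygon_length big_ord0].
by apply: le_trans main; apply: ereal_sup_ubound; exists l.
Qed.

(** Length does not depend on the parametrization: [arc_length_le] in both directions, with the
    inverses of [h] and of [Phi]. *)
Lemma arc_length_eq a b (J' : set C) s' t' : a < b -> b < a + 2 * pi -> s' < t' ->
  arc_of h `[s', t'] J' -> J' = [set Phi (cis u) | u in `[a, b]] ->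
  curve_length (Phi \o @cis R) `[a, b] = curve_length (h \o @cis R) `[s', t'].
Proof.
move=> ab ba st' [hinj J'E] J'P; have pi0 := pi_gt0 R.
have [g [gh cg hg]] := jordan_inverse.
have [[PG Pinj _] cP [gP [cgP gPK]]] := Phi_homeo.
have [_ ch _] := gammaP.
(* The bound is strict because the end points of a compact arc belong to it and have different
   images. *)
have w' : t' - s' < 2 * pi.
  rewrite ltNge; apply/negP => w'.
  have : s' + 2 * pi = s'.
    apply: hinj; rewrite ?in_itv /=; [|by rewrite lexx ltW|by rewrite cis2pi].
    by apply/andP; split; lra.
  by lra.
have cd u : closed_unit_disk (cis u) by rewrite /closed_unit_disk /= cabs_cis.
have Pv u : u \in `[a, b] -> exists2 v, v \in `[s', t'] & Phi (cis u) = h (cis v).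
  move=> uI; have : J' (Phi (cis u)) by rewrite J'P; exists u.
  by rewrite J'E => -[v vI vE]; exists v.
have hv v : v \in `[s', t'] -> exists2 u, u \in `[a, b] & h (cis v) = Phi (cis u).
  move=> vI; have : J' (h (cis v)) by rewrite J'E; exists v.
  by rewrite J'P => -[u uI uE]; exists u.
apply/eqP; rewrite eq_le; apply/andP; split.
  apply: (@arc_length_le Phi h g _ _ ((s' + t') / 2)) => //.
  - by move=> v; rewrite in_itv /= ltr_norml => /andP[h1 h2]; apply/andP; split; lra.
  - by move=> u _; move: (cg u) => + eps eps0 => /(_ eps eps0); exact: cvg_within.
  - move=> u v; rewrite !in_itv /= => /andP[u1 u2] /andP[v1 v2] E.
    apply: cis_inj_lt; first by rewrite ltr_norml; apply/andP; split; lra.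
    by apply: Pinj => //; apply/mem_set.
apply: (@arc_length_le h Phi gP _ _ ((a + b) / 2)) => //.
- by move=> v; rewrite in_itv /= ltr_norml => /andP[h1 h2]; apply/andP; split; lra.
- by move=> v; apply: gPK; exact/mem_set.
- move=> v vI; apply: (within_ccvg (c := h \o @cis R) cgP).
  + by have [u _ ->] := hv v vI; exact: PG.
  + by rewrite near_withinE; apply: nearW => x /hv[u _ /= ->]; exact: PG.
  + have : pcont (h \o @cis R) v.
      by apply: (within_pcont ch); [move=> x; exact: cabs_cis|exact: continuous_cis].
    by move=> + eps eps0 => /(_ eps eps0); exact: cvg_within.
Qed.

End Extension.

End ArcLength.

(** * The logarithmic coordinate *)

Section Strip.
Variable R : realType.
Local Notation C := R[i].
Implicit Types (z w : C).

Lemma slope_remainder (f : R -> R) (l : R) : is_derive (0 : R) (1 : R) f l ->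
  exists2 r : R -> R, r x @[x --> (0 : R)] --> (0 : R) & forall x, f x = f 0 + x * (l + r x).
Proof.
move=> [df <-].
exists (fun x => if x == 0 then 0 else (f x - f 0) / x - 'D_1 f 0).
  have : h^-1 *: ((f \o shift 0) (h *: 1) - f 0) @[h --> 0^'] --> 'D_1 f 0 by exact: df.
  move=> /cvgrPdist_lt H; apply/cvgrPdist_lt => e e0.
  have := H e e0; rewrite near_withinE; apply: filterS => x Hx.
  case: eqVneq => [_|x0]; first by rewrite subrr normr0.
  have := Hx x0; rewrite sub0r normrN distrC /= addr0 /GRing.scale /= mulr1.
  by rewrite [x^-1 * _]mulrC.
move=> x; case: eqVneq => [->|x0]; first by rewrite mul0r addr0.
by rewrite addrCA subrr addr0 mulrC divfK// addrC subrK.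
Qed.

Lemma cdiff_remainder (f : C -> C) z l (r : C -> R) :
  (forall w, cabs (f w - f z - l * (w - z)) <= r w * cabs (w - z)) ->
  r w @[w --> cnbhs z] --> (0 : R) -> cdiff f z l.
Proof.
move=> fr /cvgrPdist_lt r0.
exists (fun w => if w == z then l else (f w - f z) / (w - z)); split.
- rewrite /ccont eqxx => e e0; have := r0 e e0; apply: filterS => w.
  rewrite sub0r normrN => rw; case: eqVneq => [_|wz].
    by rewrite subrr cabs0.
  have wz0 : 0 < cabs (w - z) by rewrite cabs_gt0 subr_eq0.
  have -> : (f w - f z) / (w - z) - l = (f w - f z - l * (w - z)) / (w - z).
    by field; rewrite subr_eq0.
  rewrite cabsM cabsV ltr_pdivrMr//; apply: le_lt_trans (fr w) _.
  by rewrite ltr_pM2r//; apply: le_lt_trans rw; exact: ler_norm.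
- by rewrite eqxx.
- apply: nearW => w; case: eqVneq => [->|wz0].
    by rewrite subrr mulr0 addr0.
  by rewrite divfK ?subr_eq0// addrC subrK.
Qed.

(* [expi z = exp (i z)] *)
Definition expi z : C := (expR (- complex.Im z))%:C * cis (complex.Re z).

Lemma expiD z w : expi (z + w) = expi z * expi w.
Proof.
by rewrite /expi ReD ImD opprD expRD cisD rmorphM /=; ring.
Qed.

Lemma cabs_expi z : cabs (expi z) = expR (- complex.Im z).
Proof. by rewrite /expi cabsM cabs_cis mulr1 cabs_real gtr0_norm ?expR_gt0. Qed.

Lemma expi_neq0 z : expi z != 0.
Proof. by rewrite -cabs_gt0 cabs_expi expR_gt0. Qed.

Lemma expi_real (t : R) : expi (t +i* 0) = cis t.
Proof. by rewrite /expi /= oppr0 expR0 mul1r. Qed.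

Lemma cvg_Re_Im z : complex.Re w @[w --> cnbhs z] --> complex.Re z /\
  complex.Im w @[w --> cnbhs z] --> complex.Im z.
Proof. by have /ccvgP := ccont_id z. Qed.

(** The real derivatives of [expR], [cos] and [sin] at 0 with explicit remainders suffice; [expiD]
    moves the result to every point. *)
Lemma cdiff_expi0 : cdiff expi 0 'i.
Proof.
have [re re0 reE] : exists2 r : R -> R, r x @[x --> (0 : R)] --> (0 : R) &
    forall x, expR x = 1 + x * (1 + r x).
  have [r r0 rE] := slope_remainder (is_derive_expR (0 : R)).
  by rewrite expR0 in rE; exists r.
have [rc rc0 rcE] : exists2 r : R -> R, r x @[x --> (0 : R)] --> (0 : R) &
    forall x, cos x = 1 + x * r x.
  have [r r0 rE] := slope_remainder (is_derive_cos (0 : R)).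
  by exists r => // x; rewrite rE sin0 cos0 oppr0 add0r.
have [rs rs0 rsE] : exists2 r : R -> R, r x @[x --> (0 : R)] --> (0 : R) &
    forall x, sin x = x * (1 + r x).
  have [r r0 rE] := slope_remainder (is_derive_sin (0 : R)).
  by exists r => // x; rewrite rE sin0 cos0 add0r.
pose k w : C := (expR (- complex.Im w))%:C * (rc (complex.Re w) +i* (1 + rs (complex.Re w))) - 'i.
apply: (@cdiff_remainder _ _ _ (fun w => `|re (- complex.Im w)| + cabs (k w))).
  move=> w; rewrite subr0 mulrDl.
  have -> : expi w - expi 0 - 'i * w = (- complex.Im w * re (- complex.Im w))%:C + (complex.Re w)%:C * k w.
    have e1 := reE (- complex.Im w).
    have E0 : expi 0 = 1 by rewrite /expi /= oppr0 expR0 cis0 mulr1.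
    rewrite E0 /expi /cis /k rcE rsE; move: e1; case: w => x y /=.
    set ey := expR _ => e1; apply: complex_ext; rewrite /= ?mul0r ?mul1r ?subr0 ?add0r ?addr0.
      have -> : - y * re (- y) = ey - 1 + y by rewrite e1; ring.
      by ring.
    by ring.
  apply: le_trans (cabsD _ _) _; rewrite cabs_real cabsM cabs_real normrM normrN mulrC.
  apply: lerD; first by rewrite ler_wpM2l ?cabs_ler_Im.
  by rewrite mulrC ler_wpM2l ?cabs_ge0 ?cabs_ler_Re.
have [cR cI] := cvg_Re_Im 0; rewrite /= in cR cI.
have cIN : - complex.Im w @[w --> cnbhs 0] --> (0 : R) by rewrite -[X in _ --> X]oppr0; exact: cvgN.
rewrite -[X in _ --> X]addr0; apply: cvgD.
  rewrite -[X in _ --> X](@normr0 R R); apply: cvg_norm; exact: (cvg_comp _ re cIN re0).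
rewrite -[X in _ --> X](@cabs0 R); apply: ccvg_cabs.
rewrite [X in ccvg _ _ X](_ : (0 : C) = (expR (0 : R))%:C * (0 +i* (1 + 0)) - 'i); last first.
  by rewrite expR0; apply: complex_ext => /=; ring.
apply: ccvgB; last exact: ccvg_cst.
apply: ccvgM.
  apply/ccvgP; split => /=; last exact: cvg_cst.
  exact: (cvg_comp _ (@expR R) cIN (@continuous_expR R 0)).
apply/ccvgP; split => /=; first exact: (cvg_comp _ rc cR rc0).
by apply: cvgD; [exact: cvg_cst|exact: (cvg_comp _ rs cR rs0)].
Qed.

Lemma cdiff_expi z : cdiff expi z ('i * expi z).
Proof.
have E : expi = fun w => expi z * expi (w - z).
  by apply/funext => w; rewrite -expiD addrC subrK.
have d := cdiff_comp (f := expi) (g := fun w => w - z) (cdiff_subr z z) _.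
rewrite {1}E; have := cdiffM (cdiff_cst (expi z) z) (d 'i _).
rewrite mul0r add0r subrr mulr1 mulrC; apply.
exact: cdiff_expi0.
Qed.

Lemma expi_cont z : ccont expi z.
Proof. exact: cdiff_cont (cdiff_expi z). Qed.

(** Even reflection in the real line makes the map continuous and bounded on the whole plane, as
    [ccont] on the bottom side of a rectangle demands; on the upper half-plane it is
    [Phi (expi w)]. *)
Definition strip (Phi : C -> C) w : C := Phi (expi (complex.Re w +i* `|complex.Im w|)).

Definition strip' (Phi : C -> C) w : C := derive1 Phi (expi w) * ('i * expi w).

Lemma strip_real (Phi : C -> C) (t : R) : strip Phi (t +i* 0) = Phi (cis t).
Proof. by rewrite /strip /= normr0 expi_real. Qed.

Lemma strip_upper (Phi : C -> C) w : 0 <= complex.Im w -> strip Phi w = Phi (expi w).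
Proof. by move=> w0; rewrite /strip ger0_norm//; case: w w0. Qed.

Lemma expi_disk w : 0 < complex.Im w -> unit_disk (expi w).
Proof. by move=> w0; rewrite /unit_disk /= cabs_expi -expR0 ltr_expR oppr_lt0. Qed.

Section ConformalMap.
Variables (G : set C) (Phi : C -> C) (Gbnd : bounded_set G).
Hypothesis Phi_conf : conformal_onto (@unit_disk R) G Phi.
Hypothesis Phi_homeo : homeomorphism_onto (@closed_unit_disk R) (closure G) Phi.

Lemma cdiff_conformal z : unit_disk z -> cdiff Phi z (derive1 Phi z).
Proof. by have [dP _] := Phi_conf => /dP /derivable_cdiff. Qed.

Lemma strip_cont w : ccont (strip Phi) w.
Proof.
have [_ cP _] := Phi_homeo.
apply: (within_ccvg (c := fun w => expi (complex.Re w +i* `|complex.Im w|)) cP).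
- by rewrite /closed_unit_disk /= cabs_expi /= -expR0 ler_expR oppr_le0.
- by apply: nearW => z; rewrite /closed_unit_disk /= cabs_expi /= -expR0 ler_expR oppr_le0.
- have [cR cI] := cvg_Re_Im w.
  apply: (ccvg_comp (h := fun w => complex.Re w +i* `|complex.Im w|) (f := expi)); last exact: expi_cont.
  by apply/ccvgP; split => //=; exact: cvg_norm.
Qed.

Lemma cdiff_strip w : 0 < complex.Im w -> cdiff (strip Phi) w (strip' Phi w).
Proof.
move=> w0; apply: (@cdiff_near _ (Phi \o expi)).
  have [_ cI] := cvg_Re_Im w.
  have : \forall z \near cnbhs w, 0 < complex.Im z by exact: (cvgr_gt _ cI).
  by apply: filterS => z z0; rewrite strip_upper// ltW.
apply: (cdiff_comp (f := Phi) (g := expi)); first exact: cdiff_expi.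
exact: cdiff_conformal (expi_disk w0).
Qed.

Lemma conformal_bounded : exists M : R, (forall z, closed_unit_disk z -> cabs (Phi z) <= M) /\
  forall w, cabs (strip Phi w) <= M.
Proof.
have [[PG _ _] _ _] := Phi_homeo.
have [M GM] : exists M : R, forall z, G z -> cabs z <= M.
  have [N [Nr HN]] := Gbnd; exists (complex.Re (N + 1)) => z Gz.
  have /HN : N < N + 1 by rewrite ltrDl.
  by move=> /(_ z Gz) /=; rewrite norm_cabs lecE => /andP[].
have cGM z : closure G z -> cabs z <= M.
  move=> cz; apply/ler_addgt0Pr => e e0.
  have [|y [Gy yz]] := cz [set y | cabs (y - z) < e]; first by apply/nbhsC; exists e.
  rewrite -[z](subrK y) addrC; apply: le_trans (cabsD _ _) _.
  by apply: lerD; [exact: GM|rewrite cabs_distC; exact: ltW].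
exists M; split=> [z zd|w]; first by apply: cGM; exact: PG.
by apply: cGM; apply: PG; rewrite /closed_unit_disk /= cabs_expi /= -expR0 ler_expR oppr_le0.
Qed.

(** The map has period [2 * pi], but on a vertical line the modulus of [expi] determines the
    height. *)
Lemma strip_inj (x s t : R) : 0 < s -> 0 < t ->
  strip Phi (x +i* s) = strip Phi (x +i* t) -> s = t.
Proof.
move=> s0 t0; rewrite !strip_upper ?ltW// => E.
have [_ [_ Pinj _]] := Phi_conf.
have /(congr1 (@cabs R)) : expi (x +i* s) = expi (x +i* t).
  by apply: Pinj => //; apply/mem_set; exact: expi_disk.
by rewrite !cabs_expi /= => /expR_inj /oppr_inj.
Qed.

End ConformalMap.

Lemma atan_le (v : R) : `|atan v| <= `|v|.
Proof.
suff H (x : R) : 0 <= x -> atan x <= x.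
  have [v0|v0] := leP 0 v.
    by rewrite !ger0_norm ?H// -(@atan0 R); exact: le_atan.
  rewrite !ltr0_norm//; last by rewrite -(@atan0 R) lt_atan.
  by rewrite -atanN H// oppr_ge0 ltW.
move=> x0.
have dat c : c \in `]0, x[ -> is_derive c 1 (@atan R) (1 + c ^+ 2)^-1.
  by move=> _; exact: is_derive1_atan.
have cat : {within `[0, x], continuous (@atan R)}.
  by apply: continuous_subspaceT => c; exact: continuous_atan.
have [c _] := MVT_segment x0 dat cat.
rewrite atan0 !subr0 => ->; rewrite ler_piMl// invf_le1.
  by rewrite lerDl sqr_ge0.
by rewrite ltr_pwDl// sqr_ge0.
Qed.

(* A point of the angle of half-opening [alpha] lies, in the logarithmic
   coordinate, in a cone [|x - u| <= k y]. *)
Lemma angle_log (u alpha : R) : 0 < alpha < pi / 2 -> exists k : R, 0 <= k /\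
  forall d : R, 0 < d -> exists2 r : R, 0 < r & forall z, unit_disk z -> angle_at (cis u) alpha z ->
    cabs (z - cis u) < r -> exists w, [/\ z = expi w, 0 < complex.Im w, complex.Im w < d &
      `|complex.Re w - u| <= k * complex.Im w].
Proof.
move=> /andP[a0 a2]; have ca : 0 < cos alpha by apply: cos_gt0_pihalf; rewrite a2 (lt_trans _ a0)// oppr_lt0 divr_gt0// pi_gt0.
(* At distance [rho] from the vertex the deviation of the argument is at most [4 * rho], and the
   height at least [rho * cos alpha / 4]. *)
exists (16 / cos alpha); split; first by rewrite divr_ge0// ltW.
(* With [rho] the distance from the vertex: [1 / 2] keeps [|v|] above [1 / 2], [cos alpha] gives
   [|v| ^ 2 <= 1 - rho * cos alpha], and [1 - expR (- d)] keeps the height below [d]. *)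
move=> d d0; exists (Num.min (Num.min 2^-1 (cos alpha)) (1 - expR (- d))).
  by rewrite !lt_min invr_gt0 ltr0n ca subr_gt0 -[ltRHS]expR0 ltr_expR oppr_lt0.
move=> z zd [rho [th [rho0 tha zE]]].
pose v : C := 1 - rho%:C * cis th.
have rz : cabs (z - cis u) = rho.
  by rewrite zE (_ : _ - _ = - (cis u * (rho%:C * cis th))); [rewrite cabsN !cabsM !cabs_cis mul1r mulr1 cabs_real gtr0_norm|rewrite mulrBr mulr1; ring].
rewrite rz !lt_min => /andP[/andP[r2 rc] rd].
have vE : cabs z = cabs v by rewrite zE cabsM cabs_cis mul1r.
have v1 : cabs v < 1 by rewrite -vE; exact: zd.
have vr : 1 - rho <= cabs v.
  have := cabsD v (rho%:C * cis th); rewrite subrK cabsM cabs_cis mulr1 cabs_real gtr0_norm//.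
  by rewrite (cabs_real 1) normr1; lra.
have v0 : 0 < cabs v by lra.
pose v' : C := (cabs v)^-1%:C * v.
have v'1 : cabs v' = 1 by rewrite /v' cabsM cabs_real ger0_norm ?invr_ge0 ?ltW// mulVf// gt_eqF.
have Rv : 0 < complex.Re v.
  rewrite /v /= !mul0r subr0; have := cos_le1 th => c1.
  have : rho * cos th <= rho * 1 by rewrite ler_wpM2l// ltW.
  by lra.
have Rv'E : complex.Re v' = (cabs v)^-1 * complex.Re v.
  by rewrite /v'; case: (v) (cabs v)^-1 => x y c /=; rewrite mul0r subr0.
have Iv'E : complex.Im v' = (cabs v)^-1 * complex.Im v.
  by rewrite /v'; case: (v) (cabs v)^-1 => x y c /=; rewrite mul0r addr0.
have Rv' : 0 < complex.Re v' by rewrite Rv'E mulr_gt0// invr_gt0.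
exists ((u + arg 0 v') +i* (- ln (cabs v))).
have ly : 0 < - ln (cabs v) by rewrite oppr_gt0 ln_lt0// v0.
have cav : cis (arg 0 v') = v'.
  by apply: cis_arg => //; rewrite oppr0 cis0 mulr1 gt_eqF// (lt_trans _ Rv')// ltrN10.
split => //=.
- rewrite /expi /= opprK lnK ?posrE// cisD cav zE -/v /v'.
  have cn : (cabs v)%:C != 0 :> C by rewrite -cabs_gt0 cabs_real gtr0_norm.
  by rewrite fmorphV /=; field.
- by rewrite ltrNl -ltr_expR lnK ?posrE//; apply: lt_le_trans vr; lra.
- rewrite addrAC subrr add0r.
  have Iv : `|complex.Im v| <= rho.
    rewrite /v /= mul0r addr0 sub0r normrN normrM gtr0_norm// ler_piMr ?(ltW rho0)//.
    by rewrite ler_norml sin_geN1 sin_le1.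
  have cth : cos alpha <= cos th.
    have thpi : `|th| <= pi by have := pi_gt0 R; lra.
    have -> : cos th = cos `|th|.
      by have [th0|th0] := leP 0 th; [rewrite ger0_norm|rewrite ltr0_norm// cosN].
    by apply: ltW; rewrite ltr_cos// in_itv /= ?normr_ge0//; lra.
  (* From [- ln |v| >= 1 - |v|] and the law of cosines for [|v| ^ 2]. *)
  have y_ge : rho * cos alpha / 4 <= - ln (cabs v).
    have l1 := expR_ge1Dx (ln (cabs v)); rewrite lnK ?posrE// in l1.
    have vsq : cabs v ^+ 2 = 1 - 2 * rho * cos th + rho ^+ 2.
      rewrite /v cabs_sqr /=; have := cos2Dsin2 th; nra.
    have : cabs v ^+ 2 <= 1 - rho * cos alpha.
      by rewrite vsq; nra.
    nra.
  have atl : `|arg 0 v'| <= 4 * rho.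
    rewrite /arg oppr0 cis0 mulr1 add0r normrM [`|2|]ger0_norm//.
    suff : `|complex.Im v' / (1 + complex.Re v')| <= 2 * rho.
      by move=> h; have := atan_le (complex.Im v' / (1 + complex.Re v')); lra.
    rewrite normrM normfV [`|1 + _|]gtr0_norm; last by rewrite ltr_wpDl.
    rewrite ler_pdivrMr; last by rewrite ltr_wpDl.
    rewrite Iv'E normrM gtr0_norm ?invr_gt0// mulrC ler_pdivrMr//.
    have : 2 * rho * 2^-1 <= 2 * rho * ((1 + complex.Re v') * cabs v).
      apply: ler_wpM2l; first by rewrite mulr_ge0// ltW.
      have : 0 < complex.Re v' * cabs v by rewrite mulr_gt0.
      by move: (complex.Re v') (cabs v) v0 vr r2 => x c; clear; lra.
    rewrite !mulrA; lra.
  apply: le_trans atl _.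
  have -> : 4 * rho = 16 / cos alpha * (rho * cos alpha / 4) by field; rewrite gt_eqF.
  by rewrite ler_wpM2l// divr_ge0// ltW.
Qed.

End Strip.

(** * Means over circular arcs *)

Section CircularMeans.
Variable R : realType.
Local Notation C := R[i].
Local Notation mu := (@lebesgue_measure R).

Lemma polar_expi (r u : R) : 0 < r -> r%:C * cis u = expi (u +i* - ln r) :> C.
Proof. by move=> r0; rewrite /expi /= opprK lnK. Qed.

Lemma cvg_opp_ln : - ln r @[r --> (1 : R)^'-] --> (0 : R)^'+.
Proof.
have cl : - ln r @[r --> (1 : R)] --> (0 : R).
  rewrite -[X in _ --> X]oppr0 -(@ln1 R); apply: cvgN; exact: continuous_ln.
move=> P [e /= e0 eP]; have /cvgrPdist_lt /(_ e e0) ne := cl.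
have n0 : \forall r \near (1 : R)^'-, 0 < r by exact: nbhs_left_gt.
have n1 : \forall r \near (1 : R)^'-, r < 1 by exact: nbhs_left_lt.
have n2 : \forall r \near (1 : R)^'-, `|0 - - ln r| < e by apply: cvg_within ne.
apply: filterS3 n0 n1 n2 => r r0 r1 re; apply: eP => //.
by rewrite oppr_gt0 ln_lt0// r0.
Qed.

Lemma cvg_invr1 : r^-1 @[r --> (1 : R)^'-] --> (1 : R).
Proof.
rewrite -[X in _ --> X]invr1; apply: cvgV; first exact: oner_neq0.
by apply: cvg_at_left_filter; exact: cvg_id.
Qed.

Lemma EFin_Rintegral (A : set R) (f : R -> R) : measurable A -> mu.-integrable A (EFin \o f) ->
  (\int[mu]_(x in A) (f x)%:E = (\int[mu]_(x in A) f x)%:E)%E.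
Proof. by move=> mA fi; rewrite /Rintegral fineK//; exact: integrable_fin_num. Qed.

Section BoundaryMeans.
Variables (F F' : C -> C) (q : R -> C) (a b M : R).
Hypothesis ab : a < b.
Hypothesis FM : forall z, cabs (F z) <= M.
Hypothesis dF : forall z, 0 < complex.Im z -> cdiff F z (F' z).
Hypothesis iq : cintegrable `[a, b] q.
Hypothesis F'q : \int[mu]_(x in `[a, b]) cabs (F' (x +i* y) - q x) @[y --> 0^'+] --> (0 : R).

Let mab : measurable (`[a, b]%classic : set R). Proof. exact: measurable_itv. Qed.

Let M0 : 0 <= M. Proof. by apply: le_trans (FM 0); exact: cabs_ge0. Qed.

Lemma cintegrable_hline (y : R) : 0 < y -> cintegrable `[a, b] (fun x => F' (x +i* y)).
Proof.
move=> y0; apply: cintegrable_cont => t _; apply: pcont_hline; exact: derivative_cont FM dF _.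
Qed.

Lemma mean_dist (y : R) : 0 < y ->
  `|\int[mu]_(x in `[a, b]) cabs (F' (x +i* y)) - \int[mu]_(x in `[a, b]) cabs (q x)| <=
  \int[mu]_(x in `[a, b]) cabs (F' (x +i* y) - q x).
Proof.
move=> y0; have iF := cintegrable_hline y0.
have i1 := integrable_cabs mab iF; have i2 := integrable_cabs mab iq.
have i3 := integrable_cabs mab (cintegrableB mab iF iq).
rewrite ler_distl lerBlDr -!RintegralD//; apply/andP; split.
  apply: le_Rintegral => //; first exact: integrable_add.
  by move=> x _ /=; rewrite [X in _ <= _ + X]cabs_distC; apply: le_trans (cabsD _ _); rewrite addrC subrK.
apply: le_Rintegral => //; first exact: integrable_add.
by move=> x _ /=; apply: le_trans (cabsD _ _); rewrite addrC subrK.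
Qed.

Lemma mean_cvg : \int[mu]_(x in `[a, b]) cabs (F' (x +i* y)) @[y --> 0^'+] -->
  \int[mu]_(x in `[a, b]) cabs (q x).
Proof.
apply/cvgrPdist_le => e e0; have /cvgrPdist_le /(_ e e0) := F'q.
have n0 : \forall y \near (0 : R)^'+, 0 < y by exact: nbhs_right_gt.
apply: filterS2 n0 => y y0; rewrite sub0r normrN => h.
by rewrite distrC; apply: le_trans (mean_dist y0) _; apply: le_trans h; exact: ler_norm.
Qed.

(** Near the real line the bound comes from convergence; at heights above [d] it comes from the
    Cauchy estimate on squares of half-side [d / 2]. *)
Lemma mean_bounded : exists K : R, forall y : R, 0 < y ->
  \int[mu]_(x in `[a, b]) cabs (F' (x +i* y)) <= K.
Proof.
have /cvgrPdist_lt /(_ 1 ltr01) [d /= d0 dP] := mean_cvg.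
exists (Num.max (\int[mu]_(x in `[a, b]) cabs (q x) + 1) (4 * M / d * (b - a))) => y y0.
rewrite le_max; have [yd|yd] := ltP y d.
  apply/orP; left; have := dP y; rewrite /= sub0r normrN gtr0_norm// => /(_ yd y0).
  by rewrite distrC => /(le_lt_trans (ler_norm _)); lra.
apply/orP; right; apply: (@le_trans _ _ (\int[mu]_(x in `[a, b]) (4 * M / d))).
  apply: le_Rintegral => //.
  - exact: integrable_cabs (cintegrable_hline y0).
  - exact: integrable_cst_itv.
  move=> x _; have := @cauchy_estimate R (x +i* y) (F' (x +i* y)) (d / 2) M F.
  rewrite (_ : 2 * M / (d / 2) = 4 * M / d); last by field; rewrite gt_eqF.
  apply=> //; [by rewrite divr_gt0| |exact: dF].
  move=> z /andP[_ /andP[z1 _]]; exists (F' z); apply: dF; apply: lt_le_trans z1 => /=; lra.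
by rewrite (Rintegral_cst_itv _ (ltW ab)).
Qed.

End BoundaryMeans.

Section ConformalMeans.
Variables (G : set C) (Phi : C -> C) (a b M : R) (q : R -> C).
Hypothesis Phi_conf : conformal_onto (@unit_disk R) G Phi.
Hypothesis PhiM : forall z, closed_unit_disk z -> cabs (Phi z) <= M.
Hypothesis FM : forall w, cabs (strip Phi w) <= M.
Hypothesis ab : a < b.
Hypothesis iq : cintegrable `[a, b] q.
Hypothesis F'q :
  \int[mu]_(x in `[a, b]) cabs (strip' Phi (x +i* y) - q x) @[y --> 0^'+] --> (0 : R).

Let mab : measurable (`[a, b]%classic : set R). Proof. exact: measurable_itv. Qed.
Let dF := cdiff_strip Phi_conf.

(* [d/du Phi (e^{iu}) = i e^{iu} Phi'(e^{iu})] *)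
Definition boundary_derivative (u : R) : C := q u * ('i * cis u)^-1.

Let icis_neq0 u : 'i * cis u != 0 :> C.
Proof. by rewrite mulf_neq0// -cabs_gt0 ?cabs_cis// cabs_i. Qed.

Let cabs_icisV (u : R) : cabs (('i * cis u)^-1 : C) = 1.
Proof. by rewrite cabsV cabsM cabs_i cabs_cis mul1r invr1. Qed.

Lemma cabs_boundary_derivative u : cabs (boundary_derivative u) = cabs (q u).
Proof. by rewrite cabsM cabs_icisV mulr1. Qed.

Lemma derive1_expi w : derive1 Phi (expi w) = strip' Phi w * ('i * expi w)^-1.
Proof. by rewrite /strip' mulfK// mulf_neq0// ?expi_neq0// -cabs_gt0 cabs_i. Qed.

Lemma derive1_polar (r u : R) : 0 < r ->
  derive1 Phi (r%:C * cis u) = r^-1%:C * (strip' Phi (u +i* - ln r) * ('i * cis u)^-1).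
Proof.
move=> r0; rewrite polar_expi// derive1_expi -polar_expi// fmorphV /=.
have rC : r%:C != 0 :> C by rewrite -cabs_gt0 cabs_real gtr0_norm.
have := icis_neq0 u; rewrite mulf_eq0 negb_or => /andP[i0 c0].
by field; rewrite rC i0 c0.
Qed.

Lemma cabs_derive1_polar (r u : R) : 0 < r ->
  cabs (derive1 Phi (r%:C * cis u)) = r^-1 * cabs (strip' Phi (u +i* - ln r)).
Proof.
move=> r0; rewrite derive1_polar// cabsM cabs_real gtr0_norm ?invr_gt0//.
by rewrite [X in _ * X]cabsM cabs_icisV mulr1.
Qed.

Let opp_ln_gt0 (r : R) : 0 < r < 1 -> 0 < - ln r.
Proof. by move=> r01; rewrite oppr_gt0 ln_lt0. Qed.

Lemma cintegrable_boundary_derivative : cintegrable `]a, b[ boundary_derivative.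
Proof.
apply: (@cintegrableS _ `[a, b]%classic) => //; first exact: subset_itv_oo_cc.
apply: cintegrable_mul_cont => [|//|u _]; first exact: ltW.
apply: ccvgV => //; apply: ccvgM; first exact: ccvg_cst.
exact: continuous_cis.
Qed.

Lemma nontangential_derivative (u : R) :
  (forall k eta : R, 0 <= k -> 0 < eta -> exists2 d : R, 0 < d & forall w,
     0 < complex.Im w < d -> `|complex.Re w - u| <= k * complex.Im w ->
     cabs (strip' Phi w - q u) <= eta) ->
  nontangential_limit (derive1 Phi) (cis u) (boundary_derivative u).
Proof.
move=> H alpha /angle_log aP; have [k [k0 kP]] := aP u.
apply/cvgC => e e0; have e8 : 0 < e / 8 by rewrite divr_gt0.
have [d d0 dP] := H k (e / 8) k0 e8; have [r r0 rP] := kP d d0.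
have q1 : 0 < cabs (q u) + 1 by rewrite ltr_wpDl ?cabs_ge0.
rewrite near_withinE; apply/nbhsC.
exists (Num.min (Num.min 2^-1 r) (e / 8 / (cabs (q u) + 1))).
  by rewrite !lt_min r0 invr_gt0 ltr0n divr_gt0.
move=> z; rewrite !lt_min => /andP[/andP[z2 zr] zq] [zd za].
have [w [zw w0 wd wk]] := rP z zd za zr.
have Fq : cabs (strip' Phi w - q u) <= e / 8 by apply: dP => //; rewrite w0.
have z12 : 2^-1 <= cabs z.
  have := cabsD (cis u - z) z; rewrite subrK cabs_cis cabs_distC; lra.
have z0 : z != 0 by rewrite -cabs_gt0; lra.
have := icis_neq0 u; rewrite mulf_eq0 negb_or => /andP[i0 c0].
rewrite [in derive1 _ _]zw derive1_expi -zw /boundary_derivative.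
(* One error comes from [strip'], the other from replacing [z] by [cis u] in the chain-rule factor.
   Each is at most [e / 8], and division by [|z| >= 1 / 2] at most doubles them. *)
have -> : strip' Phi w * ('i * z)^-1 - q u * ('i * cis u)^-1 =
    ((strip' Phi w - q u) + q u * (cis u - z) * (cis u)^-1) * ('i * z)^-1.
  by field; rewrite i0 c0 z0.
rewrite cabsM cabsV [cabs ('i * z)]cabsM cabs_i mul1r ltr_pdivrMr; last lra.
apply: (@lt_le_trans _ _ (e * 2^-1)); last by rewrite ler_pM2l.
apply: le_lt_trans (cabsD _ _) _.
have : cabs (q u * (cis u - z) * (cis u)^-1) <= e / 8.
  rewrite !cabsM cabsV cabs_cis invr1 mulr1 cabs_distC.
  move: zq; rewrite ltr_pdivlMr// => zq; apply: le_trans (ltW zq).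
  by rewrite mulrC ler_wpM2l ?cabs_ge0// lerDl.
lra.
Qed.

Lemma circle_mean (r : R) : 0 < r < 1 ->
  (\int[mu]_(u in `]a, b[) (cabs (derive1 Phi (r%:C * cis u)))%:E)%E =
  (r^-1 * \int[mu]_(u in `[a, b]) cabs (strip' Phi (u +i* - ln r)))%:E.
Proof.
move=> r01; have r0 : 0 < r by case/andP: r01.
have iF := integrable_cabs mab (cintegrable_hline a b FM dF (opp_ln_gt0 r01)).
under eq_integral do rewrite cabs_derive1_polar//.
rewrite integral_itvoo; last first.
  by apply/measurable_EFinP/measurable_funM; [exact: measurable_cst|apply/measurable_EFinP; exact: measurable_int iF].
under eq_integral do rewrite EFinM.
by rewrite integralZl// EFin_Rintegral.
Qed.

(** For [r >= 1 / 2] the factor [1 / r] is at most 2. For smaller [r] a square of half-side [1 / 4]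
    around the point lies in the disk, and the Cauchy estimate gives [2 * M / (1 / 4) = 8 * M]. *)
Lemma circle_mean_bounded : exists K : R, forall r : R, 0 < r < 1 ->
  (\int[mu]_(u in `]a, b[) (cabs (derive1 Phi (r%:C * cis u)))%:E <= K%:E)%E.
Proof.
have [K KP] := mean_bounded ab FM dF iq F'q.
exists (Num.max (2 * K) (8 * M * (b - a))) => r r01; have r0 : 0 < r by case/andP: r01.
have [r2|r2] := leP 2^-1 r.
  rewrite circle_mean// lee_fin le_max; apply/orP; left.
  have KF := KP _ (opp_ln_gt0 r01).
  apply: ler_pM => //; first by rewrite invr_ge0 ltW.
    by apply: Rintegral_ge0 => u _; exact: cabs_ge0.
  by rewrite -[2]invrK lef_pV2 ?posrE ?invr_gt0.
have B u : cabs (derive1 Phi (r%:C * cis u)) <= 8 * M.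
  have rd : unit_disk (r%:C * cis u : C).
    by rewrite /unit_disk /= cabsM cabs_cis mulr1 cabs_real gtr0_norm//; case/andP: r01.
  have d4 : (0 : R) < 4^-1 by rewrite invr_gt0.
  have -> : 8 * M = 2 * M / 4^-1 by field.
  have sd z : inrect (complex.Re (r%:C * cis u : C) - 4^-1) (complex.Re (r%:C * cis u : C) + 4^-1)
      (complex.Im (r%:C * cis u : C) - 4^-1) (complex.Im (r%:C * cis u : C) + 4^-1) z -> unit_disk z.
    move=> /andP[zR zI]; rewrite /unit_disk /= -[z](subrK (r%:C * cis u)).
    apply: le_lt_trans (cabsD _ _) _; rewrite [cabs (_ * cis u)]cabsM cabs_cis mulr1 cabs_real gtr0_norm//.
    apply: (@le_lt_trans _ _ (4^-1 + 4^-1 + r)); last by lra.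
    rewrite lerD2r; apply: le_trans (cabs_le_ReIm _) _; rewrite ReD ReN ImD ImN.
    by apply: lerD; rewrite ler_distl.
  apply: (cauchy_estimate d4 (f := Phi)).
  - by move=> z /sd zd; exists (derive1 Phi z); exact: (cdiff_conformal Phi_conf).
  - by move=> z /sd zd; apply: PhiM; exact: ltW.
  - exact: (cdiff_conformal Phi_conf).
rewrite circle_mean// lee_fin le_max; apply/orP; right.
rewrite mulrC ler_pdivrMr//.
rewrite (_ : 8 * M * (b - a) * r = 8 * M * r * (b - a)); last by ring.
rewrite -(Rintegral_cst_itv _ (ltW ab)).
apply: le_Rintegral => //.
- exact: integrable_cabs (cintegrable_hline a b FM dF (opp_ln_gt0 r01)).
- exact: integrable_cst_itv.
- by move=> u _; have := B u; rewrite cabs_derive1_polar// mulrC ler_pdivrMr.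
Qed.

Lemma circle_mean_cvg :
  (\int[mu]_(u in `]a, b[) (cabs (derive1 Phi (r%:C * cis u)))%:E)%E @[r --> (1 : R)^'-] -->
  (\int[mu]_(u in `]a, b[) (cabs (boundary_derivative u))%:E)%E.
Proof.
under eq_integral do rewrite cabs_boundary_derivative.
have iqc := integrable_cabs mab iq.
rewrite integral_itvoo; last exact: measurable_int iqc.
rewrite EFin_Rintegral//.
have n0 : \forall r \near (1 : R)^'-, 0 < r < 1.
  have n1 : \forall r \near (1 : R)^'-, r < 1 by exact: nbhs_left_lt.
  have n2 : \forall r \near (1 : R)^'-, 0 < r by exact: nbhs_left_gt.
  by apply: filterS2 n1 n2 => r -> ->.
apply: (cvg_trans _ (_ : ((r^-1 * \int[mu]_(u in `[a, b]) cabs (strip' Phi (u +i* - ln r)))%:E)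
   @[r --> (1 : R)^'-] --> _)).
  by apply: near_eq_cvg; apply: filterS n0 => r r01; rewrite circle_mean.
apply: cvg_EFin; first exact: nearW.
rewrite -[X in _ --> X]mul1r; apply: cvgM.
  exact: cvg_invr1.
exact: (cvg_comp _ (fun y => \int[mu]_(u in `[a, b]) cabs (strip' Phi (u +i* y))) cvg_opp_ln (mean_cvg FM dF iq F'q)).
Qed.

(** The factor [1 / r] of the polar derivative adds an error of at most [(1 / r - 1) * |q|] to the
    convergence on horizontal lines. *)
Lemma circle_mean_dist_cvg :
  (\int[mu]_(u in `]a, b[) (cabs (derive1 Phi (r%:C * cis u) - boundary_derivative u))%:E)%E
    @[r --> (1 : R)^'-] --> 0%E.
Proof.
have n1 : \forall r \near (1 : R)^'-, r < 1 by exact: nbhs_left_lt.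
have n2 : \forall r \near (1 : R)^'-, 0 < r by exact: nbhs_left_gt.
pose D r := \int[mu]_(u in `[a, b]) cabs (strip' Phi (u +i* - ln r) - q u).
pose I := \int[mu]_(u in `[a, b]) cabs (q u).
have Ecvg : (r^-1 * D r + (r^-1 - 1) * I)%:E @[r --> (1 : R)^'-] --> 0%E.
  apply: cvg_EFin; first exact: nearW.
  rewrite [X in _ --> X](_ : 0 = 1 * 0 + (1 - 1) * I); last by rewrite subrr mul0r mulr0 addr0.
  apply: cvgD; last by apply: cvgM; [apply: cvgB; [exact: cvg_invr1|exact: cvg_cst]|exact: cvg_cst].
  apply: cvgM; first exact: cvg_invr1.
  exact: (cvg_comp _ (fun y => \int[mu]_(x in `[a, b]) cabs (strip' Phi (x +i* y) - q x)) cvg_opp_ln F'q).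
apply: (squeeze_cvge _ (cvg_cst 0%E) Ecvg).
apply: filterS2 n1 n2 => r r1 r0; have r01 : 0 < r < 1 by rewrite r0.
have y0 := opp_ln_gt0 r01; have iF := cintegrable_hline a b FM dF y0.
have iD := integrable_cabs mab (cintegrableB mab iF iq); have iQ := integrable_cabs mab iq.
have rV1 : 0 <= r^-1 - 1 by rewrite subr_ge0 invf_ge1// ltW.
pose f u := cabs (r^-1%:C * strip' Phi (u +i* - ln r) - q u).
have iF1 : cintegrable `[a, b] (fun u => r^-1%:C * strip' Phi (u +i* - ln r)) by exact: cintegrableZ.
have fi : mu.-integrable `[a, b] (EFin \o f) by apply: integrable_cabs => //; exact: cintegrableB.
rewrite integral_ge0/=; last by move=> u _; rewrite lee_fin cabs_ge0.
have -> : (\int[mu]_(u in `]a, b[) (cabs (derive1 Phi (r%:C * cis u) - boundary_derivative u))%:E =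
    \int[mu]_(u in `]a, b[) (f u)%:E)%E.
  apply: eq_integral => u _; rewrite derive1_polar// /boundary_derivative mulrA -mulrBl cabsM cabs_icisV mulr1.
  by [].
rewrite integral_itvoo; last exact: measurable_int fi.
rewrite EFin_Rintegral// lee_fin /D /I -(Rintegral_lincomb r^-1 (r^-1 - 1) mab iD iQ).
apply: le_Rintegral => //; first exact: (integrable_lincomb r^-1 (r^-1 - 1) mab iD iQ).
move=> u _ /=; rewrite /f.
have -> : r^-1%:C * strip' Phi (u +i* - ln r) - q u =
    r^-1%:C * (strip' Phi (u +i* - ln r) - q u) + (r^-1 - 1)%:C * q u.
  by rewrite rmorphB /=; ring.
apply: le_trans (cabsD _ _) _.
by rewrite !cabsM !cabs_real gtr0_norm ?invr_gt0// ger0_norm.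
Qed.

Lemma circle_length (r : R) : 0 < r < 1 ->
  curve_length (fun u => Phi (r%:C * cis u)) `[a, b] =
  (\int[mu]_(u in `[a, b]) cabs (strip' Phi (u +i* - ln r)))%:E.
Proof.
move=> r01; have r0 : 0 < r by case/andP: r01.
have y0 := opp_ln_gt0 r01; have iF := cintegrable_hline a b FM dF y0.
have iFc := integrable_cabs mab iF.
have -> : (fun u => Phi (r%:C * cis u)) = fun u => strip Phi (u +i* - ln r).
  by apply/funext => u; rewrite strip_upper ?ltW// polar_expi.
rewrite (@curve_length_density _ _ (fun u => strip' Phi (u +i* - ln r)))//.
  rewrite integral_itvoo; last exact: measurable_int iFc.
  by rewrite EFin_Rintegral.
split=> // s t _ st _.
rewrite (cint_FTC (f := fun u => strip Phi (u +i* - ln r)) st)// => u _.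
  by apply: pcont_hline; exact: derivative_cont FM dF _.
by apply: rdiff_hline; exact: dF.
Qed.

Lemma circle_length_cvg :
  curve_length (fun u => Phi (r%:C * cis u)) `[a, b] @[r --> (1 : R)^'-] -->
  (\int[mu]_(u in `]a, b[) (cabs (boundary_derivative u))%:E)%E.
Proof.
under eq_integral do rewrite cabs_boundary_derivative.
have iqc := integrable_cabs mab iq.
rewrite integral_itvoo; last exact: measurable_int iqc.
rewrite EFin_Rintegral//.
have n1 : \forall r \near (1 : R)^'-, r < 1 by exact: nbhs_left_lt.
have n2 : \forall r \near (1 : R)^'-, 0 < r by exact: nbhs_left_gt.
apply: (cvg_trans _ (_ : (\int[mu]_(u in `[a, b]) cabs (strip' Phi (u +i* - ln r)))%:E
   @[r --> (1 : R)^'-] --> _)).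
  by apply: near_eq_cvg; apply: filterS2 n1 n2 => r r1 r0; rewrite circle_length// r0.
apply: cvg_EFin; first exact: nearW.
exact: (cvg_comp _ (fun y => \int[mu]_(u in `[a, b]) cabs (strip' Phi (u +i* y))) cvg_opp_ln (mean_cvg FM dF iq F'q)).
Qed.

End ConformalMeans.
End CircularMeans.

(** * Return to the disk and to the arc *)

Theorem corollary3p1p1 (R : realType)
  (gamma : set R[i]) (h : R[i] -> R[i]) (gammaP : jordan_curve gamma h)
  (G : set R[i]) (GP : interior_of_jordan_curve gamma G)
  (J : set R[i]) (s t : R) (st : s < t) (JP : arc_of h `]s, t[ J)
  (Jrect : (curve_length (h \o @cis R) `]s, t[ < +oo)%E)
  (J' : set R[i]) (s' t' : R) (st' : s' < t') (JP' : arc_of h `[s', t'] J')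
  (J'J : J' `<=` J)
  (Phi : R[i] -> R[i])
  (Phi_conf : conformal_onto (@unit_disk R) G Phi)
  (Phi_homeo : homeomorphism_onto (@closed_unit_disk R) (closure G) Phi)
  (a b : R) (ab : a < b) (ba : b < a + 2 * pi)
  (J'ab : J' = [set Phi (cis u) | u in `[a, b]]) :
  let mu := @lebesgue_measure R in
  let dPhi : R[i] -> R[i] := derive1 Phi in
  (exists M : R, forall r : R, 0 < r < 1 ->
    (\int[mu]_(u in `]a, b[) (cabs (dPhi (r%:C * cis u)))%:E <= M%:E)%E) /\
  exists dPhib : R -> R[i],
    [/\ {ae mu, forall u, u \in `]a, b[ ->
           nontangential_limit dPhi (cis u) (dPhib u)},
        {ae mu, forall u, u \in `]a, b[ -> dPhib u != 0},
        cintegrable `]a, b[ dPhib,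
        (\int[mu]_(u in `]a, b[)
            (cabs (dPhi (r%:C * cis u) - dPhib u))%:E)%E
          @[r --> 1^'-] --> 0%E &
        [/\ curve_length (h \o @cis R) `[s', t'] =
              (\int[mu]_(u in `]a, b[) (cabs (dPhib u))%:E)%E,
            (\int[mu]_(u in `]a, b[) (cabs (dPhi (r%:C * cis u)))%:E)%E
              @[r --> 1^'-] --> curve_length (h \o @cis R) `[s', t'] &
            curve_length (fun u => Phi (r%:C * cis u)) `[a, b]
              @[r --> 1^'-] --> curve_length (h \o @cis R) `[s', t']]].
Proof.
move=> mu dPhi.
have [Gb _] := GP.
have [M [PhiM FM]] := conformal_bounded Gb Phi_homeo.
have dF := cdiff_strip Phi_conf; have cF := strip_cont Phi_homeo.
have JPhi u : u \in `[a, b] -> J (Phi (cis u)).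
  by move=> uab; apply: J'J; rewrite J'ab; exists u.
have [e [L [e0 _ FL]]] := arc_extension gammaP GP JP Phi_conf Phi_homeo ab ba JPhi Jrect.
have aeb : a - e < b + e by lra.
have [q iqT qE] : exists2 q : R -> R[i], cintegrable setT q & forall s t, a - e < s -> s <= t ->
    t < b + e -> strip Phi (t +i* 0) - strip Phi (s +i* 0) = cint `[s, t] q.
  apply: (riesz_density aeb (ltr01 : 0 < 1 :> R) (M := M) (L := L)) => //.
    by split=> [z _|z _ z0]; [exact: cF|exists (strip' Phi z); exact: dF].
  move=> l sl lab; have := FL l sl lab.
  by rewrite (_ : (fun t => strip Phi (t +i* 0)) = fun u => Phi (cis u))//; apply/funext => u; rewrite strip_real.
(* The density is known strictly inside []a - e, b + e[], so half of the room is given up here; the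
   other half is the margin of [strip_boundary_values], which ends exactly at [[a, b]]. *)
pose a1 := a - e / 2; pose b1 := b + e / 2.
have a1b1 : a1 < b1 by rewrite /a1 /b1; lra.
have e2 : 0 < e / 2 by rewrite divr_gt0.
have hd1 : has_density (fun t => strip Phi (t +i* 0)) q a1 b1.
  split; first by apply: cintegrableS iqT.
  by move=> x y; rewrite /a1 /b1 => ax xy yb; apply: qE => //; lra.
have [nt F'q] := strip_boundary_values a1b1 e2 FM cF dF hd1.
rewrite /a1 /b1 subrK addrK in nt F'q.
have iq : cintegrable `[a, b] q by apply: cintegrableS iqT.
have hd : has_density (Phi \o @cis R) q a b.
  split=> // x y ax xy yb /=; rewrite -!strip_real; apply: qE => //; lra.
have nz : {ae mu, forall u, a1 < u < b1 -> q u != 0}.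
  apply: (boundary_nonzero FM cF _ _ hd1); first by move=> z z0; exists (strip' Phi z); exact: dF.
  exact: strip_inj Phi_conf.
split; first exact: (circle_mean_bounded Phi_conf PhiM FM ab iq F'q).
exists (boundary_derivative q); split.
- apply: ae_imply nt => u H; rewrite in_itv /= => uab.
  exact: nontangential_derivative (H uab).
- apply: ae_imply nz => u H; rewrite in_itv /= => uab.
  rewrite -cabs_gt0 cabs_boundary_derivative cabs_gt0 H//.
  by move: uab => /andP[au ub]; rewrite /a1 /b1; apply/andP; split; lra.
- exact: cintegrable_boundary_derivative.
- exact: (circle_mean_dist_cvg Phi_conf FM iq F'q).
have E : curve_length (h \o @cis R) `[s', t'] =
    (\int[mu]_(u in `]a, b[) (cabs (boundary_derivative q u))%:E)%E.
  rewrite -(arc_length_eq gammaP GP Phi_conf Phi_homeo ab ba st' JP' J'ab).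
  rewrite (curve_length_density ab hd).
  by under [in RHS]eq_integral do rewrite cabs_boundary_derivative.
split; first exact: E.
- by rewrite E; exact: (circle_mean_cvg Phi_conf FM iq F'q).
- by rewrite E; exact: (circle_length_cvg Phi_conf FM ab iq F'q).
Qed.
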